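(* For every integer $d\geqslant 5$, $QP_5^+((3)|^d)$ is an $\mathbb F_2$-vector space of dimension $90$, and $\dim QP_5((3)|^d) = 155$.
   Context: $P_5=\mathbb F_2[x_1,\dots,x_5]$ with $\deg x_i=1$, a module over the mod-2 Steenrod algebra $\mathcal A$ with augmentation ideal $\mathcal A^+$. For a monomial $x=x_1^{a_1}\cdots x_5^{a_5}$, its weight vector is $\omega(x)=(\omega_1(x),\omega_2(x),\dots)$ with $\omega_i(x)=\sum_j\alpha_{i-1}(a_j)$, $\alpha_r(a)$ the $r$-th binary digit of $a$; weight vectors are ordered left-lexicographically, and $\deg\omega=\sum_i2^{i-1}\omega_i$. For a weight vector $\omega$, $P_5(\omega)$ is spanned by monomials $y$ with $\deg y=\deg\omega$ and $\omega(y)\le\omega$, and $P_5^-(\omega)$ by those with $\omega(y)<\omega$. $QP_5(\omega)$ is the quotient of $P_5(\omega)$ by the relation $f\equiv_\omega g \iff f+g\in\mathcal A^+P_5+P_5^-(\omega)$. $QP_5^+(\omega)$ is the subspace of $QP_5(\omega)$ spanned by the classes of monomials $x_1^{a_1}\cdots x_5^{a_5}\in P_5(\omega)$ with $a_1a_2\cdots a_5>0$. $(3)|^d$ denotes the weight vector $(3,3,\dots,3,0,0,\dots)$ with $d$ entries equal to $3$. *)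

(* Defs.v *)
From mathcomp Require Import all_boot all_order all_algebra.
From mathcomp Require Import mpoly.
Set Implicit Arguments. Unset Strict Implicit. Unset Printing Implicit Defensive.
Import GRing.Theory.
Local Open Scope ring_scope.

Notation P5 := {mpoly 'F_2[5]}.

(* Action of Sq^k on a monomial x^m (Cartan formula + Sq^k(x^a) = C(a,k) x^(a+k)):
   Sq^k(x_1^a_1...x_5^a_5) = sum_{k_1+...+k_5=k} prod_j C(a_j,k_j) x_j^(a_j+k_j). *)
Definition Sq_mon (k : nat) (m : 'X_{1..5}) : P5 :=
  \sum_(t : {ffun 'I_5 -> 'I_k.+1} | (\sum_(j < 5) (t j : nat))%N == k)
     ((\prod_(j < 5) 'C(m j, t j))%N)%:R *: 'X_[(m + [multinom (t j : nat) | j < 5])%MM].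

Definition Sq (k : nat) (p : P5) : P5 :=
  \sum_(m <- msupp p) p@_m *: Sq_mon k m.

(* A^+ P_5 : the image of the augmentation ideal, i.e. the span of the
   images Sq^k(P_5), k >= 1 (A^+ is spanned by the Sq^{i_1}...Sq^{i_r}, r>=1, i_j>=1). *)
Definition AplusP (p : P5) : Prop :=
  exists s : seq (nat * P5), all (fun x => (0 < x.1)%N) s /\
    p = \sum_(x <- s) Sq x.1 x.2.

(* Weight vector of a monomial, 0-indexed: omega m i = omega_{i+1}(x^m)
   = sum_j alpha_i(a_j), alpha_i(a) = i-th binary digit of a. *)
Definition omega (m : 'X_{1..5}) (i : nat) : nat :=
  (\sum_(j < 5) odd (m j %/ 2 ^ i))%N.

(* Weight vectors as finite lists (trailing zeros implicit), 0-indexed. *)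
Definition wv (w : seq nat) (i : nat) : nat := nth 0%N w i.

(* deg omega = sum_i 2^(i-1) omega_i (1-indexed), i.e. sum_i 2^i (wv w i). *)
Definition degw (w : seq nat) : nat := (\sum_(i < size w) 2 ^ i * wv w i)%N.

Definition wlt (u v : nat -> nat) : Prop :=
  exists k, (forall i, (i < k)%N -> u i = v i) /\ (u k < v k)%N.
Definition wle (u v : nat -> nat) : Prop := (forall i, u i = v i) \/ wlt u v.

Definition three_d (d : nat) : seq nat := nseq d 3%N.

Definition inP (w : seq nat) (p : P5) : Prop :=
  forall m, m \in msupp p -> mdeg m = degw w /\ wle (omega m) (wv w).
Definition inPminus (w : seq nat) (p : P5) : Prop :=
  forall m, m \in msupp p -> mdeg m = degw w /\ wlt (omega m) (wv w).

Definition equivw (w : seq nat) (f g : P5) : Prop :=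
  exists h q, AplusP h /\ inPminus w q /\ f + g = h + q.

(* dim QP_5(omega) = n : there are n elements of P_5(omega) whose classes
   form a basis of QP_5(omega) = P_5(omega) / ==_omega. *)
Definition dimQP (w : seq nat) (n : nat) : Prop :=
  exists b : 'I_n -> P5,
    (forall i, inP w (b i)) /\
    (forall c : 'I_n -> 'F_2, equivw w (\sum_(i < n) c i *: b i) 0 -> forall i, c i = 0) /\
    (forall f, inP w f -> exists c : 'I_n -> 'F_2, equivw w f (\sum_(i < n) c i *: b i)).

Definition posmon (m : 'X_{1..5}) : bool := [forall j : 'I_5, (0 < m j)%N].

(* dim QP_5^+(omega) = n : QP_5^+(omega) is the subspace of QP_5(omega)
   spanned by the classes of monomials x^m in P_5(omega) with all exponents
   positive; we give n elements of the span of such monomials whose classes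
   are linearly independent and span that subspace. *)
Definition dimQPplus (w : seq nat) (n : nat) : Prop :=
  exists b : 'I_n -> P5,
    (forall i, inP w (b i) /\ forall m, m \in msupp (b i) -> posmon m) /\
    (forall c : 'I_n -> 'F_2, equivw w (\sum_(i < n) c i *: b i) 0 -> forall i, c i = 0) /\
    (forall m : 'X_{1..5}, posmon m -> inP w 'X_[m] ->
       exists c : 'I_n -> 'F_2, equivw w 'X_[m] (\sum_(i < n) c i *: b i)).

(* Main.v *)
(** A monomial of weight [(3)|^d] is a word of [d] letters, the [i]-th letter
    being the 3-subset of the variables whose exponent has [i]-th binary digit 1.

    Lower bound.  A 3-dimensional subspace [W] of [F_2^5], given by five linear
    forms [l_j] in three variables, yields the functional sending [f] to the
    coefficient of [(y_0 y_1 y_2)^(2^d-1)] in [f(l_1, ..., l_5)].  It kills all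
    hits, because substitution commutes with the total square and that monomial
    is a spike, and it kills lower weights; on a word it is the product of the
    Pluecker coordinates of [W] at the letters.  There are 155 subspaces, 90 of
    them in no coordinate hyperplane, and already the words of length 5 take
    independent values on them.

    Upper bound.  Modulo hits and lower weights, [Sq^1] yields the (ordered)
    Pluecker relations between two adjacent letters and their variant with the
    first letter doubled; such relations may be multiplied by words on both
    sides.  They force words of length at least 4 to be commutative, and those
    of length at least 5 to depend on their set of letters only.  The resulting
    squarefree Pluecker relations reduce all sets of letters to 155 of them,
    those covering all variables to 90. *)

Require Import Defs.
From mathcomp Require Import all_boot all_order all_algebra.
From mathcomp Require Import mpoly zify ring.
Set Implicit Arguments. Unset Strict Implicit. Unset Printing Implicit Defensive.
Import GRing.Theory.
Local Open Scope ring_scope.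


(** * Total squares *)

(** The constants: [F_2^5] has 155 subspaces of dimension 3 (a Gaussian binomial coefficient), and
    inclusion-exclusion over the coordinate hyperplanes leaves 155 - 5*15 + 10 = 90 of them. On the
    side of words, a nonempty set of letters misses a variable exactly when the complementary edges
    of K5 all pass through one vertex. There are 5*15 - 10 = 65 such sets; no Pluecker relation
    contains one, since it consists of pairs of disjoint edges. The obstacle is that the relations
    concern ordered words of every length, while only finite computations can be checked. Relations
    are therefore certified in lengths 3 to 5, for all relabellings and all suffixes at once.
    Prefixes are added afterwards, since [x^e f^2] is hit whenever [f] is; suffixes follow no such
    rule here and are carried along from the four basic relations onwards. The bound on [d] comes
    from three places: reordering takes 4 letters, forgetting multiplicities takes 5, and the sets
    in the basis have up to 5 letters. *)

(** Truncation gives all factors the same finite index range, so that the product can be distributed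
    in [coef_prod] over the very index set used by [Sq_mon]. *)
Lemma coef_prod_trunc (R : comNzRingType) (I : Type) (r : seq I) (p : I -> {poly R}) k N :
  (k < N)%N ->
  (\prod_(i <- r) p i)`_k = (\prod_(i <- r) (\poly_(j < N) (p i)`_j))`_k.
Proof.
elim: r k => [|i r IH] k kN; first by rewrite !big_nil.
rewrite !big_cons !coefM; apply: eq_bigr => j _.
have jN : (j < N)%N by apply: leq_trans kN; rewrite ltnS -ltnS.
by rewrite coef_poly jN IH //; apply: leq_ltn_trans kN; apply: leq_subr.
Qed.

Lemma coef_prod (R : comNzRingType) n (p : 'I_n -> {poly R}) k :
  (\prod_(i < n) p i)`_k =
  \sum_(t : {ffun 'I_n -> 'I_k.+1} | (\sum_(j < n) (t j : nat))%N == k)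
    \prod_(i < n) (p i)`_(t i).
Proof.
rewrite (@coef_prod_trunc _ _ _ _ k k.+1) //.
under eq_bigr do rewrite poly_def.
rewrite bigA_distr_bigA coef_sum /= [RHS]big_mkcond /=.
apply: eq_bigr => t _.
have -> : \prod_(i < n) ((p i)`_(t i) *: 'X^(t i)) =
  (\prod_(i < n) (p i)`_(t i)) *: 'X^(\sum_(i < n) (t i : nat))%N.
  elim/big_rec3: _ => [|i x y z _ ->]; first by rewrite expr0 alg_polyC.
  by rewrite exprD -scalerAl -scalerAr scalerA.
by rewrite coefZ coefXn eq_sym; case: eqP; rewrite ?mulr1 ?mulr0.
Qed.

(* The value of the total square [sum_k Sq^k t^k] on a monomial. *)
Definition totSq n (m : 'X_{1..n}) : {poly {mpoly 'F_2[n]}} :=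
  \prod_(i < n) (('X_i)%:P + ('X_i ^+ 2)%:P * 'X) ^+ m i.

(** [Sq_mon] in any number of variables; the functionals need it in three. At [n = 5] the two are
    convertible, which later proofs use silently. *)
Definition SqX n k (m : 'X_{1..n}) : {mpoly 'F_2[n]} :=
  \sum_(t : {ffun 'I_n -> 'I_k.+1} | (\sum_(j < n) (t j : nat))%N == k)
     ((\prod_(j < n) 'C(m j, t j))%N)%:R *: 'X_[(m + [multinom (t j : nat) | j < n])%MM].

(** Each factor is [X^a (1 + X t)^a], whose coefficient at [t^k] is [C(a,k) X^(a+k)]. *)
Lemma coef_totSq n (m : 'X_{1..n}) k : (totSq m)`_k = SqX k m.
Proof.
rewrite coef_prod; apply: eq_bigr => t _.
have coefi i : ((('X_i : {mpoly 'F_2[n]})%:P + ('X_i ^+ 2)%:P * 'X) ^+ m i)`_(t i) =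
    'X_i ^+ (m i + t i) *+ 'C(m i, t i).
  have -> : (('X_i : {mpoly 'F_2[n]})%:P + ('X_i ^+ 2)%:P * 'X) =
            ('X_i)%:P * ('X_i *: 'X + 1%:P).
    by rewrite mulrDr mulr1 addrC -mul_polyC mulrA -polyCM expr2.
  rewrite exprMn -polyC_exp coefCM.
  rewrite (_ : 'X_i *: 'X + 1%:P = 1 + 'X_i *: 'X); last by rewrite addrC.
  rewrite exprDn coef_sum.
  under eq_bigr do rewrite expr1n mul1r exprZn coefMn coefZ coefXn.
  case: (ltnP (t i) (m i).+1) => tm.
    rewrite (bigD1 (Ordinal tm)) //= eqxx mulr1 big1 ?addr0.
      by rewrite mulrnAr exprD.
    move=> j; rewrite -val_eqE /= eq_sym => /negbTE ->.
    by rewrite mulr0 mul0rn.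
  rewrite big1 ?mulr0 ?bin_small ?mulr0n // => j _.
  by rewrite gtn_eqF ?mulr0 ?mul0rn // (leq_trans (ltn_ord j)).
under eq_bigr do rewrite coefi -mulr_natr.
rewrite big_split /= -natr_prod mulr_natr scaler_nat mpolyXE_id.
by congr (_ *+ _); apply: eq_bigr => i _; rewrite mnmDE mnmE.
Qed.

(** This is the Cartan formula, and the reason for working with generating polynomials. *)
Lemma totSqD n (m1 m2 : 'X_{1..n}) : totSq (m1 + m2) = totSq m1 * totSq m2.
Proof. by rewrite -big_split; apply: eq_bigr => i _; rewrite mnmDE exprD. Qed.

Lemma pchar_mpolyF2 n : 2 \in [pchar {mpoly 'F_2[n]}].
Proof. by rewrite (rmorph_pchar (@mpolyC n 'F_2)) // pchar_Fp. Qed.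

Lemma addpp n (p : {mpoly 'F_2[n]}) : p + p = 0.
Proof. exact: addrr_pchar2 (pchar_mpolyF2 n) p. Qed.

Lemma F2_sqr (c : 'F_2) : c ^+ 2 = c.
Proof. by case: c => [[|[|]]] // i; apply/val_inj. Qed.

Lemma mpoly_sqr n (p : {mpoly 'F_2[n]}) :
  p ^+ 2 = \sum_(m <- msupp p) p@_m *: 'X_[m *+ 2].
Proof.
rewrite -(pFrobenius_autE (pchar_mpolyF2 n)) {1}[p]mpolyE rmorph_sum /=.
by apply: eq_bigr => m _; rewrite pFrobenius_autE exprZn F2_sqr mpolyXn.
Qed.

Lemma poly_sqr_pchar2 (R : comNzRingType) (p : {poly R}) k : 2 \in [pchar R] ->
  (p ^+ 2)`_k = if odd k then 0 else p`_(k./2) ^+ 2.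
Proof.
move=> chR; have ch : 2 \in [pchar {poly R}].
  by rewrite (rmorph_pchar (polyC : {rmorphism R -> _})).
elim/poly_ind: p k => [|p c IH] k.
  by rewrite expr0n /= !coef0 expr0n if_same.
have -> : (p * 'X + c%:P) ^+ 2 = p ^+ 2 * 'X * 'X + (c ^+ 2)%:P.
  by rewrite -(pFrobenius_autE ch) rmorphD /= !pFrobenius_autE exprMn polyC_exp -mulrA.
rewrite coefD !coefMX coefC.
case: k => [|[|k]] //=.
- by rewrite coefD coefMX coefC /= !add0r.
- by rewrite addr0.
rewrite addr0 IH negbK; case: odd => //.
by rewrite coefD coefMX coefC /= addr0.
Qed.

(** Applied to [totSq m], this says that odd squares kill [y^2] and that
    [Sq^(2k)(y^2) = (Sq^k y)^2]. *)
Lemma poly_sqr n (p : {poly {mpoly 'F_2[n]}}) k :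
  (p ^+ 2)`_k = if odd k then 0 else p`_(k./2) ^+ 2.
Proof. exact: poly_sqr_pchar2 (pchar_mpolyF2 n). Qed.


(** * Hit elements modulo lower weight *)

(** Numerical form of the recursion behind all inductions on [d]: a first letter of degree 3, plus
    twice a shorter word. *)
Lemma degw_threeS d : degw (three_d d.+1) = (3 + (degw (three_d d)).*2)%N.
Proof.
rewrite /degw /three_d !size_nseq big_ord_recl /= expn0 mul1n.
congr (_ + _)%N; rewrite -mul2n big_distrr /=; apply: eq_bigr => i _.
by rewrite /wv /= /bump /= add1n expnS mulnA.
Qed.

Definition squarefree n (e : 'X_{1..n}) := forall j, (e j <= 1)%N.

Lemma mdeg_squarefree n (e : 'X_{1..n}) :
  squarefree e -> (\sum_(j < n) odd (e j))%N = mdeg e.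
Proof.
by move=> e01; rewrite mdegE; apply: eq_bigr => j _; case: (e j) (e01 j) => [|[]].
Qed.

Lemma omega0 (m : 'X_{1..5}) : omega m 0 = (\sum_(j < 5) odd (m j))%N.
Proof. by apply: eq_bigr => j _; rewrite expn0 divn1. Qed.

Lemma omegaS (e m : 'X_{1..5}) i :
  squarefree e -> omega (e + m *+ 2) i.+1 = omega m i.
Proof.
move=> e01; apply: eq_bigr => j _; rewrite mnmDE mulmnE expnS divnMA.
by rewrite addnC divnMDl // (@divn_small (e j) 2) ?addn0 //; apply: e01.
Qed.

Lemma omega_add0 (e m : 'X_{1..5}) :
  omega (e + m *+ 2) 0 = (\sum_(j < 5) odd (e j))%N.
Proof.
rewrite omega0; apply: eq_bigr => j _.
by rewrite mnmDE mulmnE oddD oddM andbF addbF.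
Qed.

Definition low d (m : 'X_{1..5}) :=
  mdeg m = degw (three_d d) /\ wlt (omega m) (wv (three_d d)).

Lemma low_first d (m : 'X_{1..5}) : mdeg m = degw (three_d d.+1) ->
  (\sum_(j < 5) odd (m j) < 3)%N -> low d.+1 m.
Proof. by move=> dm lt3; split=> //; exists 0%N; split=> //; rewrite omega0. Qed.

(** A full letter in front puts a 3 at the head of the weight vector and shifts the rest, so the
    first deficient place moves from [k] to [k.+1]. *)
Lemma low_next d (e m : 'X_{1..5}) :
  squarefree e -> mdeg e = 3%N -> low d m -> low d.+1 (e + m *+ 2).
Proof.
move=> e01 e3 [dm [k [eqk ltk]]]; split.
  by rewrite mdegD mdegMn e3 dm degw_threeS muln2.
exists k.+1; split; last by rewrite omegaS.
case=> [|i] ik; first by rewrite omega_add0 mdeg_squarefree.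
by rewrite omegaS // eqk.
Qed.

(** * Supports of polynomials as predicates on monomials *)

Section Span.
Variables (n : nat) (P : 'X_{1..n} -> Prop).
Definition supported (p : {mpoly 'F_2[n]}) := forall m, m \in msupp p -> P m.

Lemma supported0 : supported 0.
Proof. by move=> m; rewrite msupp0. Qed.

Lemma supportedX m : P m -> supported 'X_[m].
Proof. by move=> Pm m'; rewrite msuppX inE => /eqP ->. Qed.

Lemma supportedD p q : supported p -> supported q -> supported (p + q).
Proof. by move=> Pp Pq m /msuppD_le; rewrite mem_cat => /orP[/Pp|/Pq]. Qed.

Lemma supportedZ c p : supported p -> supported (c *: p).
Proof. by move=> Pp m /msuppZ_le /Pp. Qed.

Lemma supported_sum (I : Type) (r : seq I) (Q : pred I) F :
  (forall i, Q i -> supported (F i)) -> supported (\sum_(i <- r | Q i) F i).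
Proof. by move=> PF; apply: big_ind => //; [apply: supported0|apply: supportedD]. Qed.
End Span.

Lemma supportedM n (P Q R : 'X_{1..n} -> Prop) p q :
  supported P p -> supported Q q ->
  (forall a b, P a -> Q b -> R (a + b)%MM) -> supported R (p * q).
Proof.
by move=> Pp Qq PQ m /msuppM_le /allpairsP [[a b] /= [/Pp Pa /Qq Qb ->]]; apply: PQ.
Qed.

Lemma supported_sqr n (P Q : 'X_{1..n} -> Prop) p :
  supported P p -> (forall m, P m -> Q (m *+ 2)%MM) -> supported Q (p ^+ 2).
Proof.
move=> Pp PQ; rewrite mpoly_sqr big_seq; apply: supported_sum => m /Pp Pm.
by apply: supportedZ; apply: supportedX; apply: PQ.
Qed.

(** The bound on [t] holds because a binomial coefficient vanishes otherwise. For squarefree [m] it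
    means that every raised exponent goes from 1 to 2, hence becomes even. *)
Lemma SqX_supported n k (m : 'X_{1..n}) : supported (fun m' =>
   mdeg m' = (mdeg m + k)%N /\ exists t : 'X_{1..n},
   [/\ m' = (m + t)%MM, mdeg t = k & forall j, (t j <= m j)%N]) (SqX k m).
Proof.
apply: supported_sum => t /eqP tk.
set T := [multinom _ | _ < _].
have dT : mdeg T = k by rewrite mdegE -[RHS]tk; apply: eq_bigr => j _; rewrite mnmE.
case: (boolP [forall j, (T j <= m j)%N]) => [/forallP le|/forallPn [j]].
  apply: supportedZ; apply: supportedX; split; first by rewrite mdegD dT.
  by exists T.
rewrite -ltnNge mnmE => /bin_small j0.
rewrite (bigD1 j) //= j0 mul0n scale0r; exact: supported0.
Qed.

Lemma SqX0 n (m : 'X_{1..n}) : SqX 0 m = 'X_[m].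
Proof.
rewrite -coef_totSq -horner_coef0 /totSq horner_prod mpolyXE_id.
by apply: eq_bigr => i _; rewrite !hornerE.
Qed.

(* The preimages are homogeneous monomials, so that the remainder keeps the degree
   required by [inPminus]. *)
Definition hit d (f : P5) := exists s : seq (nat * 'X_{1..5}),
  all (fun x => (0 < x.1)%N && (x.1 + mdeg x.2 == degw (three_d d))%N) s /\
  supported (low d) (f + \sum_(x <- s) Sq_mon x.1 x.2).

Lemma hit_low d f : supported (low d) f -> hit d f.
Proof. by move=> lf; exists [::]; split=> //; rewrite big_nil addr0. Qed.

Lemma hit0 d : hit d 0.
Proof. by apply: hit_low; apply: supported0. Qed.

Lemma hitD d f g : hit d f -> hit d g -> hit d (f + g).
Proof.
move=> [s [s1 s2]] [t [t1 t2]]; exists (s ++ t); rewrite all_cat s1 t1; split=> //.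
by rewrite big_cat /= addrACA; apply: supportedD.
Qed.

Lemma hit_sum d (I : Type) (r : seq I) (Q : pred I) F :
  (forall i, Q i -> hit d (F i)) -> hit d (\sum_(i <- r | Q i) F i).
Proof. by move=> hF; apply: big_ind => //; [apply: hit0|apply: hitD]. Qed.

Lemma hit_Sq d k m : (0 < k)%N -> (k + mdeg m)%N = degw (three_d d) -> hit d (Sq_mon k m).
Proof.
move=> k0 km; exists [:: (k, m)]; rewrite /= k0 km eqxx big_seq1 addpp; split=> //.
exact: supported0.
Qed.

(* [Sq^(2k) (x^e y^2) = x^e (Sq^k y)^2] plus terms with fewer than 3 odd exponents. *)
Lemma hit_prefix_Sq d (e m : 'X_{1..5}) k : squarefree e -> mdeg e = 3%N ->
  (0 < k)%N -> (k + mdeg m)%N = degw (three_d d) ->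
  hit d.+1 ('X_[e] * (Sq_mon k m) ^+ 2).
Proof.
move=> e01 e3 k0 km.
have deg2 : (k.*2 + mdeg (e + m *+ 2))%N = degw (three_d d.+1).
  by rewrite mdegD mdegMn e3 muln2 degw_threeS -km doubleD addnCA.
rewrite -['X_[e] * _](addrK (Sq_mon k.*2 (e + m *+ 2))).
rewrite (oppr_pchar2 (pchar_mpolyF2 5)).
apply: hitD; last by apply: hit_Sq; rewrite ?double_gt0.
apply: hit_low => m' m'in; apply: low_first.
  move: m' m'in; apply: supportedD.
    apply: (@supportedM _ (fun a => a = e) (fun b => mdeg b = (degw (three_d d)).*2)).
    - exact: supportedX.
    - apply: (supported_sqr (@SqX_supported 5 k m)) => a [da _].
      by rewrite mdegMn da muln2 addnC km.
    by move=> a b -> db; rewrite mdegD e3 db degw_threeS.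
  move=> a /(@SqX_supported 5) [-> _]; by rewrite addnC.
move: m' m'in.
(* Cartan formula for [x^e] times [y^2]: the summand with [Sq^0 x^e] is the wanted product and
   cancels; in all others at least one unit is spent on [x^e]. *)
have -> : 'X_[e] * Sq_mon k m ^+ 2 + Sq_mon k.*2 (e + m *+ 2) =
   \sum_(j < k.*2) SqX j.+1 e * ((totSq m) ^+ 2)`_(k.*2 - j.+1).
  rewrite [X in _ + X](_ : _ = SqX k.*2 (e + m *+ 2)%MM) // -coef_totSq.
  rewrite totSqD (_ : totSq (m *+ 2) = totSq m ^+ 2); last by rewrite totSqD.
  rewrite coefM big_ord_recl subn0 poly_sqr odd_double doubleK !coef_totSq.
  rewrite SqX0.
  rewrite addrA addpp add0r; apply: eq_bigr => j _.
  by rewrite coef_totSq.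
apply: supported_sum => j _.
apply: (supportedM (@SqX_supported 5 j.+1 e) (Q := fun b => exists c, b = (c *+ 2)%MM)).
  rewrite poly_sqr; case: ifP => _; first exact: supported0.
  by apply: (@supported_sqr _ (fun=> True)) => // c _; exists c.
move=> _ _ [_ [t [-> tj te]]] [c ->].
(* The doubled part does not affect parity, and each of the [j.+1] units spent on [e] makes one odd
   exponent even; thus [3 - j.+1] odd exponents remain. *)
rewrite (eq_bigr (fun i => e i - t i)%N); last first.
  move=> i _; rewrite mnmDE mulmnE mnmDE !oddD oddM andbF addbF.
  by case: (e i) (e01 i) (te i) => [|[]] // _; case: (t i) => [|[]].
rewrite sumnB // -!mdegE e3 tj.
by rewrite ltn_subrL.
Qed.

(** Squaring is additive in characteristic 2, so it can be applied to each square of the certificate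
    ([hit_prefix_Sq]) and to the remainder of lower weight ([low_next]) separately. *)
Lemma hit_prefix d (e : 'X_{1..5}) f : squarefree e -> mdeg e = 3%N ->
  hit d f -> hit d.+1 ('X_[e] * f ^+ 2).
Proof.
move=> e01 e3 [s [s1 s2]].
set q := f + _ in s2.
have -> : f = q + \sum_(x <- s) Sq_mon x.1 x.2 by rewrite -addrA addpp addr0.
rewrite -(pFrobenius_autE (pchar_mpolyF2 5)) rmorphD rmorph_sum /= mulrDr mulr_sumr.
apply: hitD.
  apply: hit_low; rewrite pFrobenius_autE.
  apply: (@supportedM _ (fun a => a = e) (fun b => exists2 c, b = (c *+ 2)%MM & low d c)).
  - exact: supportedX.
  - by apply: (supported_sqr s2) => m lm; exists m.
  by move=> a b -> [c -> lc]; apply: low_next.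
rewrite big_seq; apply: hit_sum => x /(allP s1) /andP[x0 /eqP xd].
by rewrite pFrobenius_autE; apply: hit_prefix_Sq.
Qed.

(** [Sq^1] is a derivation (this is [KD]), hence determined by the generators, where it sends [x_i]
    to [x_i^2]. *)
Lemma SqX1 n (m : 'X_{1..n}) :
  SqX 1 m = \sum_(i < n) (m i)%:R *: 'X_[m + U_(i)].
Proof.
pose K (m : 'X_{1..n}) := SqX 1 m = \sum_(i < n) (m i)%:R *: 'X_[m + U_(i)].
rewrite -/(K m).
have KD a b : K a -> K b -> K (a + b)%MM.
  rewrite /K => Ka Kb; rewrite -coef_totSq totSqD coefM !big_ord_recl big_ord0 /=.
  rewrite !coef_totSq /= !SqX0 Ka Kb addr0 mulr_sumr mulr_suml -big_split.
  apply: eq_bigr => i _; rewrite mnmDE natrD scalerDl addrC /=.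
  rewrite -scalerAl -scalerAr -!mpolyXD.
  by congr (_ *: 'X_[_] + _ *: 'X_[_]); apply/mnmP => j; rewrite !mnmDE ?addnA // addnAC.
have K0 : K 0%MM.
  rewrite /K big1 => [|i _]; last by rewrite mnm0E scale0r.
  rewrite -coef_totSq /totSq big1 ?coef1 // => i _.
  by rewrite mnm0E expr0.
rewrite [m]multinomUE_id; apply: big_ind => // i _.
elim: (m i) => [|k IH]; first by rewrite mulm0n.
rewrite mulmS; apply: KD => //.
rewrite /K -coef_totSq /totSq (bigD1 i) //= big1 ?mulr1; last first.
  by move=> j ji; rewrite mnm1E eq_sym (negbTE ji) expr0.
rewrite mnm1E eqxx expr1 coefD coefCM coefC coefX /= mulr1 add0r.
rewrite (bigD1 i) //= big1 ?addr0.
  by rewrite mnm1E eqxx scale1r mpolyXD expr2.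
by move=> j ji; rewrite mnm1E eq_sym (negbTE ji) scale0r.
Qed.


(** * Relations between adjacent letters obtained from [Sq^1] *)

Definition ind n (A : {set 'I_n}) : 'X_{1..n} := [multinom (k \in A : nat) | k < n].

Lemma ind_squarefree n (A : {set 'I_n}) : squarefree (ind A).
Proof. by move=> j; rewrite mnmE; case: (_ \in _). Qed.

Lemma mdeg_ind n (A : {set 'I_n}) : mdeg (ind A) = #|A|.
Proof.
rewrite mdegE -sum1_card [RHS]big_mkcond /=; apply: eq_bigr => j _.
by rewrite mnmE; case: (_ \in _).
Qed.

Lemma indU n (A : {set 'I_n}) (i : 'I_n) : i \notin A -> (ind A + U_(i) = ind (i |: A))%MM.
Proof.
move=> iA; apply/mnmP => k; rewrite mnmDE !mnmE in_setU1 eq_sym.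
by case: eqP => [->|_] /=; rewrite ?(negbTE iA) // addn0.
Qed.

Lemma indD n (A : {set 'I_n}) (i : 'I_n) : i \in A -> (ind A + U_(i) = ind (A :\ i) + U_(i) *+ 2)%MM.
Proof.
move=> iA; apply/mnmP => k; rewrite mnmDE [in RHS]mnmDE mulmnE !mnmE in_setD1 eq_sym.
by case: eqP => [->|_] /=; rewrite ?iA // addn0.
Qed.

(** One binary carry: adding [u] to the lowest digit [a] leaves [b] there and sends [u] on to the
    next digit, where it is added to [c]. *)
Lemma mnm_carry n (a b u c : 'X_{1..n}) :
  (a + u = b + u *+ 2 -> a + c *+ 2 + u = b + (c + u) *+ 2)%MM.
Proof.
move=> /mnmP abu; apply/mnmP => k.
by have := abu k; rewrite !(mnmDE, mulmnE); lia.
Qed.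

Lemma mnm_addAC n (a b c : 'X_{1..n}) : (a + b + c = a + c + b)%MM.
Proof. by apply/mnmP => k; rewrite !mnmDE; lia. Qed.

(** The doubled part has even exponents, so the derivation [Sq^1] only sees [S]; raising [i] in [S]
    empties its lowest digit and carries into [m]. *)
Lemma Sq_mon_ind (S : {set 'I_5}) (m : 'X_{1..5}) :
  Sq_mon 1 (ind S + m *+ 2) = \sum_(i in S) 'X_[ind (S :\ i) + (m + U_(i)) *+ 2].
Proof.
rewrite [LHS](SqX1 (ind S + m *+ 2)) [RHS]big_mkcond; apply: eq_bigr => i _.
rewrite mnmDE mulmnE mnmE natrD natrM (_ : 2%:R = 0 :> 'F_2) ?mulr0 ?addr0 //; last first.
  exact/val_inj.
case: ifP => iS; last by rewrite scale0r.
rewrite scale1r; congr 'X_[_].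
exact: mnm_carry (indD iS).
Qed.

Lemma cardC5 (A : {set 'I_5}) : #|~: A| = (5 - #|A|)%N.
Proof. by have := cardsC A; rewrite card_ord; lia. Qed.

(* [Sq^1] of the 4-subset [~: [set s]] followed by the 2-subset [~: Q]: the terms whose
   carry meets [~: Q] have lower weight, the others exchange [i] between the letters. *)
Section Relations.
Variables (d : nat) (s : 'I_5) (Q : {set 'I_5}) (m : 'X_{1..5}).
Hypotheses (Q3 : #|Q| = 3%N) (dm : mdeg m = degw (three_d d)).

Lemma card_Csi (i : 'I_5) : i != s -> #|(~: [set s]) :\ i| = 3%N.
Proof.
move=> iS; have := cardsD1 i (~: [set s]).
by rewrite in_setC1 iS cardC5 cards1 /=; lia.
Qed.

Lemma low_carry (i : 'I_5) : i != s -> i \notin Q ->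
  low d.+1 (ind (~: Q) + m *+ 2 + U_(i)).
Proof.
move=> iS iQ; have iT : i \in ~: Q by rewrite in_setC.
have -> : (ind (~: Q) + m *+ 2 + U_(i) = ind (~: Q :\ i) + (m + U_(i)) *+ 2)%MM.
  exact: mnm_carry (indD iT).
have T1 : #|~: Q :\ i| = 1%N by have := cardsD1 i (~: Q); rewrite iT cardC5 Q3 => -[].
apply: low_first.
  by rewrite mdegD mdegMn mdegD mdeg1 mdeg_ind T1 dm degw_threeS; lia.
rewrite -omega0 omega_add0 (mdeg_squarefree (@ind_squarefree _ _)) mdeg_ind T1 //.
Qed.

(** The sum has two terms if [s] lies in [Q] and three otherwise; the two cases become [hit_swap]
    and [hit_plucker]. *)
Lemma hit_R1 : hit d.+2 (\sum_(i in Q :\ s)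
  'X_[ind (~: [set s] :\ i) + (ind (~: (Q :\ i)) + m *+ 2) *+ 2]).
Proof.
have Sqhit : hit d.+2 (Sq_mon 1 (ind (~: [set s]) + (ind (~: Q) + m *+ 2) *+ 2)).
  (* The degrees of the first two digits agree: 1 + 4 + 2*2 = 3 + 2*3. *)
  apply: hit_Sq => //; rewrite !mdegD !mdeg_ind !cardC5 cards1 Q3 dm.
  by rewrite !degw_threeS; lia.
move: Sqhit; rewrite Sq_mon_ind (bigID (mem Q)) /=.
set a := (X in hit _ (X + _)); set b := (X in hit _ (_ + X)) => h.
have hb : hit d.+2 b.
  apply: hit_low; apply: supported_sum => i /andP[]; rewrite in_setC1 => iS iQ.
  apply: supportedX; apply: low_next; [exact: ind_squarefree|by rewrite mdeg_ind card_Csi|].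
  exact: low_carry.
have -> : \sum_(i in Q :\ s) 'X_[ind (~: [set s] :\ i) + (ind (~: (Q :\ i)) + m *+ 2) *+ 2] = a.
  rewrite /a; apply: eq_big => [i|i]; first by rewrite in_setC1 in_setD1.
  rewrite in_setD1 => /andP[_ iQ]; congr ('X_[_ + _ *+ 2]).
  rewrite (_ : ~: (Q :\ i) = i |: ~: Q) -?indU ?in_setC ?negbK //.
    exact: mnm_addAC.
  by apply/setP => k; rewrite !inE negb_and negbK.
by rewrite -[a](addrK b) (oppr_pchar2 (pchar_mpolyF2 5)); apply: hitD.
Qed.

(** With two 4-subsets in front of the 2-subset, the carry started by [Sq^1] runs through both
    before it reaches [~: Q]. Both lose the same [i], hence the doubled first letter. The degrees
    fit because 1 + 4 + 2*4 + 4*2 = 3 + 2*3 + 4*3. *)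
Lemma hit_R2 : hit d.+3 (\sum_(i in Q :\ s)
  'X_[ind (~: [set s] :\ i) + (ind (~: [set s] :\ i) + (ind (~: (Q :\ i)) + m *+ 2) *+ 2) *+ 2]).
Proof.
have Sqhit : hit d.+3 (Sq_mon 1 (ind (~: [set s]) + (ind (~: [set s]) + (ind (~: Q) + m *+ 2) *+ 2) *+ 2)).
  apply: hit_Sq => //; rewrite !mdegD.
  by rewrite !mdeg_ind !cardC5 cards1 Q3 dm !degw_threeS; lia.
move: Sqhit; rewrite Sq_mon_ind (bigID (mem Q)) /=.
have carry (i : 'I_5) : i != s -> (ind (~: [set s]) + (ind (~: Q) + m *+ 2) *+ 2 + U_(i) =
    ind (~: [set s] :\ i) + (ind (~: Q) + m *+ 2 + U_(i)) *+ 2)%MM.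
  rewrite -in_setC1 => iS; exact: mnm_carry (indD iS).
set a := (X in hit _ (X + _)); set b := (X in hit _ (_ + X)) => h.
have hb : hit d.+3 b.
  apply: hit_low; apply: supported_sum => i /andP[]; rewrite in_setC1 => iS iQ.
  apply: supportedX; apply: low_next; [exact: ind_squarefree|by rewrite mdeg_ind card_Csi|].
  rewrite carry //; apply: low_next; [exact: ind_squarefree|by rewrite mdeg_ind card_Csi|].
  exact: low_carry.
have -> : \sum_(i in Q :\ s) 'X_[ind (~: [set s] :\ i) + (ind (~: [set s] :\ i) +
     (ind (~: (Q :\ i)) + m *+ 2) *+ 2) *+ 2] = a.
  rewrite /a; apply: eq_big => [i|i]; first by rewrite in_setC1 in_setD1.
  rewrite in_setD1 => /andP[iS iQ]; rewrite carry //; congr ('X_[_ + (_ + _ *+ 2) *+ 2]).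
  rewrite (_ : ~: (Q :\ i) = i |: ~: Q) -?indU ?in_setC ?negbK //.
    exact: mnm_addAC.
  by apply/setP => k; rewrite !inE negb_and negbK.
by rewrite -[a](addrK b) (oppr_pchar2 (pchar_mpolyF2 5)); apply: hitD.
Qed.
End Relations.


(** * Words *)

(* A 3-subset of the variables is recorded by its complement, an edge
   of the complete graph K5. *)
Definition letter (e : 'I_5 * 'I_5) : 'X_{1..5} := ind (~: [set e.1; e.2]).

Definition mon (w : seq ('I_5 * 'I_5)) : 'X_{1..5} :=
  foldr (fun e m => letter e + m *+ 2)%MM 0%MM w.

Definition edgeb (e : 'I_5 * 'I_5) := e.1 != e.2.

Lemma mdeg_letter e : edgeb e -> mdeg (letter e) = 3%N.
Proof. by rewrite /edgeb => he; rewrite mdeg_ind cardC5 cards2 he. Qed.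

Lemma letter_squarefree e : squarefree (letter e).
Proof. exact: ind_squarefree. Qed.

Lemma letterC i j : letter (i, j) = letter (j, i).
Proof. by rewrite /letter /= setUC. Qed.

Lemma mdeg_mon w : all edgeb w -> mdeg (mon w) = degw (three_d (size w)).
Proof.
elim: w => [|e w IH] /=; first by rewrite mdeg0 /degw /= big_ord0.
by case/andP=> he hw; rewrite mdegD mdegMn mdeg_letter // IH // degw_threeS muln2.
Qed.

Definition wsum (L : seq (seq ('I_5 * 'I_5))) : P5 := \sum_(w <- L) 'X_[mon w].

Lemma wsum_cons e L : wsum [seq e :: w | w <- L] = 'X_[letter e] * wsum L ^+ 2.
Proof.
rewrite /wsum big_map -(pFrobenius_autE (pchar_mpolyF2 5)) rmorph_sum /= mulr_sumr.
by apply: eq_bigr => w _; rewrite mpolyXD pFrobenius_autE mpolyXn.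
Qed.

(** Iterates [hit_prefix]: prefixing a letter to every word squares the sum and multiplies it by one
    monomial. *)
Lemma hit_cat p n L : all edgeb p -> hit n (wsum L) ->
  hit (size p + n) (wsum [seq p ++ w | w <- L]).
Proof.
elim: p => [|e p IH] /=; first by rewrite map_id.
case/andP=> he hp hL; rewrite (map_comp (cons e) (cat p)) wsum_cons.
apply: hit_prefix; [exact: letter_squarefree|exact: mdeg_letter|exact: IH].
Qed.

Lemma mon_cons e w : mon (e :: w) = (letter e + mon w *+ 2)%MM.
Proof. by []. Qed.

Lemma setC1D1 (a b : 'I_5) : ~: [set a] :\ b = ~: [set a; b].
Proof. by apply/setP => x; rewrite !inE negb_or andbC. Qed.

(** Translation of [hit_R1] and [hit_R2] to edges: a 4-subset without [s] that loses [i] is the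
    letter of [(s, i)], and [f i] is the edge left of [Q] when [i] is deleted. The list [r]
    enumerates [Q :\ s]. *)
Lemma hit_exchange (s : 'I_5) (r : seq 'I_5) (f : 'I_5 -> 'I_5 * 'I_5) z :
  uniq r -> s \notin r ->
  (exists Q : {set 'I_5}, #|Q| = 3%N /\
     forall i, (i \in Q :\ s) = (i \in r) /\
       (i \in r -> Q :\ i = [set (f i).1; (f i).2])) ->
  all edgeb z ->
  hit (size z).+2 (wsum [seq [:: (s, i), f i & z] | i <- r]) /\
  hit (size z).+3 (wsum [seq [:: (s, i), (s, i), f i & z] | i <- r]).
Proof.
move=> ur sr [Q [Q3 QE]] hz; have dm := mdeg_mon hz.
have sE i : i \in r -> letter (s, i) = ind (~: [set s] :\ i).
  by move=> _; rewrite setC1D1.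
have lE i : i \in r -> letter (f i) = ind (~: (Q :\ i)).
  by move=> ir; rewrite ((QE i).2 ir).
have sumE (F G : 'I_5 -> 'X_{1..5}) : (forall i, i \in r -> F i = G i) ->
    \sum_(i in Q :\ s) 'X_[F i] = \sum_(i <- r) 'X_[G i] :> P5.
  move=> FG; rewrite (eq_bigl _ _ (fun i => (QE i).1)) -big_uniq //.
  by apply: eq_big_seq => i /FG ->.
split; rewrite /wsum big_map.
  rewrite -(sumE (fun i => ind (~: [set s] :\ i) + (ind (~: (Q :\ i)) + mon z *+ 2) *+ 2)%MM).
    exact: hit_R1.
  by move=> i ir; rewrite !mon_cons sE // lE.
rewrite -(sumE (fun i => ind (~: [set s] :\ i) + (ind (~: [set s] :\ i) +
            (ind (~: (Q :\ i)) + mon z *+ 2) *+ 2) *+ 2)%MM).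
  exact: hit_R2.
by move=> i ir; rewrite !mon_cons sE // lE.
Qed.

Lemma hit_swap s i j z : uniq [:: s; i; j] -> all edgeb z ->
  hit (size z).+2 (wsum [:: [:: (s, i), (s, j) & z]; [:: (s, j), (s, i) & z]]) /\
  hit (size z).+3 (wsum [:: [:: (s, i), (s, i), (s, j) & z]; [:: (s, j), (s, j), (s, i) & z]]).
Proof.
rewrite /= !inE !negb_or => /and3P[/andP[si sj] ij _] hz.
have := @hit_exchange s [:: i; j] (fun t => (s, if t == i then j else i)) z.
rewrite /= !inE eqxx (eq_sym j i) (negbTE ij) negb_or si sj; apply=> //.
(* Here [s] belongs to [Q], so that only two terms survive. *)
exists [set s; i; j]; split.
  rewrite [_ :|: _]setUC cardsU1 cards2 si !inE negb_or.
  by rewrite (eq_sym j s) (eq_sym j i) sj ij.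
move=> t; split.
  by rewrite !inE; case: (eqVneq t s) => [->|]; rewrite ?(negbTE si) ?(negbTE sj).
rewrite !inE => /orP[] /eqP ->; apply/setP => x; rewrite !inE ?eqxx ?(eq_sym j i) ?(negbTE ij).
  by case: (eqVneq x i) => [->|]; rewrite ?(eq_sym i s) ?(negbTE si) ?(negbTE ij) //= ?orbF.
by case: (eqVneq x j) => [->|]; rewrite ?(eq_sym j s) ?(eq_sym j i) ?(negbTE sj) ?(negbTE ij) //= ?orbF.
Qed.

(** These are the three perfect matchings of the vertices [s], [i], [j], [k], as in the three-term
    Pluecker relation; signs disappear modulo 2. It is the case where [s] lies outside [Q]. *)
Lemma hit_plucker s i j k z : uniq [:: s; i; j; k] -> all edgeb z ->
  hit (size z).+2 (wsum [:: [:: (s, i), (j, k) & z]; [:: (s, j), (i, k) & z];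
                            [:: (s, k), (i, j) & z]]) /\
  hit (size z).+3 (wsum [:: [:: (s, i), (s, i), (j, k) & z]; [:: (s, j), (s, j), (i, k) & z];
                            [:: (s, k), (s, k), (i, j) & z]]).
Proof.
rewrite /= !inE !negb_or => /and4P[/and3P[si sj sk] /andP[ij ik] jk _] hz.
have := @hit_exchange s [:: i; j; k]
  (fun t => if t == i then (j, k) else if t == j then (i, k) else (i, j)) z.
rewrite /= !inE !eqxx (eq_sym j i) (eq_sym k i) (eq_sym k j) (negbTE ij) (negbTE ik) (negbTE jk).
rewrite !negb_or si sj sk; apply=> //.
exists [set i; j; k]; split.
  rewrite [_ :|: _]setUC cardsU1 cards2 ij !inE negb_or.
  by rewrite (eq_sym k i) (eq_sym k j) ik jk.
move=> t; split.
  by rewrite !inE; case: (eqVneq t s) => [->|]; rewrite ?(negbTE si) ?(negbTE sj) ?(negbTE sk) ?orbA.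
by rewrite !inE => /or3P[] /eqP ->; apply/setP => x;
  rewrite !inE ?eqxx ?(eq_sym j i) ?(eq_sym k i) ?(eq_sym k j) ?(negbTE ij) ?(negbTE ik) ?(negbTE jk) /=;
  case: (eqVneq x i) => [->|]; rewrite ?(negbTE ij) ?(negbTE ik) ?(negbTE jk) //=;
  case: (eqVneq x j) => [->|]; rewrite ?(negbTE ij) ?(negbTE ik) ?(negbTE jk) //=;
  case: (eqVneq x k) => [->|].
Qed.

Local Open Scope nat_scope.

(** * Derivations between formal sums of words *)

Notation vedge := (nat * nat)%type.
Notation vword := (seq (nat * nat)).

(** Edges are kept with increasing ends, so that cancellation of words becomes a syntactic test. *)
Definition mkedge i j : vedge := if i < j then (i, j) else (j, i).
Definition relabel (t : seq nat) (w : vword) : vword :=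
  [seq mkedge (nth 0 t e.1) (nth 0 t e.2) | e <- w].
Definition is_perm5 (t : seq nat) := [&& size t == 5, uniq t & all (fun i => i < 5) t].
Definition is_edge (e : vedge) := [&& e.1 < 5, e.2 < 5 & e.1 != e.2].

Definition lab (f : nat -> 'I_5) (w : vword) : seq ('I_5 * 'I_5) :=
  [seq (f e.1, f e.2) | e <- w].

(* [zero n l]: the formal sum [l] of words of length [n] is hit, after any
   relabelling of the vertices and in front of any word. *)
Definition zero n (l : seq vword) := forall f : nat -> 'I_5,
  {in gtn 5 &, injective f} -> forall z, all edgeb z ->
  hit (n + size z) (wsum [seq lab f w ++ z | w <- l]).

(* The step [(p, r, t, s)] uses the [r]-th known relation, relabelled by [t], between the
   words [p] and [s]. *)
Notation step := (vword * nat * seq nat * vword)%type.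

Definition expand (K : seq (nat * seq vword)) (c : step) : seq vword :=
  let: (p, r, t, s) := c in
  [seq p ++ relabel t w ++ s | w <- (nth (0, [::]) K r).2].
Definition step_ok n (K : seq (nat * seq vword)) (c : step) :=
  let: (p, r, t, s) := c in
  [&& all is_edge p, all is_edge s, is_perm5 t, r < size K
    & size p + (nth (0, [::]) K r).1 + size s == n].
Definition cancels (T : eqType) (l : seq T) := all (fun w => ~~ odd (count_mem w l)) l.

(** The list [c] is a certificate: over [F_2], [l] equals the sum of the instances of known
    relations exactly when everything together cancels in pairs. *)
Definition derives n K (l : seq vword) (c : seq step) :=
  all (step_ok n K) c && cancels (l ++ flatten (map (expand K) c)).

Definition zeros (K : seq (nat * seq vword)) := forall x : nat * seq vword, x \in K -> zero x.1 x.2.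

Local Open Scope ring_scope.

Lemma cancels_sum (T : eqType) (l : seq T) (F : T -> P5) :
  cancels l -> \sum_(w <- l) F w = 0.
Proof.
move=> /allP ev; rewrite -big_undup_iterop_count /=.
rewrite big_seq big1 // => w; rewrite mem_undup => /ev.
rewrite Monoid.iteropE => odd0.
have -> : iter (count_mem w l) (+%R (F w)) 0 = F w *+ count_mem w l.
  by elim: (count_mem w l) => //= k ->; rewrite mulrS.
rewrite -(odd_double_half (count_mem w l)) (negbTE odd0) add0n -mul2n mulrnA.
by rewrite mulr2n addpp mul0rn.
Qed.

Lemma is_edge_lab f p : {in gtn 5 &, injective f} -> all is_edge p ->
  all edgeb (lab f p).
Proof.
move=> finj; rewrite all_map; apply: sub_all => -[i j] /and3P[/= i5 j5 ij].
by apply: contra ij => /eqP /finj -> //.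
Qed.

Lemma mon_eq w1 w2 : map letter w1 = map letter w2 -> mon w1 = mon w2.
Proof.
elim: w1 w2 => [|e w IH] [|e' w'] //= E.
by rewrite (IH w' (congr1 behead E)) (congr1 (head 0%MM) E : letter e = letter e').
Qed.

Lemma lab_relabel f t w z : map letter (lab f (relabel t w) ++ z) =
  map letter (lab (fun i => f (nth 0%N t i)) w ++ z).
Proof.
rewrite !map_cat; congr (_ ++ _); rewrite -!map_comp; apply: eq_map => e /=.
by rewrite /mkedge; case: ifP => //=; rewrite letterC.
Qed.

(** The quantifiers of [zero] match the parts of a step: the relabelling [t] is composed with [f],
    the suffix [s] is absorbed into the free suffix [z], and the prefix [p] is added by
    [hit_cat]. *)
Lemma zero_expand n K c : zeros K -> step_ok n K c -> zero n (expand K c).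
Proof.
case: c => [[[p r] t] s] zK /and5P[hp hs /and3P[/eqP t5 ut at5] rK /eqP <-].
have {zK rK} zr := zK _ (mem_nth (0%N, [::]) rK).
move=> f finj z hz.
have finj' : {in gtn 5 &, injective (fun i => f (nth 0%N t i))}.
  move=> i j; rewrite !inE => i5 j5 /finj.
  rewrite !inE !(allP at5) ?mem_nth ?t5 // => /(_ isT isT) /eqP.
  by rewrite nth_uniq ?t5 // => /eqP.
have hsz : all edgeb (lab f s ++ z) by rewrite all_cat is_edge_lab.
have := hit_cat (is_edge_lab finj hp) (zr _ finj' _ hsz).
rewrite size_map size_cat size_map !addnA.
rewrite /expand -!map_comp /wsum !big_map; congr hit.
apply: eq_bigr => w _; congr 'X_[_]; apply: mon_eq => /=.
have labD u v : lab f (u ++ v) = lab f u ++ lab f v by apply: map_cat.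
rewrite !labD -!catA (map_cat letter (lab f p)) -(lab_relabel f t w).
by rewrite -map_cat.
Qed.

Lemma derives_zero n K l c : zeros K -> derives n K l c -> zero n l.
Proof.
move=> zK /andP[/allP ok ev] f finj z hz.
have := cancels_sum (fun w => 'X_[mon (lab f w ++ z)]) ev.
rewrite big_cat /= => /eqP; rewrite addr_eq0 (oppr_pchar2 (pchar_mpolyF2 5)) => /eqP E.
rewrite /wsum big_map E -(big_map (fun w => lab f w ++ z) predT (fun w => 'X_[mon w])).
elim: c ok {E ev} => [|x c IH] ok /=; first by rewrite big_nil; apply: hit0.
rewrite map_cat big_cat /=; apply: hitD.
  by apply: (zero_expand zK) => //; apply: ok; rewrite inE eqxx.
by apply: IH => y yc; apply: ok; rewrite inE yc orbT.
Qed.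

Notation checker := (nat -> seq (nat * seq vword) -> seq vword -> seq step -> bool).

(** Proved entries are appended to [K] and may be used by later ones. Starting from
    [base_relations], the indices 0 to 3 denote the basic relations, 4 to 16 the results of
    [noncommutative_steps], and 17 to 21 those of [commutative_steps]. *)
Fixpoint derivable (chk : checker) K
    (l : seq ((nat * seq vword) * seq step)) :=
  if l is (x, c) :: l' then chk x.1 K x.2 c && derivable chk (rcons K x) l' else true.

Lemma derivable_zeros (chk : checker) K l :
  (forall n K l c, zeros K -> chk n K l c -> zero n l) ->
  zeros K -> derivable chk K l -> zeros (K ++ map fst l).
Proof.
move=> sound; elim: l K => [|[x c] l IH] K zK /=; first by rewrite cats0.
case/andP=> ok /IH {}IH; rewrite -cat_rcons; apply: IH => y.
by rewrite mem_rcons inE => /predU1P[->|/zK //]; apply: sound ok.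
Qed.

Definition base_relations : seq (nat * seq vword) :=
 [:: (2, [:: [:: (0,1); (0,2)]; [:: (0,2); (0,1)]]);
     (2, [:: [:: (0,1); (2,3)]; [:: (0,2); (1,3)]; [:: (0,3); (1,2)]]);
     (3, [:: [:: (0,1); (0,1); (0,2)]; [:: (0,2); (0,2); (0,1)]]);
     (3, [:: [:: (0,1); (0,1); (2,3)]; [:: (0,2); (0,2); (1,3)];
             [:: (0,3); (0,3); (1,2)]])]%N.

Lemma base_zeros : zeros base_relations.
Proof.
have neq (f : nat -> 'I_5) i j : {in gtn 5 &, injective f} -> (i < 5)%N -> (j < 5)%N -> i != j -> f i != f j.
  by move=> finj i5 j5; apply: contra => /eqP fij; apply/eqP/finj.
have u4 (f : nat -> 'I_5) : {in gtn 5 &, injective f} -> uniq [:: f 0; f 1; f 2; f 3]%N.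
  by move=> finj; rewrite /= !inE !negb_or !neq.
have u3 (f : nat -> 'I_5) : {in gtn 5 &, injective f} -> uniq [:: f 0; f 1; f 2]%N.
  by move=> finj; rewrite /= !inE !negb_or !neq.
move=> x; rewrite !inE => /or4P[] /eqP -> f finj z hz.
- exact: (hit_swap (u3 f finj) hz).1.
- exact: (hit_plucker (u4 f finj) hz).1.
- exact: (hit_swap (u3 f finj) hz).2.
- exact: (hit_plucker (u4 f finj) hz).2.
Qed.

Local Open Scope nat_scope.
(* With A, A' disjoint edges and c = AA' + A'A: in turn x c = 0 for x = A, for x meeting both A
   and A', and for x through the fifth vertex; c x = 0 in the first two cases; c x = c' A in
   the third one, where c' is the commutator of x and A'; finally c x y = 0 in that case. *)
Definition noncommutative_steps : seq ((nat * seq vword) * seq step) :=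
 [:: ((3, [:: [:: (0,1); (0,1); (2,3)];
     [:: (0,1); (2,3); (0,1)]]),
   [:: ([::], 1, [:: 0; 1; 2; 3; 4], [:: (0,1)]);
     ([:: (0,1)], 1, [:: 0; 1; 2; 3; 4], [::]);
     ([:: (0,2)], 0, [:: 1; 3; 0; 2; 4], [::]);
     ([::], 0, [:: 0; 2; 1; 3; 4], [:: (1,3)]);
     ([:: (0,3)], 0, [:: 1; 2; 0; 3; 4], [::]);
     ([::], 0, [:: 0; 3; 1; 2; 4], [:: (1,2)])]);
  ((3, [:: [:: (0,2); (0,1); (2,3)];
     [:: (0,2); (2,3); (0,1)]]),
   [:: ([::], 4, [:: 0; 2; 1; 3; 4], [::]);
     ([:: (0,2)], 1, [:: 0; 1; 2; 3; 4], [::]);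
     ([:: (0,2)], 1, [:: 3; 0; 1; 2; 4], [::])]);
  ((3, [:: [:: (0,4); (0,1); (2,3)];
     [:: (0,4); (2,3); (0,1)]]),
   [:: ([::], 0, [:: 0; 2; 1; 3; 4], [:: (3,4)]);
     ([:: (0,1)], 1, [:: 0; 2; 3; 4; 1], [::]);
     ([::], 1, [:: 0; 2; 3; 4; 1], [:: (0,1)]);
     ([::], 0, [:: 0; 1; 3; 2; 4], [:: (2,4)]);
     ([::], 0, [:: 0; 1; 4; 2; 3], [:: (2,3)]);
     ([::], 0, [:: 0; 1; 2; 3; 4], [:: (3,4)]);
     ([:: (0,2)], 1, [:: 0; 1; 3; 4; 2], [::]);
     ([::], 1, [:: 0; 1; 3; 4; 2], [:: (0,2)]);
     ([::], 0, [:: 0; 2; 3; 1; 4], [:: (1,4)]);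
     ([::], 0, [:: 0; 2; 4; 1; 3], [:: (1,3)]);
     ([::], 0, [:: 0; 1; 3; 2; 4], [:: (2,4)]);
     ([:: (0,3)], 1, [:: 0; 1; 2; 4; 3], [::]);
     ([::], 1, [:: 0; 1; 2; 4; 3], [:: (0,3)]);
     ([::], 0, [:: 0; 3; 2; 1; 4], [:: (1,4)]);
     ([::], 0, [:: 0; 3; 4; 1; 2], [:: (1,2)]);
     ([:: (0,2)], 1, [:: 0; 1; 3; 4; 2], [::]);
     ([:: (0,2)], 1, [:: 4; 0; 1; 3; 2], [::]);
     ([:: (0,3)], 1, [:: 0; 1; 2; 4; 3], [::]);
     ([:: (0,3)], 1, [:: 4; 0; 1; 2; 3], [::]);
     ([:: (0,1)], 1, [:: 0; 2; 3; 4; 1], [::]);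
     ([:: (0,1)], 1, [:: 4; 0; 2; 3; 1], [::]);
     ([:: (0,4)], 1, [:: 0; 2; 3; 1; 4], [::]);
     ([:: (0,4)], 1, [:: 1; 0; 2; 3; 4], [::])]);
  ((3, [:: [:: (0,1); (2,3); (0,2)];
     [:: (2,3); (0,1); (0,2)]]),
   [:: ([:: (0,1)], 0, [:: 2; 3; 0; 1; 4], [::]);
     ([::], 0, [:: 0; 1; 2; 3; 4], [:: (2,3)]);
     ([:: (2,3)], 0, [:: 0; 1; 2; 3; 4], [::]);
     ([::], 0, [:: 2; 3; 0; 1; 4], [:: (0,1)]);
     ([::], 5, [:: 0; 1; 2; 3; 4], [::])]);
  ((3, [:: [:: (0,1); (2,3); (0,1)];
     [:: (2,3); (0,1); (0,1)]]),
   [:: ([::], 7, [:: 0; 2; 1; 3; 4], [::]);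
     ([::], 1, [:: 0; 1; 2; 3; 4], [:: (0,1)]);
     ([::], 1, [:: 3; 0; 1; 2; 4], [:: (0,1)])]);
  ((3, [:: [:: (0,1); (2,3); (0,4)];
     [:: (2,3); (0,1); (0,4)];
     [:: (0,4); (2,3); (0,1)];
     [:: (2,3); (0,4); (0,1)]]),
   [:: ([::], 6, [:: 0; 4; 2; 3; 1], [::]);
     ([::], 0, [:: 0; 1; 4; 2; 3], [:: (2,3)]);
     ([:: (2,3)], 0, [:: 0; 1; 4; 2; 3], [::]);
     ([::], 6, [:: 0; 1; 2; 3; 4], [::])]);
  ((4, [:: [:: (0,1); (2,3); (0,4); (0,1)];
     [:: (2,3); (0,1); (0,4); (0,1)]]),
   [:: ([:: (0,1); (2,3)], 0, [:: 0; 4; 1; 2; 3], [::]);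
     ([:: (2,3); (0,1)], 0, [:: 0; 4; 1; 2; 3], [::]);
     ([::], 8, [:: 0; 1; 2; 3; 4], [:: (0,4)])]);
  ((4, [:: [:: (0,1); (2,3); (0,4); (0,2)];
     [:: (2,3); (0,1); (0,4); (0,2)]]),
   [:: ([:: (0,1); (2,3)], 0, [:: 0; 4; 2; 1; 3], [::]);
     ([:: (2,3); (0,1)], 0, [:: 0; 4; 2; 1; 3], [::]);
     ([::], 7, [:: 0; 1; 2; 3; 4], [:: (0,4)])]);
  ((4, [:: [:: (0,1); (2,3); (0,4); (2,3)];
     [:: (2,3); (0,1); (0,4); (2,3)]]),
   [:: ([:: (0,1); (2,3)], 1, [:: 0; 4; 2; 3; 1], [::]);
     ([:: (2,3); (0,1)], 1, [:: 0; 4; 2; 3; 1], [::]);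
     ([::], 7, [:: 0; 1; 2; 3; 4], [:: (3,4)]);
     ([::], 7, [:: 0; 1; 3; 2; 4], [:: (2,4)])]);
  ((4, [:: [:: (0,1); (2,3); (0,4); (1,2)];
     [:: (2,3); (0,1); (0,4); (1,2)]]),
   [:: ([:: (0,1); (2,3)], 1, [:: 0; 4; 1; 2; 3], [::]);
     ([:: (2,3); (0,1)], 1, [:: 0; 4; 1; 2; 3], [::]);
     ([::], 8, [:: 0; 1; 2; 3; 4], [:: (2,4)]);
     ([::], 7, [:: 0; 1; 2; 3; 4], [:: (1,4)])]);
  ((4, [:: [:: (0,1); (2,3); (0,4); (0,4)];
     [:: (2,3); (0,1); (0,4); (0,4)]]),
   [:: ([::], 9, [:: 0; 1; 2; 3; 4], [:: (0,4)]);
     ([:: (0,4); (2,3)], 0, [:: 0; 1; 4; 2; 3], [::]);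
     ([:: (2,3); (0,4)], 0, [:: 0; 1; 4; 2; 3], [::]);
     ([::], 8, [:: 0; 4; 2; 3; 1], [:: (0,1)])]);
  ((4, [:: [:: (0,1); (2,3); (0,4); (1,4)];
     [:: (2,3); (0,1); (0,4); (1,4)]]),
   [:: ([::], 1, [:: 0; 1; 2; 3; 4], [:: (0,4); (1,4)]);
     ([::], 1, [:: 3; 0; 1; 2; 4], [:: (0,4); (1,4)]);
     ([::], 9, [:: 0; 2; 1; 3; 4], [:: (1,4)]);
     ([:: (0,4); (1,3)], 1, [:: 0; 2; 1; 4; 3], [::]);
     ([:: (1,3); (0,4)], 1, [:: 0; 2; 1; 4; 3], [::]);
     ([::], 7, [:: 0; 4; 1; 3; 2], [:: (2,4)]);
     ([::], 8, [:: 0; 4; 1; 3; 2], [:: (1,2)])]);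
  ((4, [:: [:: (0,1); (2,3); (0,4); (2,4)];
     [:: (2,3); (0,1); (0,4); (2,4)]]),
   [:: ([::], 9, [:: 0; 1; 2; 3; 4], [:: (2,4)]);
     ([:: (0,4); (2,3)], 1, [:: 0; 1; 2; 4; 3], [::]);
     ([:: (2,3); (0,4)], 1, [:: 0; 1; 2; 4; 3], [::]);
     ([::], 7, [:: 0; 4; 2; 3; 1], [:: (1,4)]);
     ([::], 8, [:: 0; 4; 2; 3; 1], [:: (1,2)])])].

(* For words taken up to order: AAA'x = AA'A'x when x avoids the fifth vertex, and
   AAA'xy = AA'A'xy when x and y both contain the fifth vertex. *)
Definition commutative_steps : seq ((nat * seq vword) * seq step) :=
 [:: ((4, [:: [:: (0,1); (0,1); (2,3); (0,2)];
     [:: (0,1); (2,3); (2,3); (0,2)]]),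
   [:: ([::], 2, [:: 0; 1; 2; 3; 4], [:: (2,3)]);
     ([::], 2, [:: 2; 0; 3; 1; 4], [:: (0,1)])]);
  ((4, [:: [:: (0,1); (0,1); (2,3); (0,1)];
     [:: (0,1); (2,3); (2,3); (0,1)]]),
   [:: ([::], 3, [:: 0; 1; 2; 3; 4], [:: (0,1)]);
     ([::], 3, [:: 3; 0; 1; 2; 4], [:: (0,1)]);
     ([::], 17, [:: 0; 2; 1; 3; 4], [::])]);
  ((5, [:: [:: (0,1); (0,1); (2,3); (0,4); (1,4)];
     [:: (0,1); (2,3); (2,3); (0,4); (1,4)]]),
   [:: ([::], 3, [:: 0; 1; 2; 3; 4], [:: (0,4); (1,4)]);
     ([::], 3, [:: 3; 0; 1; 2; 4], [:: (0,4); (1,4)]);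
     ([::], 2, [:: 0; 2; 4; 1; 3], [:: (1,3); (1,4)]);
     ([::], 2, [:: 4; 0; 1; 2; 3], [:: (0,2); (1,3)]);
     ([::], 2, [:: 1; 4; 3; 0; 2], [:: (0,2); (0,4)])]);
  ((5, [:: [:: (0,1); (0,1); (2,3); (0,4); (2,4)];
     [:: (0,1); (2,3); (2,3); (0,4); (2,4)]]),
   [:: ([::], 2, [:: 0; 1; 4; 2; 3], [:: (2,3); (2,4)]);
     ([::], 2, [:: 4; 0; 2; 1; 3], [:: (0,1); (2,3)]);
     ([::], 2, [:: 2; 4; 3; 0; 1], [:: (0,1); (0,4)])]);
  ((5, [:: [:: (0,1); (0,1); (2,3); (0,4); (0,4)];
     [:: (0,1); (2,3); (2,3); (0,4); (0,4)]]),
   [:: ([::], 2, [:: 0; 1; 4; 2; 3], [:: (0,4); (2,3)]);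
     ([::], 18, [:: 0; 4; 2; 3; 1], [:: (0,1)])])].

(* For each edge x, respectively each pair of edges x, y, the relation and the relabelling
   (preserving the pair of edges 01, 23) which give x 01 23 = x 23 01,
   01 23 x y = 23 01 x y and 01 01 23 x y = 01 23 23 x y. *)
Definition mid_table : seq (nat * seq nat * vword) :=
 [:: (4, [:: 0; 1; 2; 3; 4], [::]); (5, [:: 0; 1; 2; 3; 4], [::]); (5, [:: 0; 1; 3; 2; 4],
   [::]); (6, [:: 0; 1; 2; 3; 4], [::]); (5, [:: 1; 0; 2; 3; 4], [::]); (5, [:: 1; 0; 3; 2; 4],
   [::]); (6, [:: 1; 0; 2; 3; 4], [::]); (4, [:: 2; 3; 0; 1; 4], [::]); (6, [:: 2; 3; 0; 1; 4],
   [::]); (6, [:: 3; 2; 0; 1; 4], [::])].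

Definition front_table : seq (nat * seq nat * vword) :=
 [:: (8, [:: 0; 1; 2; 3; 4], [:: (0,1)]); (8, [:: 0; 1; 2; 3; 4], [:: (0,2)]); (8, [:: 0; 1; 2;
   3; 4], [:: (0,3)]); (8, [:: 0; 1; 2; 3; 4], [:: (0,4)]); (8, [:: 0; 1; 2; 3; 4], [:: (1,2)]);
   (8, [:: 0; 1; 2; 3; 4], [:: (1,3)]); (8, [:: 0; 1; 2; 3; 4], [:: (1,4)]); (8, [:: 0; 1; 2; 3;
   4], [:: (2,3)]); (8, [:: 0; 1; 2; 3; 4], [:: (2,4)]); (8, [:: 0; 1; 2; 3; 4], [:: (3,4)]); (7,
   [:: 0; 1; 2; 3; 4], [:: (0,1)]); (7, [:: 0; 1; 2; 3; 4], [:: (0,2)]); (7, [:: 0; 1; 2; 3; 4],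
   [:: (0,3)]); (7, [:: 0; 1; 2; 3; 4], [:: (0,4)]); (7, [:: 0; 1; 2; 3; 4], [:: (1,2)]); (7,
   [:: 0; 1; 2; 3; 4], [:: (1,3)]); (7, [:: 0; 1; 2; 3; 4], [:: (1,4)]); (7, [:: 0; 1; 2; 3; 4],
   [:: (2,3)]); (7, [:: 0; 1; 2; 3; 4], [:: (2,4)]); (7, [:: 0; 1; 2; 3; 4], [:: (3,4)]); (7,
   [:: 0; 1; 3; 2; 4], [:: (0,1)]); (7, [:: 0; 1; 3; 2; 4], [:: (0,2)]); (7, [:: 0; 1; 3; 2; 4],
   [:: (0,3)]); (7, [:: 0; 1; 3; 2; 4], [:: (0,4)]); (7, [:: 0; 1; 3; 2; 4], [:: (1,2)]); (7,
   [:: 0; 1; 3; 2; 4], [:: (1,3)]); (7, [:: 0; 1; 3; 2; 4], [:: (1,4)]); (7, [:: 0; 1; 3; 2; 4],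
   [:: (2,3)]); (7, [:: 0; 1; 3; 2; 4], [:: (2,4)]); (7, [:: 0; 1; 3; 2; 4], [:: (3,4)]); (10,
   [:: 0; 1; 2; 3; 4], [::]); (11, [:: 0; 1; 2; 3; 4], [::]); (11, [:: 0; 1; 3; 2; 4], [::]); (14,
   [:: 0; 1; 2; 3; 4], [::]); (13, [:: 0; 1; 2; 3; 4], [::]); (13, [:: 0; 1; 3; 2; 4], [::]); (15,
   [:: 0; 1; 2; 3; 4], [::]); (12, [:: 0; 1; 2; 3; 4], [::]); (16, [:: 0; 1; 2; 3; 4], [::]); (16,
   [:: 0; 1; 3; 2; 4], [::]); (7, [:: 1; 0; 2; 3; 4], [:: (0,1)]); (7, [:: 1; 0; 2; 3; 4],
   [:: (0,2)]); (7, [:: 1; 0; 2; 3; 4], [:: (0,3)]); (7, [:: 1; 0; 2; 3; 4], [:: (0,4)]); (7,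
   [:: 1; 0; 2; 3; 4], [:: (1,2)]); (7, [:: 1; 0; 2; 3; 4], [:: (1,3)]); (7, [:: 1; 0; 2; 3; 4],
   [:: (1,4)]); (7, [:: 1; 0; 2; 3; 4], [:: (2,3)]); (7, [:: 1; 0; 2; 3; 4], [:: (2,4)]); (7,
   [:: 1; 0; 2; 3; 4], [:: (3,4)]); (7, [:: 1; 0; 3; 2; 4], [:: (0,1)]); (7, [:: 1; 0; 3; 2; 4],
   [:: (0,2)]); (7, [:: 1; 0; 3; 2; 4], [:: (0,3)]); (7, [:: 1; 0; 3; 2; 4], [:: (0,4)]); (7,
   [:: 1; 0; 3; 2; 4], [:: (1,2)]); (7, [:: 1; 0; 3; 2; 4], [:: (1,3)]); (7, [:: 1; 0; 3; 2; 4],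
   [:: (1,4)]); (7, [:: 1; 0; 3; 2; 4], [:: (2,3)]); (7, [:: 1; 0; 3; 2; 4], [:: (2,4)]); (7,
   [:: 1; 0; 3; 2; 4], [:: (3,4)]); (10, [:: 1; 0; 2; 3; 4], [::]); (13, [:: 1; 0; 2; 3; 4],
   [::]); (13, [:: 1; 0; 3; 2; 4], [::]); (15, [:: 1; 0; 2; 3; 4], [::]); (11, [:: 1; 0; 2; 3; 4],
   [::]); (11, [:: 1; 0; 3; 2; 4], [::]); (14, [:: 1; 0; 2; 3; 4], [::]); (12, [:: 1; 0; 2; 3; 4],
   [::]); (16, [:: 1; 0; 2; 3; 4], [::]); (16, [:: 1; 0; 3; 2; 4], [::]); (8, [:: 2; 3; 0; 1; 4],
   [:: (0,1)]); (8, [:: 2; 3; 0; 1; 4], [:: (0,2)]); (8, [:: 2; 3; 0; 1; 4], [:: (0,3)]); (8,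
   [:: 2; 3; 0; 1; 4], [:: (0,4)]); (8, [:: 2; 3; 0; 1; 4], [:: (1,2)]); (8, [:: 2; 3; 0; 1; 4],
   [:: (1,3)]); (8, [:: 2; 3; 0; 1; 4], [:: (1,4)]); (8, [:: 2; 3; 0; 1; 4], [:: (2,3)]); (8,
   [:: 2; 3; 0; 1; 4], [:: (2,4)]); (8, [:: 2; 3; 0; 1; 4], [:: (3,4)]); (12, [:: 2; 3; 0; 1; 4],
   [::]); (11, [:: 2; 3; 0; 1; 4], [::]); (13, [:: 2; 3; 0; 1; 4], [::]); (16, [:: 2; 3; 0; 1; 4],
   [::]); (11, [:: 2; 3; 1; 0; 4], [::]); (13, [:: 2; 3; 1; 0; 4], [::]); (16, [:: 2; 3; 1; 0; 4],
   [::]); (10, [:: 2; 3; 0; 1; 4], [::]); (14, [:: 2; 3; 0; 1; 4], [::]); (15, [:: 2; 3; 0; 1; 4],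
   [::]); (12, [:: 3; 2; 0; 1; 4], [::]); (13, [:: 3; 2; 0; 1; 4], [::]); (11, [:: 3; 2; 0; 1; 4],
   [::]); (16, [:: 3; 2; 0; 1; 4], [::]); (13, [:: 3; 2; 1; 0; 4], [::]); (11, [:: 3; 2; 1; 0; 4],
   [::]); (16, [:: 3; 2; 1; 0; 4], [::]); (10, [:: 3; 2; 0; 1; 4], [::]); (15, [:: 3; 2; 0; 1; 4],
   [::]); (14, [:: 3; 2; 0; 1; 4], [::])].

Definition collapse_table : seq (nat * seq nat * vword) :=
 [:: (18, [:: 0; 1; 2; 3; 4], [:: (0,1)]); (18, [:: 0; 1; 2; 3; 4], [:: (0,2)]); (18, [:: 0; 1;
   2; 3; 4], [:: (0,3)]); (18, [:: 0; 1; 2; 3; 4], [:: (0,4)]); (18, [:: 0; 1; 2; 3; 4],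
   [:: (1,2)]); (18, [:: 0; 1; 2; 3; 4], [:: (1,3)]); (18, [:: 0; 1; 2; 3; 4], [:: (1,4)]); (18,
   [:: 0; 1; 2; 3; 4], [:: (2,3)]); (18, [:: 0; 1; 2; 3; 4], [:: (2,4)]); (18, [:: 0; 1; 2; 3; 4],
   [:: (3,4)]); (18, [:: 0; 1; 2; 3; 4], [:: (0,2)]); (17, [:: 0; 1; 2; 3; 4], [:: (0,2)]); (17,
   [:: 0; 1; 2; 3; 4], [:: (0,3)]); (17, [:: 0; 1; 2; 3; 4], [:: (0,4)]); (17, [:: 0; 1; 2; 3; 4],
   [:: (1,2)]); (17, [:: 0; 1; 2; 3; 4], [:: (1,3)]); (17, [:: 0; 1; 2; 3; 4], [:: (1,4)]); (18,
   [:: 2; 3; 0; 1; 4], [:: (0,2)]); (17, [:: 0; 1; 2; 3; 4], [:: (2,4)]); (17, [:: 0; 1; 2; 3; 4],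
   [:: (3,4)]); (18, [:: 0; 1; 2; 3; 4], [:: (0,3)]); (17, [:: 0; 1; 2; 3; 4], [:: (0,3)]); (17,
   [:: 0; 1; 3; 2; 4], [:: (0,3)]); (17, [:: 0; 1; 3; 2; 4], [:: (0,4)]); (17, [:: 0; 1; 3; 2; 4],
   [:: (1,2)]); (17, [:: 0; 1; 3; 2; 4], [:: (1,3)]); (17, [:: 0; 1; 3; 2; 4], [:: (1,4)]); (18,
   [:: 2; 3; 0; 1; 4], [:: (0,3)]); (17, [:: 0; 1; 3; 2; 4], [:: (2,4)]); (17, [:: 0; 1; 3; 2; 4],
   [:: (3,4)]); (18, [:: 0; 1; 2; 3; 4], [:: (0,4)]); (17, [:: 0; 1; 2; 3; 4], [:: (0,4)]); (17,
   [:: 0; 1; 3; 2; 4], [:: (0,4)]); (21, [:: 0; 1; 2; 3; 4], [::]); (17, [:: 1; 0; 2; 3; 4],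
   [:: (0,4)]); (17, [:: 1; 0; 3; 2; 4], [:: (0,4)]); (19, [:: 0; 1; 2; 3; 4], [::]); (18, [:: 2;
   3; 0; 1; 4], [:: (0,4)]); (20, [:: 0; 1; 2; 3; 4], [::]); (20, [:: 0; 1; 3; 2; 4], [::]); (18,
   [:: 0; 1; 2; 3; 4], [:: (1,2)]); (17, [:: 0; 1; 2; 3; 4], [:: (1,2)]); (17, [:: 0; 1; 3; 2; 4],
   [:: (1,2)]); (17, [:: 1; 0; 2; 3; 4], [:: (0,4)]); (17, [:: 1; 0; 2; 3; 4], [:: (1,2)]); (17,
   [:: 1; 0; 2; 3; 4], [:: (1,3)]); (17, [:: 1; 0; 2; 3; 4], [:: (1,4)]); (18, [:: 2; 3; 0; 1; 4],
   [:: (1,2)]); (17, [:: 1; 0; 2; 3; 4], [:: (2,4)]); (17, [:: 1; 0; 2; 3; 4], [:: (3,4)]); (18,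
   [:: 0; 1; 2; 3; 4], [:: (1,3)]); (17, [:: 0; 1; 2; 3; 4], [:: (1,3)]); (17, [:: 0; 1; 3; 2; 4],
   [:: (1,3)]); (17, [:: 1; 0; 3; 2; 4], [:: (0,4)]); (17, [:: 1; 0; 2; 3; 4], [:: (1,3)]); (17,
   [:: 1; 0; 3; 2; 4], [:: (1,3)]); (17, [:: 1; 0; 3; 2; 4], [:: (1,4)]); (18, [:: 2; 3; 0; 1; 4],
   [:: (1,3)]); (17, [:: 1; 0; 3; 2; 4], [:: (2,4)]); (17, [:: 1; 0; 3; 2; 4], [:: (3,4)]); (18,
   [:: 0; 1; 2; 3; 4], [:: (1,4)]); (17, [:: 0; 1; 2; 3; 4], [:: (1,4)]); (17, [:: 0; 1; 3; 2; 4],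
   [:: (1,4)]); (19, [:: 0; 1; 2; 3; 4], [::]); (17, [:: 1; 0; 2; 3; 4], [:: (1,4)]); (17, [:: 1;
   0; 3; 2; 4], [:: (1,4)]); (21, [:: 1; 0; 2; 3; 4], [::]); (18, [:: 2; 3; 0; 1; 4], [:: (1,4)]);
   (20, [:: 1; 0; 2; 3; 4], [::]); (20, [:: 1; 0; 3; 2; 4], [::]); (18, [:: 0; 1; 2; 3; 4],
   [:: (2,3)]); (18, [:: 2; 3; 0; 1; 4], [:: (0,2)]); (18, [:: 2; 3; 0; 1; 4], [:: (0,3)]); (18,
   [:: 2; 3; 0; 1; 4], [:: (0,4)]); (18, [:: 2; 3; 0; 1; 4], [:: (1,2)]); (18, [:: 2; 3; 0; 1; 4],
   [:: (1,3)]); (18, [:: 2; 3; 0; 1; 4], [:: (1,4)]); (18, [:: 2; 3; 0; 1; 4], [:: (2,3)]); (18,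
   [:: 2; 3; 0; 1; 4], [:: (2,4)]); (18, [:: 2; 3; 0; 1; 4], [:: (3,4)]); (18, [:: 0; 1; 2; 3; 4],
   [:: (2,4)]); (17, [:: 0; 1; 2; 3; 4], [:: (2,4)]); (17, [:: 0; 1; 3; 2; 4], [:: (2,4)]); (20,
   [:: 0; 1; 2; 3; 4], [::]); (17, [:: 1; 0; 2; 3; 4], [:: (2,4)]); (17, [:: 1; 0; 3; 2; 4],
   [:: (2,4)]); (20, [:: 1; 0; 2; 3; 4], [::]); (18, [:: 2; 3; 0; 1; 4], [:: (2,4)]); (21, [:: 2;
   3; 0; 1; 4], [::]); (19, [:: 2; 3; 0; 1; 4], [::]); (18, [:: 0; 1; 2; 3; 4], [:: (3,4)]); (17,
   [:: 0; 1; 2; 3; 4], [:: (3,4)]); (17, [:: 0; 1; 3; 2; 4], [:: (3,4)]); (20, [:: 0; 1; 3; 2; 4],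
   [::]); (17, [:: 1; 0; 2; 3; 4], [:: (3,4)]); (17, [:: 1; 0; 3; 2; 4], [:: (3,4)]); (20, [:: 1;
   0; 3; 2; 4], [::]); (18, [:: 2; 3; 0; 1; 4], [:: (3,4)]); (19, [:: 2; 3; 0; 1; 4], [::]); (21,
   [:: 3; 2; 0; 1; 4], [::])].
Local Open Scope ring_scope.

Definition all_edges : seq vedge :=
  [:: (0,1); (0,2); (0,3); (0,4); (1,2); (1,3); (1,4); (2,3); (2,4); (3,4)]%N.

Definition relations1 := base_relations ++ map fst noncommutative_steps.

Lemma relations1_zeros : zeros relations1.
Proof.
apply: (derivable_zeros (chk := derives)) base_zeros _; first exact: derives_zero.
by vm_cast_no_check (erefl true).
Qed.


(** * Commutativity *)

Definition weq n (u v : seq ('I_5 * 'I_5)) := hit n ('X_[mon u] + 'X_[mon v]).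

Lemma weq_refl n u v : map letter u = map letter v -> weq n u v.
Proof. by move=> /mon_eq E; rewrite /weq E addpp; apply: hit0. Qed.

Lemma weq_sym n u v : weq n u v -> weq n v u.
Proof. by rewrite /weq addrC. Qed.

Lemma weq_trans n v u w : weq n u v -> weq n v w -> weq n u w.
Proof.
move=> uv vw; have := hitD uv vw.
by rewrite addrA -[_ + _ + 'X_[mon v]]addrA addpp addr0.
Qed.

Lemma weq_zero n u v : hit n (wsum [:: u; v]) <-> weq n u v.
Proof. by rewrite /wsum !big_cons big_nil addr0. Qed.

Lemma weq_cat p n u v : all edgeb p -> weq n u v -> weq (size p + n) (p ++ u) (p ++ v).
Proof. by move=> hp /weq_zero /(hit_cat hp) /weq_zero. Qed.

Lemma weq_ltr n u u' v v' : map letter u = map letter u' -> map letter v = map letter v' ->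
  weq n u v -> weq n u' v'.
Proof. by rewrite /weq => /mon_eq -> /mon_eq ->. Qed.

(** The orbits of pairs of edges of K5 under relabelling. Adjacent edges are settled by [hit_swap];
    only disjoint ones call for the tables. *)
Variant edge_pair_spec (e f : 'I_5 * 'I_5) : Prop :=
| SameEdge of letter e = letter f
| AdjacentEdges s i j of uniq [:: s; i; j] & letter e = letter (s, i) & letter f = letter (s, j)
| DisjointEdges of uniq [:: e.1; e.2; f.1; f.2].

Lemma edge_pairP e f : edgeb e -> edgeb f -> edge_pair_spec e f.
Proof.
case: e f => [a b] [c d]; rewrite /edgeb /= => ab cd.
have [ac|ac] := eqVneq a c; first rewrite -ac in cd *.
  have [<-|bd] := eqVneq b d; first exact: SameEdge.
  apply: (@AdjacentEdges _ _ a b d) => //=.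
  by rewrite !inE negb_or ab cd bd.
have [ad|ad] := eqVneq a d.
  have [bc|bc] := eqVneq b c; first by apply: SameEdge; rewrite letterC ad bc.
  by apply: (@AdjacentEdges _ _ a b c); rewrite ?ad ?[letter (c, _)]letterC //= !inE negb_or -ad ab ac bc.
have [bc|bc] := eqVneq b c.
  apply: (@AdjacentEdges _ _ b a d); rewrite ?[letter (a, _)]letterC -?bc //= !inE negb_or.
  by rewrite eq_sym ab ad bc cd.
have [bd|bd] := eqVneq b d.
  apply: (@AdjacentEdges _ _ b a c); rewrite ?[letter (a, _)]letterC ?[letter (c, _)]letterC -?bd //= !inE negb_or.
  by rewrite eq_sym ab ac bc.
by apply: DisjointEdges; rewrite /= !inE !negb_or ab ac ad bc bd cd.
Qed.

(** Two disjoint edges leave one vertex of K5 over. Naming the vertices accordingly turns the edges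
    into 01 and 23, the normal form to which the tables apply. *)
Lemma frame e f : uniq [:: e.1; e.2; f.1; f.2] -> exists g : nat -> 'I_5,
  [/\ {in gtn 5 &, injective g}, e = (g 0%N, g 1%N), f = (g 2%N, g 3%N) &
      forall x, edgeb x -> exists2 y, y \in all_edges & letter x = letter (g y.1, g y.2)].
Proof.
case: e f => [a b] [c d] /= u4; set r4 := [:: a; b; c; d].
have [v vr] : exists v, v \notin r4.
  suff /card_gt0P [v] : (0 < #|[predC (mem r4)]|)%N by exists v.
  by have := cardC (mem r4); rewrite card_ord (card_uniqP (u4 : uniq r4)) /=; case: #|_|.
pose r := rcons r4 v.
have ur : uniq r by rewrite rcons_uniq vr.
have r5 : size r = 5%N by [].
have inr x : x \in r.
  have [_ ->] : (size r = size (enum 'I_5)) * (r =i enum 'I_5); last by rewrite mem_enum.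
  by apply: (uniq_min_size ur) => [z _|]; rewrite ?mem_enum // size_enum_ord.
exists (nth v r); split=> //.
  by move=> i j i5 j5 /eqP; rewrite nth_uniq // => /eqP.
case=> i j; rewrite /edgeb /= => ij.
exists (mkedge (index i r) (index j r)); last first.
  by rewrite /mkedge; case: ifP => _ /=; rewrite !nth_index // letterC.
have : index i r != index j r.
  by apply: contra ij => /eqP /(congr1 (nth v r)); rewrite !nth_index // => ->.
have : (index i r < 5)%N by have := inr i; rewrite -index_mem.
have : (index j r < 5)%N by have := inr j; rewrite -index_mem.
by case: (index i r) (index j r) => [|[|[|[|[|]]]]] [|[|[|[|[|]]]]].
Qed.

Definition step_of (x : nat * seq nat * vword) : seq step :=
  let: (r, t, s) := x in [:: ([::], r, t, s)].

Definition edge_pairs := [seq (x, y) | x <- all_edges, y <- all_edges].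

Lemma zero_table n K (T : eqType) (dom : seq T) tab (chk : checker) (F : T -> seq vword) :
  (forall n K l c, zeros K -> chk n K l c -> zero n l) -> zeros K ->
  all2 (fun x c => chk n K (F x) (step_of c)) dom tab ->
  forall x, x \in dom -> zero n (F x).
Proof.
move=> sound zK; elim: dom tab => [|y dom IH] [|c tab] //= /andP[ok /IH {}IH] x.
by rewrite inE => /predU1P[->|/IH //]; apply: sound ok.
Qed.

Lemma mid_zero x : x \in all_edges ->
  zero 3 [:: [:: x; (0, 1); (2, 3)]; [:: x; (2, 3); (0, 1)]]%N.
Proof.
move: x; apply: (zero_table (F := fun x => _) derives_zero relations1_zeros (tab := mid_table)).
by vm_cast_no_check (erefl true).
Qed.

Lemma front_zero xy : xy \in edge_pairs ->
  zero 4 [:: [:: (0, 1); (2, 3); xy.1; xy.2]; [:: (2, 3); (0, 1); xy.1; xy.2]]%N.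
Proof.
move: xy; apply: (zero_table (F := fun xy => _) derives_zero relations1_zeros (tab := front_table)).
by vm_cast_no_check (erefl true).
Qed.

Lemma weq_adjacent (e f : 'I_5 * 'I_5) s i j z : uniq [:: s; i; j] ->
  letter e = letter (s, i) -> letter f = letter (s, j) -> all edgeb z ->
  weq (size z).+2 [:: e, f & z] [:: f, e & z].
Proof.
move=> u le lf hz; have /weq_zero := (hit_swap u hz).1.
by apply: weq_ltr; rewrite /= le lf.
Qed.

Lemma weq_mid x e f z : edgeb x -> edgeb e -> edgeb f -> all edgeb z ->
  weq (size z).+3 [:: x, e, f & z] [:: x, f, e & z].
Proof.
move=> hx he hf hz; case: (edge_pairP he hf) => [lef|s i j u le lf|u].
- by apply: weq_refl; rewrite /= lef.
- by apply: (@weq_cat [:: x]); rewrite /= ?hx //; apply: weq_adjacent u le lf hz.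
have [g [ginj -> -> /(_ x hx) [y yE lx]]] := frame u.
have /weq_zero := mid_zero yE ginj hz.
by apply: weq_ltr; rewrite /= lx.
Qed.

Lemma weq_front e f x y z : edgeb e -> edgeb f -> edgeb x -> edgeb y -> all edgeb z ->
  weq (size z).+4 [:: e, f, x, y & z] [:: f, e, x, y & z].
Proof.
move=> he hf hx hy hz; case: (edge_pairP he hf) => [lef|s i j u le lf|u].
- by apply: weq_refl; rewrite /= lef.
- by apply: (weq_adjacent (z := [:: x, y & z]) u le lf); rewrite /= hx hy.
have [g [ginj -> -> gE]] := frame u.
have [[x' xE lx] [y' yE ly]] := (gE x hx, gE y hy).
have xyE : (x', y') \in edge_pairs by apply: allpairs_f.
have /weq_zero := front_zero xyE ginj hz.
by apply: weq_ltr; rewrite /= lx ly.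
Qed.

(** Away from the front, the letter before the pair allows [weq_mid]. At the front, length 4
    provides two letters behind the pair for [weq_front]; this is the origin of the bound 4. *)
Lemma weq_swap p e f z : all edgeb (p ++ [:: e, f & z]) -> (4 <= size (p ++ [:: e, f & z]))%N ->
  weq (size (p ++ [:: e, f & z])) (p ++ [:: e, f & z]) (p ++ [:: f, e & z]).
Proof.
case/lastP: p => [|p x].
  case: z => [|x [|y z]] //= /and5P[he hf hx hy hz] _; exact: weq_front.
rewrite !cat_rcons all_cat => /andP[hp /=/and4P[hx he hf hz]] _.
by rewrite size_cat; apply: weq_cat => //; apply: weq_mid.
Qed.

(** The induction carries a prefix [p] instead of cutting it off with [weq_cat], because a tail
    shorter than 4 is not covered by [weq_swap] on its own. *)
Lemma weq_perm u v : perm_eq u v -> all edgeb u -> (4 <= size u)%N -> weq (size u) u v.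
Proof.
suff gen p : perm_eq u v -> all edgeb (p ++ u) -> (4 <= size (p ++ u))%N ->
    weq (size (p ++ u)) (p ++ u) (p ++ v) by apply: (gen [::]).
elim: u v p => [|a u IH] v p.
  by move=> /perm_size /esym /size0nil -> _ _; apply: weq_refl.
move=> uv; have av : a \in v by rewrite -(perm_mem uv) inE eqxx.
case/splitPr: av uv => v1 v2 uv hpu spu.
have uv' : perm_eq u (v1 ++ v2).
  by rewrite -(perm_cons a) (perm_trans uv) // -cat1s perm_catCA.
apply: (@weq_trans _ (p ++ a :: v1 ++ v2)).
  by have := IH _ (rcons p a) uv'; rewrite !cat_rcons; apply.
have hpv : all edgeb (p ++ a :: v1 ++ v2).
  by rewrite -(perm_all _ (_ : perm_eq (p ++ a :: u) _)) // perm_cat2l perm_cons.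
have spv : size (p ++ a :: u) = size (p ++ a :: v1 ++ v2).
  by rewrite !size_cat /= (perm_size uv') size_cat.
rewrite spv in spu *; clear - hpv spu.
(* The letter [a] travels to its place by adjacent swaps; the prefix absorbs the letters already
   passed. *)
elim: v1 p hpv spu => [|b v1 IH] p hpv spv; first exact: weq_refl.
apply: (@weq_trans _ (p ++ [:: b, a & v1 ++ v2])); first exact: weq_swap.
have pE w : p ++ b :: w = rcons p b ++ w by rewrite cat_rcons.
have sE : size (p ++ (a :: (b :: v1) ++ v2)) = size (rcons p b ++ a :: v1 ++ v2).
  by rewrite !size_cat size_rcons /= addnS.
rewrite sE [p ++ [:: b, a & _]]pE [p ++ (b :: v1) ++ _]pE; apply: IH.
  have pm : perm_eq (rcons p b ++ a :: v1 ++ v2) (p ++ a :: (b :: v1) ++ v2).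
    by rewrite cat_rcons perm_cat2l; apply/permP => P /=; rewrite addnCA.
  by rewrite (perm_all _ pm).
by rewrite -sE.
Qed.


Definition edge_leq (e f : vedge) := (e.1 * 5 + e.2 <= f.1 * 5 + f.2)%N.

(** From length 4 on words may be compared as multisets, so cancellation is tested after sorting;
    [weq_perm] makes this sound. *)
Definition derives_comm : checker := fun n K l c =>
  let L := l ++ flatten (map (expand K) c) in
  [&& (4 <= n)%N, all (fun w => (size w == n) && all is_edge w) L,
      all (step_ok n K) c & cancels (map (sort edge_leq) L)].

Lemma derives_comm_zero n K l c : zeros K -> derives_comm n K l c -> zero n l.
Proof.
move=> zK /and4P[n4 /allP okL /allP ok ev] f finj z hz.
have := cancels_sum (fun w => 'X_[mon (lab f w ++ z)]) ev.
set L := l ++ _ in okL ev *.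
(* Each word differs from its sorted form by a hit; since the sorted forms cancel, the sum over [L]
   itself is hit. *)
have hL : hit (n + size z) (\sum_(w <- L)
    ('X_[mon (lab f w ++ z)] + 'X_[mon (lab f (sort edge_leq w) ++ z)])).
  rewrite big_seq; apply: hit_sum => w /okL /andP[/eqP wn we].
  have sz : (n + size z)%N = size (lab f w ++ z) by rewrite size_cat size_map wn.
  rewrite sz; apply: weq_perm; last by rewrite -sz; lia.
    by rewrite perm_cat2r perm_map // perm_sym perm_sort.
  by rewrite all_cat is_edge_lab.
rewrite big_map => E; move: hL; rewrite big_split /= E addr0 big_cat /= => h.
have hc : hit (n + size z) (\sum_(w <- flatten (map (expand K) c)) 'X_[mon (lab f w ++ z)]).
  elim: c ok {E ev okL h L} => [|x c IH] ok /=; first by rewrite big_nil; apply: hit0.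
  rewrite big_cat /=; apply: hitD.
    have := zero_expand zK (ok x (mem_head _ _)) finj hz.
    by rewrite /wsum big_map.
  by apply: IH => y yc; apply: ok; rewrite inE yc orbT.
by have := hitD h hc; rewrite -addrA addpp addr0 /wsum big_map.
Qed.

Definition relations2 := relations1 ++ map fst commutative_steps.

Lemma relations2_zeros : zeros relations2.
Proof.
apply: (derivable_zeros (chk := derives_comm)) relations1_zeros _; first exact: derives_comm_zero.
by vm_cast_no_check (erefl true).
Qed.

Lemma collapse_zero xy : xy \in edge_pairs ->
  zero 5 [:: [:: (0, 1); (0, 1); (2, 3); xy.1; xy.2]; [:: (0, 1); (2, 3); (2, 3); xy.1; xy.2]]%N.
Proof.
move: xy; apply: (zero_table (F := fun xy => _) derives_comm_zero relations2_zeros (tab := collapse_table)).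
by vm_cast_no_check (erefl true).
Qed.

Lemma weq_collapse e f z : edgeb e -> edgeb f -> all edgeb z -> (2 <= size z)%N ->
  weq (size z).+3 [:: e, e, f & z] [:: e, f, f & z].
Proof.
move=> he hf hz sz; case: (edge_pairP he hf) => [lef|s i j u le lf|u].
- by apply: weq_refl; rewrite /= lef.
(* For adjacent edges the doubled swap relation gives [eef = ffe], and reordering gives [eff]. *)
- apply: (@weq_trans _ [:: f, f, e & z]).
    have /weq_zero := (hit_swap u hz).2.
    by apply: weq_ltr; rewrite /= le lf.
  apply: (@weq_perm [:: f, f, e & z]); rewrite /= ?he ?hf //; last by lia.
  by apply/permP => P /=; lia.
case: z hz sz => [|x [|y z]] //= /and3P[hx hy hz] _.
have [g [ginj -> -> gE]] := frame u.
have [[x' xE lx] [y' yE ly]] := (gE x hx, gE y hy).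
have xyE : (x', y') \in edge_pairs by apply: allpairs_f.
have /weq_zero := collapse_zero xyE ginj hz.
by apply: weq_ltr; rewrite /= lx ly.
Qed.

Lemma perm_collapse (T : eqType) (a h : T) r q s t : perm_eq s [:: a, h & t] ->
  perm_eq (a :: r ++ q ++ s) [:: a, a, h & r ++ q ++ t] /\
  perm_eq [:: a, h, h & r ++ q ++ t] (r ++ (h :: q) ++ s).
Proof.
move=> /permP pt; split; apply/permP => P; rewrite /= !count_cat /= ?count_cat pt /=; lia.
Qed.

(** Excess letters are turned into [h] one at a time: an excess [a] is placed next to the [a] and
    the [h] contained in [s], and [weq_collapse] replaces [aah] by [ahh]. The count [k] records the
    copies of [h] gained so far. *)
Lemma weq_pad h s k r : uniq s -> h \in s -> all edgeb s -> {subset r <= s} ->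
  (5 <= size r + k + size s)%N ->
  weq (size r + k + size s) (r ++ nseq k h ++ s) (nseq (size r + k) h ++ s).
Proof.
move=> us hs es; elim: r k => [|a r IH] k rs n5; first exact: weq_refl.
have as_ : a \in s by apply: rs; rewrite mem_head.
have rs' : {subset r <= s} by move=> x xr; apply: rs; rewrite inE xr orbT.
have er : all edgeb r by apply/allP => x /rs' /(allP es).
have eh := allP es _ hs; have ea := allP es _ as_.
have enk : all edgeb (nseq k h) by apply/allP => x /nseqP[-> _].
have := IH k.+1 rs'; rewrite !addnS !addSn => /(_ n5); apply: weq_trans.
have sE u : perm_eq u (a :: r ++ nseq k h ++ s) -> size u = (size r + k + size s).+1.
  by move=> /perm_size ->; rewrite /= !size_cat size_nseq addnA.
have eE u : perm_eq u (a :: r ++ nseq k h ++ s) -> all edgeb u.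
  by move=> /perm_all ->; rewrite /= ea !all_cat er enk.
have ps : perm_eq s (a :: rem a s) by apply: perm_to_rem.
have [ah|ah] := eqVneq a h.
  rewrite -(sE _ (perm_refl _)); apply: weq_perm.
  - by rewrite ah /= -[h :: r ++ _]cat1s perm_catCA.
  - exact: eE (perm_refl _).
  - by rewrite (sE _ (perm_refl _)); apply: ltnW.
(* What remains of [s] once the [a] and the [h] that take part in the collapse are set aside. *)
pose t := rem h (rem a s).
have pt : perm_eq s [:: a, h & t].
  apply: (perm_trans ps); rewrite perm_cons; apply: perm_to_rem.
  by rewrite mem_rem_uniq // inE eq_sym ah.
have p1 : perm_eq (a :: r ++ nseq k h ++ s) [:: a, a, h & r ++ nseq k h ++ t].
  exact: (perm_collapse r (nseq k h) pt).1.
have p2 : perm_eq [:: a, h, h & r ++ nseq k h ++ t] (r ++ nseq k.+1 h ++ s).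
  exact: (perm_collapse r (nseq k h) pt).2.
have e2 : all edgeb (r ++ nseq k h ++ t).
  by move: (eE _ (perm_refl _)); rewrite (perm_all _ p1) /= => /and4P[].
have s2 : (size r + k + size s).+1 = (size (r ++ nseq k h ++ t)).+3.
  by rewrite -(sE _ (perm_refl _)) (perm_size p1).
apply: (@weq_trans _ [:: a, a, h & r ++ nseq k h ++ t]).
  rewrite -(sE _ (perm_refl _)); apply: weq_perm.
  - exact: p1.
  - exact: eE (perm_refl _).
  - by rewrite (sE _ (perm_refl _)); apply: ltnW.
apply: (@weq_trans _ [:: a, h, h & r ++ nseq k h ++ t]).
  have n5' : (5 <= (size (r ++ nseq k h ++ t)).+3)%N by rewrite -s2.
  by rewrite s2; apply: weq_collapse.
rewrite s2; apply: (@weq_perm [:: a, h, h & r ++ nseq k h ++ t]).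
- exact: p2.
- by rewrite /= ea eh.
- by rewrite /= -s2; apply: ltnW.
Qed.

Lemma perm_undup_rest (T : eqType) (w : seq T) :
  exists2 r, perm_eq w (r ++ undup w) & {subset r <= undup w}.
Proof.
elim: w => [|x w [r pr sr]] /=; first by exists [::].
case: ifP => xw.
  exists (x :: r); first by rewrite cat_cons perm_cons.
  by move=> y; rewrite inE => /predU1P[->|/sr //]; rewrite mem_undup.
exists r; last by move=> y /sr; rewrite inE orbC => ->.
by rewrite -[x :: undup w]cat1s perm_sym perm_catCA /= perm_cons perm_sym.
Qed.

(** Both words are brought to one form: each letter once, and all excess copies replaced by the same
    letter [h], the head of [u]. Equal lengths then force equal numbers of copies. *)
Lemma weq_set u v : u =i v -> size u = size v -> all edgeb u -> (5 <= size u)%N ->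
  weq (size u) u v.
Proof.
move=> uv suv eu u5.
case: u uv suv eu u5 => [|h u'] //; set u := h :: u' => uv suv eu u5.
have hv : h \in v by rewrite -uv mem_head.
have ev : all edgeb v by apply/allP => x; rewrite -uv => /(allP eu).
have canon w : all edgeb w -> (5 <= size w)%N -> h \in w -> exists2 k,
    weq (size w) w (nseq k h ++ undup w) & size w = (k + size (undup w))%N.
  move=> ew w5 hw; have [r pr sr] := perm_undup_rest w.
  have sw : size w = (size r + 0 + size (undup w))%N.
    by rewrite (perm_size pr) size_cat addn0.
  exists (size r); last by rewrite sw addn0.
  apply: (@weq_trans _ (r ++ undup w)); first by apply: weq_perm => //; apply: ltnW.
  have := @weq_pad h (undup w) 0 r (undup_uniq w).
  rewrite mem_undup hw -sw addn0; apply=> //.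
  by apply/allP => x; rewrite mem_undup => /(allP ew).
have [k wk sk] := canon u eu u5 (mem_head _ _).
have v5 : (5 <= size v)%N by rewrite -suv.
have [l wl sl] := canon v ev v5 hv; rewrite -suv in wl sl.
have pu : perm_eq (undup u) (undup v).
  by apply: uniq_perm; rewrite ?undup_uniq // => x; rewrite !mem_undup uv.
have kl : k = l.
  by apply/eqP; rewrite -(eqn_add2r (size (undup v))) -sl -(perm_size pu) -sk.
apply: weq_trans wk _; apply: weq_trans (weq_sym wl).
have sn : size u = size (nseq k h ++ undup u) by rewrite sk size_cat size_nseq.
rewrite sn -kl; apply: weq_perm; rewrite -?sn //; last by apply: ltnW.
  by rewrite perm_cat2l.
rewrite all_cat; apply/andP; split; apply/allP => x.
  by move/nseqP=> [-> _]; apply: (allP eu); rewrite mem_head.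
by rewrite mem_undup => /(allP eu).
Qed.

Local Open Scope nat_scope.

(** * Reduction of sets of letters *)

(* A set of edges is a sequence of 10 bits, indexed by [all_edges]; the two codes are its
   halves, least significant bit first. *)
Definition decode (c : nat * nat) : bitseq :=
  [seq odd (iter i half c.1) | i <- iota 0 5] ++ [seq odd (iter i half c.2) | i <- iota 0 5].

(** The choice is justified by computation: [closure_complete] shows that these sets span,
    [inverse_ok] that they are independent together with the sets missing a variable. All have at
    most 5 letters, so they fit into words of every length from 5 on. *)
Definition positive_basis : seq bitseq := map decode
 [:: (19,0); (20,0); (21,0); (24,0); (27,0); (30,0); (5,1); (19,1); (21,1); (24,1); (2,2); (5,2);
   (9,2); (10,2); (12,2); (13,2); (19,2); (21,2); (20,3); (26,3); (5,4); (6,4); (14,4); (22,4);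
   (2,5); (3,5); (10,5); (16,5); (20,5); (28,5); (0,6); (5,6); (8,6); (11,6); (6,7); (4,8);
   (10,8); (12,8); (14,8); (20,8); (24,8); (26,8); (1,9); (8,9); (10,9); (1,10); (4,10); (11,10);
   (16,10); (20,10); (4,11); (6,11); (17,12); (16,13); (1,16); (2,16); (12,16); (17,16); (18,16); (19,16);
   (26,16); (6,17); (8,17); (10,17); (12,17); (14,17); (1,18); (6,18); (16,18); (21,18); (0,19); (5,19);
   (12,19); (6,20); (16,20); (22,20); (12,21); (16,21); (0,22); (16,23); (2,24); (12,24); (13,24); (16,24);
   (26,24); (17,26); (0,28); (10,28); (20,28); (0,30)].

(* The step [(a, k, c)] multiplies the Pluecker relation on the vertices other than [a] by
   the letters of [decode c], and solves it for the term containing the [k]-th matching. *)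
Definition closure_steps : seq (nat * nat * (nat * nat)) :=
 [:: (3,1,(0,1)); (3,0,(8,0)); (2,1,(0,16)); (2,2,(0,18)); (0,1,(0,24)); (1,0,(0,2)); (3,0,(2,16)); (1,2,(16,0));
   (1,1,(24,0)); (4,0,(2,4)); (0,0,(0,16)); (1,1,(10,1)); (4,0,(12,8)); (0,1,(0,20)); (0,0,(0,28)); (3,2,(0,2));
   (3,0,(8,2)); (3,1,(8,8)); (3,2,(8,10)); (3,0,(10,8)); (3,1,(0,10)); (3,2,(10,0)); (3,0,(0,8)); (3,0,(2,8));
   (0,2,(16,4)); (0,2,(16,12)); (0,1,(16,0)); (0,2,(1,0)); (2,1,(16,0)); (4,1,(4,2)); (4,0,(17,0)); (2,0,(16,1));
   (4,0,(0,3)); (4,0,(4,3)); (4,0,(17,1)); (4,2,(2,5)); (4,2,(3,4)); (0,0,(8,0)); (2,0,(0,8)); (2,0,(0,9));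
   (0,2,(1,16)); (0,2,(1,17)); (2,2,(1,6)); (1,2,(4,2)); (2,0,(2,16)); (3,2,(10,2)); (3,2,(9,8)); (3,0,(24,2));
   (3,0,(2,2)); (3,0,(26,0)); (3,1,(24,8)); (0,2,(10,0)); (2,1,(2,8)); (4,0,(8,8)); (1,2,(6,2)); (2,0,(6,8));
   (3,0,(4,8)); (0,0,(14,0)); (2,0,(10,4)); (3,2,(12,4)); (1,2,(1,0)); (1,0,(20,0)); (4,0,(6,16)); (2,0,(8,17));
   (2,0,(4,18)); (2,2,(1,18)); (2,0,(6,16)); (1,2,(5,0)); (1,1,(5,4)); (4,1,(12,4)); (1,0,(1,4)); (1,0,(1,12));
   (3,1,(4,4)); (4,1,(4,8)); (4,1,(2,16)); (0,0,(6,1)); (2,0,(2,5)); (4,2,(4,6)); (4,1,(0,6)); (4,2,(0,7));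
   (2,0,(1,17)); (2,1,(0,17)); (2,0,(0,19)); (1,1,(20,1)); (2,0,(20,4)); (3,0,(4,5)); (4,0,(8,5)); (0,0,(20,0));
   (0,0,(20,1)); (4,0,(1,20)); (2,0,(1,5)); (4,0,(4,16)); (4,0,(4,17)); (2,2,(5,4)); (0,0,(6,2)); (2,0,(2,9));
   (4,0,(4,10)); (1,2,(20,2)); (2,2,(18,16)); (0,2,(3,16)); (0,2,(10,1)); (3,1,(2,17)); (1,2,(1,6)); (1,2,(0,3));
   (3,2,(0,17)); (4,2,(0,18)); (4,2,(0,19)); (2,1,(0,6)); (2,1,(0,7)); (2,0,(8,6)); (0,1,(20,2)); (0,1,(4,0));
   (2,2,(0,4)); (2,2,(4,4)); (1,1,(8,1)); (2,0,(8,4)); (2,0,(12,4)); (0,0,(12,0)); (2,0,(4,8)); (2,0,(4,9));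
   (1,1,(1,20)); (2,1,(9,4)); (0,1,(28,0)); (3,0,(20,16)); (4,0,(24,16)); (1,2,(1,24)); (1,2,(24,1)); (3,0,(4,9));
   (4,0,(8,9)); (4,0,(1,24)); (1,0,(16,1)); (2,0,(16,4)); (2,0,(16,5)); (3,0,(0,5)); (0,0,(5,0)); (0,0,(5,1));
   (1,0,(1,1)); (1,0,(5,1)); (3,2,(4,1)); (0,1,(2,1)); (4,0,(18,16)); (0,1,(1,20)); (0,2,(5,16)); (2,2,(20,16));
   (4,1,(17,16)); (1,2,(1,17)); (2,2,(2,1)); (2,1,(2,17)); (4,2,(3,16)); (2,2,(6,1)); (0,2,(2,0)); (4,0,(0,8));
   (2,2,(4,6)); (2,1,(2,0)); (4,2,(8,0)); (4,0,(10,0)); (4,0,(14,0)); (3,0,(6,0)); (1,1,(3,4)); (4,2,(10,4));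
   (1,2,(3,8)); (3,2,(6,8)); (4,2,(6,8)); (3,2,(10,4)); (4,0,(2,8)); (0,1,(5,2)); (2,2,(20,2)); (2,2,(17,16));
   (4,1,(1,18)); (2,2,(1,9)); (4,1,(8,3)); (0,0,(9,0)); (2,1,(1,8)); (2,0,(2,2)); (4,2,(8,2)); (0,1,(9,16));
   (2,1,(24,16)); (1,0,(5,2)); (2,2,(5,8)); (3,2,(4,10)); (1,1,(1,18)); (2,2,(2,18)); (3,2,(3,16)); (2,0,(28,0));
   (4,1,(12,2)); (2,1,(8,9)); (2,2,(3,16)); (1,0,(9,16)); (2,1,(12,8)); (3,1,(12,16)); (1,1,(9,0)); (1,1,(11,0));
   (2,1,(10,0)); (1,0,(8,2)); (2,0,(8,8)); (1,0,(9,8)); (1,0,(13,0)); (3,1,(12,8)); (2,0,(10,2)); (3,0,(12,2));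
   (3,0,(24,1)); (3,0,(2,3)); (4,0,(24,2)); (1,1,(4,17)); (2,1,(4,20)); (0,2,(4,17)); (1,2,(0,17)); (0,1,(4,18));
   (2,2,(0,22)); (1,1,(8,17)); (2,1,(8,20)); (2,2,(0,25)); (2,1,(4,24)); (0,2,(8,16)); (2,1,(8,24)); (2,2,(16,10));
   (2,0,(4,16)); (2,0,(4,17)); (2,2,(5,16)); (0,1,(0,18)); (0,1,(16,2)); (0,0,(0,26)); (1,0,(14,0)); (1,2,(12,0));
   (1,2,(12,16)); (1,0,(4,0)); (1,1,(4,16)); (1,1,(6,0)); (1,2,(0,16)); (1,2,(2,0)); (1,0,(8,16)); (1,2,(8,0));
   (1,2,(0,8)); (1,2,(0,24)); (1,2,(2,8)); (1,1,(2,24)); (1,0,(8,8)); (1,1,(8,12)); (1,2,(4,24)); (1,2,(2,16));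
   (1,2,(6,16)); (1,2,(6,8)); (1,0,(12,8)); (4,1,(5,0)); (4,0,(5,1)); (2,2,(17,0)); (2,2,(21,0)); (4,1,(1,2));
   (4,1,(5,2)); (2,1,(17,1)); (2,1,(25,0)); (3,1,(9,1)); (4,1,(9,1)); (3,1,(5,2)); (2,1,(11,0)); (4,2,(9,0));
   (4,2,(11,0)); (2,2,(7,0)); (3,1,(16,4)); (4,1,(16,8)); (3,0,(18,4)); (0,2,(18,1)); (4,0,(16,9)); (4,0,(16,6));
   (0,1,(17,0)); (4,1,(16,2)); (4,1,(17,2)); (0,2,(17,1)); (2,2,(1,0)); (2,2,(1,2)); (2,2,(5,0)); (2,2,(5,2));
   (2,1,(1,1)); (2,0,(9,0)); (2,0,(9,2)); (2,0,(13,0)); (2,1,(8,16)); (2,1,(9,16)); (0,1,(11,0)); (1,1,(3,2));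
   (3,2,(9,4)); (4,2,(10,2)); (3,2,(10,1)); (4,2,(9,8)); (1,1,(17,0)); (1,1,(17,4)); (3,1,(1,4)); (3,1,(17,4));
   (4,1,(24,4)); (4,1,(25,0)); (2,1,(18,0)); (2,1,(18,1)); (3,0,(2,1)); (3,0,(18,1)); (4,0,(24,1)); (4,0,(26,0));
   (1,2,(21,0)); (3,1,(20,8)); (3,1,(21,0)); (4,1,(5,8)); (3,1,(20,4)); (4,1,(20,8)); (4,1,(1,12)); (0,0,(3,2));
   (3,0,(1,6)); (2,2,(22,0)); (3,0,(20,2)); (3,0,(22,0)); (4,0,(6,2)); (3,0,(20,1)); (4,0,(20,2)); (4,0,(2,3));
   (4,1,(9,4)); (3,0,(17,16)); (0,0,(1,12)); (0,1,(1,10)); (3,2,(0,6)); (4,1,(0,10)); (0,2,(1,24)); (0,2,(17,8));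
   (2,2,(16,8)); (3,1,(16,16)); (0,0,(1,2)); (0,0,(1,3)); (3,2,(0,3)); (3,2,(1,3)); (0,0,(24,2)); (1,0,(24,2));
   (3,0,(8,6)); (0,0,(2,3)); (3,2,(2,9)); (4,0,(0,11)); (4,0,(2,10)); (4,1,(16,10)); (0,2,(24,1)); (2,0,(16,9));
   (2,0,(24,8)); (3,1,(8,9)); (1,2,(18,2)); (3,0,(18,16)); (0,1,(1,18)); (0,1,(17,2)); (2,2,(16,18)); (2,0,(24,2));
   (3,0,(8,3)); (0,1,(8,2)); (0,1,(8,18)); (3,0,(0,18)); (3,0,(8,18)); (3,0,(2,18)); (4,0,(16,18)); (4,0,(24,8));
   (4,1,(0,28)); (0,1,(6,4)); (1,1,(20,4)); (4,1,(2,20)); (1,0,(16,4)); (4,1,(0,12)); (4,1,(16,12)); (1,1,(0,5));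
   (1,1,(0,21)); (4,2,(0,20)); (4,2,(0,21)); (0,2,(2,20)); (1,2,(16,20)); (1,1,(18,4)); (0,0,(2,5)); (4,2,(0,13));
   (0,2,(4,12)); (1,2,(0,13)); (1,0,(4,5)); (0,1,(2,16)); (0,1,(2,18)); (1,1,(0,22)); (1,1,(2,6)); (3,2,(0,22));
   (3,2,(2,20)); (0,1,(8,20)); (0,1,(24,4)); (1,1,(16,16)); (1,1,(24,16)); (3,1,(16,20)); (3,1,(8,20)); (0,0,(4,10));
   (1,0,(4,6)); (2,2,(0,14)); (2,2,(4,12)); (0,0,(8,5)); (1,0,(8,9)); (2,1,(0,13)); (2,1,(8,12)); (0,2,(2,17));
   (1,2,(2,9)); (4,2,(0,25)); (4,2,(2,24)); (3,2,(0,25)); (3,2,(4,12)); (1,0,(16,9)); (2,1,(16,12)); (3,1,(0,13));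
   (1,2,(20,16)); (4,1,(4,24)); (3,1,(4,24)); (2,2,(2,20)); (2,1,(16,20)); (4,1,(16,0)); (4,1,(4,0)); (4,2,(16,1));
   (1,1,(4,4)); (1,1,(4,20)); (1,1,(6,4)); (1,0,(0,4)); (1,0,(0,12)); (1,0,(4,12)); (0,1,(0,4)); (0,1,(0,2));
   (0,2,(0,12)); (0,1,(0,8)); (0,2,(10,8)); (1,2,(24,8)); (3,1,(2,24)); (1,0,(16,8)); (1,0,(16,12)); (3,1,(0,12));
   (3,1,(16,12)); (1,2,(0,10)); (1,2,(0,26)); (3,2,(0,24)); (3,2,(0,26)); (0,2,(2,24)); (1,2,(16,24)); (1,2,(18,8));
   (0,0,(2,10)); (3,2,(0,14)); (1,0,(8,10)); (3,1,(3,0)); (3,0,(19,0)); (3,1,(11,0)); (3,2,(1,0)); (3,2,(1,2));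
   (3,2,(3,2)); (3,1,(18,0)); (3,1,(18,8)); (3,0,(17,0)); (3,0,(17,2)); (3,0,(18,2)); (4,0,(0,5)); (4,1,(16,5));
   (4,1,(4,5)); (4,1,(0,1)); (4,1,(1,1)); (4,2,(1,5)); (4,2,(16,4)); (4,0,(18,4)); (4,0,(6,4)); (4,2,(2,0));
   (4,2,(2,1)); (4,0,(1,0)); (4,2,(3,0)); (4,2,(3,1)); (4,0,(20,4)); (4,0,(18,1)); (4,0,(6,1)); (2,2,(8,0));
   (2,2,(8,2)); (2,2,(12,0)); (2,2,(12,2)); (2,1,(0,1)); (2,1,(0,2)); (0,2,(0,5)); (0,2,(0,21)); (0,2,(16,5));
   (0,0,(0,1)); (0,0,(0,3)); (0,1,(0,7)); (0,1,(16,17)); (0,0,(0,6)); (0,0,(0,14)); (0,0,(0,13)); (0,0,(0,11));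
   (0,2,(0,25)); (0,2,(16,9)); (0,0,(0,15)); (0,1,(8,22)); (0,0,(8,14)); (0,0,(8,13)); (0,0,(8,11)); (0,0,(8,7));
   (0,1,(24,6)); (0,1,(4,22)); (0,0,(4,14)); (0,0,(4,13)); (0,0,(4,11)); (0,0,(4,7)); (0,1,(20,6)); (0,2,(12,24));
   (0,1,(12,20)); (0,0,(12,12)); (0,1,(12,18)); (0,0,(12,10)); (0,2,(12,17)); (0,0,(12,5)); (0,0,(12,3)); (0,2,(28,8));
   (0,1,(28,4)); (0,1,(28,2)); (0,2,(28,1)); (0,1,(2,22)); (0,0,(2,14)); (0,0,(2,13)); (0,0,(2,11)); (0,0,(2,7));
   (0,1,(18,6)); (0,2,(10,24)); (0,1,(10,20)); (0,0,(10,12)); (0,1,(10,18)); (0,0,(10,10)); (0,2,(10,17)); (0,0,(10,5));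
   (0,0,(10,3)); (0,2,(26,8)); (0,1,(26,4)); (0,1,(26,2)); (0,2,(26,1)); (0,2,(6,24)); (0,1,(6,20)); (0,0,(6,12));
   (0,1,(6,18)); (0,0,(6,10)); (0,2,(6,17)); (0,0,(6,5)); (0,0,(6,3)); (0,2,(22,8)); (0,1,(22,4)); (0,1,(22,2));
   (0,2,(22,1)); (0,1,(1,22)); (0,0,(1,14)); (0,0,(1,13)); (0,0,(1,11)); (0,0,(1,7)); (0,1,(17,6)); (0,2,(9,24));
   (0,1,(9,20)); (0,0,(9,12)); (0,1,(9,18)); (0,0,(9,10)); (0,2,(9,17)); (0,0,(9,5)); (0,0,(9,3)); (0,2,(25,8));
   (0,1,(25,4)); (0,1,(25,2)); (0,2,(25,1)); (0,2,(5,24)); (0,1,(5,20)); (0,0,(5,12)); (0,1,(5,18)); (0,0,(5,10));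
   (0,2,(5,17)); (0,0,(5,5)); (0,0,(5,3)); (0,2,(21,8)); (0,1,(21,4)); (0,1,(21,2)); (0,2,(21,1)); (0,2,(3,24));
   (0,1,(3,20)); (0,0,(3,12)); (0,1,(3,18)); (0,0,(3,10)); (0,2,(3,17)); (0,0,(3,5)); (0,0,(3,3)); (0,2,(19,8));
   (0,1,(19,4)); (0,1,(19,2)); (0,2,(19,1)); (1,1,(8,7)); (1,0,(24,6)); (1,1,(24,17)); (1,0,(24,9)); (1,2,(20,18));
   (1,0,(20,6)); (1,0,(20,9)); (1,0,(12,12)); (1,0,(12,10)); (1,0,(12,6)); (1,0,(12,9)); (1,0,(12,5)); (1,0,(12,3));
   (1,0,(28,8)); (1,0,(28,4)); (1,0,(28,2)); (1,0,(28,1)); (1,2,(2,11)); (1,1,(2,7)); (1,1,(10,6)); (1,1,(10,5));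
   (1,1,(10,3)); (1,1,(26,4)); (1,1,(26,2)); (1,1,(26,1)); (1,2,(6,3)); (1,2,(22,2)); (1,2,(22,1)); (1,2,(1,11));
   (1,1,(1,7)); (1,2,(17,18)); (1,0,(17,6)); (1,1,(17,17)); (1,0,(17,9)); (1,1,(9,20)); (1,0,(9,12)); (1,1,(9,18));
   (1,0,(9,10)); (1,1,(9,17)); (1,0,(9,9)); (1,1,(25,16)); (1,0,(25,8)); (1,0,(5,12)); (1,2,(5,18)); (1,0,(5,6));
   (1,2,(5,17)); (1,0,(5,5)); (1,2,(21,16)); (1,0,(21,4)); (1,0,(13,8)); (1,0,(13,4)); (1,0,(13,2)); (1,0,(13,1));
   (1,0,(29,0)); (1,2,(3,10)); (1,1,(3,6)); (1,2,(3,9)); (1,1,(3,5)); (1,2,(19,8)); (1,1,(19,4)); (1,1,(11,4));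
   (1,1,(11,2)); (1,1,(11,1)); (1,1,(27,0)); (1,2,(7,2)); (1,2,(7,1)); (1,2,(23,0)); (2,0,(24,9)); (2,0,(20,6));
   (2,0,(12,3)); (2,0,(28,2)); (2,0,(28,1)); (2,0,(10,6)); (2,0,(10,5)); (2,0,(10,3)); (2,0,(26,4)); (2,0,(26,2));
   (2,0,(6,10)); (2,0,(6,9)); (2,0,(6,3)); (2,0,(22,8)); (2,0,(22,1)); (2,1,(9,12)); (2,1,(9,9)); (2,1,(9,5));
   (2,1,(25,8)); (2,1,(25,4)); (2,1,(25,1)); (2,2,(5,12)); (2,2,(21,8)); (2,2,(21,4)); (2,2,(3,10)); (2,2,(3,6));
   (2,1,(3,9)); (2,1,(3,5)); (2,2,(19,2)); (2,1,(19,1)); (2,1,(11,1)); (2,1,(27,0)); (2,2,(23,0)); (3,0,(28,4));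
   (3,1,(28,1)); (3,0,(2,7)); (3,0,(26,2)); (3,0,(26,1)); (3,0,(22,2)); (3,0,(22,1)); (3,1,(25,4)); (3,1,(21,16));
   (3,1,(21,4)); (3,2,(3,17)); (3,2,(3,5)); (4,0,(22,1)); (0,0,(8,15)); (0,0,(4,15)); (0,1,(12,22)); (0,0,(12,14));
   (0,0,(12,13)); (0,0,(12,11)); (0,0,(12,7)); (0,1,(28,6)); (0,0,(2,15)); (0,1,(10,22)); (0,0,(10,14)); (0,0,(10,13));
   (0,0,(10,11)); (0,0,(10,7)); (0,1,(26,6)); (0,1,(6,22)); (0,0,(6,14)); (0,0,(6,13)); (0,0,(6,11)); (0,0,(6,7));
   (0,1,(22,6)); (0,2,(14,24)); (0,1,(14,20)); (0,0,(14,12)); (0,1,(14,18)); (0,0,(14,10)); (0,2,(14,17)); (0,0,(14,5));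
   (0,0,(14,3)); (0,2,(30,8)); (0,1,(30,4)); (0,1,(30,2)); (0,2,(30,1)); (0,0,(1,15)); (0,1,(9,22)); (0,0,(9,14));
   (0,0,(9,13)); (0,0,(9,11)); (0,0,(9,7)); (0,1,(25,6)); (0,1,(5,22)); (0,0,(5,14)); (0,0,(5,13)); (0,0,(5,11));
   (0,0,(5,7)); (0,1,(21,6)); (0,2,(13,24)); (0,1,(13,20)); (0,0,(13,12)); (0,1,(13,18)); (0,0,(13,10)); (0,2,(13,17));
   (0,0,(13,5)); (0,0,(13,3)); (0,2,(29,8)); (0,1,(29,4)); (0,1,(29,2)); (0,2,(29,1)); (0,1,(3,22)); (0,0,(3,14));
   (0,0,(3,13)); (0,0,(3,11)); (0,0,(3,7)); (0,1,(19,6)); (0,2,(11,24)); (0,1,(11,20)); (0,0,(11,12)); (0,1,(11,18));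
   (0,0,(11,10)); (0,2,(11,17)); (0,0,(11,5)); (0,0,(11,3)); (0,2,(27,8)); (0,1,(27,4)); (0,1,(27,2)); (0,2,(27,1));
   (0,2,(7,24)); (0,1,(7,20)); (0,0,(7,12)); (0,1,(7,18)); (0,0,(7,10)); (0,2,(7,17)); (0,0,(7,5)); (0,0,(7,3));
   (0,2,(23,8)); (0,1,(23,4)); (0,1,(23,2)); (0,2,(23,1)); (1,0,(28,6)); (1,0,(28,9)); (1,1,(10,7)); (1,1,(9,7));
   (1,0,(25,6)); (1,1,(25,17)); (1,0,(25,9)); (1,2,(21,18)); (1,0,(21,6)); (1,0,(21,9)); (1,0,(13,12)); (1,0,(13,10));
   (1,0,(13,6)); (1,0,(13,9)); (1,0,(13,5)); (1,0,(13,3)); (1,0,(29,8)); (1,0,(29,4)); (1,0,(29,2)); (1,0,(29,1));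
   (1,2,(3,11)); (1,1,(3,7)); (1,1,(11,6)); (1,1,(11,5)); (1,1,(11,3)); (1,1,(27,4)); (1,1,(27,2)); (1,1,(27,1));
   (1,2,(7,3)); (1,2,(23,2)); (1,2,(23,1)); (2,1,(27,1)); (0,0,(12,15)); (0,0,(10,15)); (0,0,(6,15)); (0,1,(14,22));
   (0,0,(14,14)); (0,0,(14,13)); (0,0,(14,11)); (0,0,(14,7)); (0,1,(30,6)); (0,0,(9,15)); (0,0,(5,15)); (0,1,(13,22));
   (0,0,(13,14)); (0,0,(13,13)); (0,0,(13,11)); (0,0,(13,7)); (0,1,(29,6)); (0,0,(3,15)); (0,1,(11,22)); (0,0,(11,14));
   (0,0,(11,13)); (0,0,(11,11)); (0,0,(11,7)); (0,1,(27,6)); (0,1,(7,22)); (0,0,(7,14)); (0,0,(7,13)); (0,0,(7,11));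
   (0,0,(7,7)); (0,1,(23,6)); (0,2,(15,24)); (0,1,(15,20)); (0,0,(15,12)); (0,1,(15,18)); (0,0,(15,10)); (0,2,(15,17));
   (0,0,(15,5)); (0,0,(15,3)); (0,2,(31,8)); (0,1,(31,4)); (0,1,(31,2)); (0,2,(31,1)); (1,0,(29,6)); (1,0,(29,9));
   (1,1,(11,7)); (0,0,(14,15)); (0,0,(13,15)); (0,0,(11,15)); (0,0,(7,15)); (0,1,(15,22)); (0,0,(15,14)); (0,0,(15,13));
   (0,0,(15,11)); (0,0,(15,7)); (0,1,(31,6)); (0,0,(15,15))].

Fixpoint bitseqs k : seq bitseq :=
  if k is k'.+1 then let s := bitseqs k' in map (cons false) s ++ map (cons true) s
  else [:: [::]].

Definition setU2 (X Y : bitseq) : bitseq := [seq p.1 || p.2 | p <- zip X Y].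

(** A letter is the complement of its edge, hence contains [v] exactly when [v] is not an end of the
    edge. *)
Definition covers (X : bitseq) := all (fun v =>
  has (fun p : bool * vedge => [&& p.1, v != p.2.1 & v != p.2.2]) (zip X all_edges)) (iota 0 5).

Definition quads := [:: [:: 1; 2; 3; 4]; [:: 0; 2; 3; 4]; [:: 0; 1; 3; 4]; [:: 0; 1; 2; 4]; [:: 0; 1; 2; 3]].

Definition matchings (q : seq nat) : seq (vedge * vedge) :=
  let: v := nth 0 q in
  [:: ((v 0, v 1), (v 2, v 3)); ((v 0, v 2), (v 1, v 3)); ((v 0, v 3), (v 1, v 2))].

Definition set2 (p : vedge * vedge) : bitseq :=
  [seq (e == p.1) || (e == p.2) | e <- all_edges].

(** Sets of bit sequences with fast membership, for evaluating the closure certificate. *)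
Inductive trie := Empty | Node of bool & trie & trie.

Fixpoint tmem (t : trie) (x : bitseq) : bool :=
  match t, x with
  | Empty, _ => false
  | Node b _ _, [::] => b
  | Node _ l r, c :: x' => tmem (if c then r else l) x'
  end.

Fixpoint tadd (t : trie) (x : bitseq) : trie :=
  let: (b, l, r) := if t is Node b l r then (b, l, r) else (false, Empty, Empty) in
  match x with
  | [::] => Node true l r
  | c :: x' => if c then Node b l (tadd r x') else Node b (tadd l x') r
  end.

Lemma tmem_add t x y : tmem (tadd t x) y = (y == x) || tmem t y.
Proof.
elim: x t y => [|c x IH] [|b l r] [|c' y] //=.
- by case: c'.
- by case: c.
- by case: c; case: c' => //=; rewrite IH eqseq_cons //= ?orbF.
- by case: c.
by case: c; case: c' => //=; rewrite IH eqseq_cons.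
Qed.

(** The words of the relation with cofactor [m] have to accommodate [count id m + 2] letters. A word
    carrying [n] in the range of interest has length at least 5 and at least [count id n], so the
    test against the maximum leaves room at every length. If [x == y], these two terms cancel and
    [n] is itself hit. *)
Fixpoint closure (K : trie) (l : seq (nat * nat * (nat * nat))) : option trie :=
  if l is (a, k, c) :: l' then
    let m := decode c in
    let s := [seq setU2 (set2 p) m | p <- rot k (matchings (nth [::] quads a))] in
    let: (n, x, y) := (nth [::] s 0, nth [::] s 1, nth [::] s 2) in
    if [&& a < 5, has id m, count id m + 2 <= maxn 5 (count id n)
         & (x == y) || (tmem K x && tmem K y)]
    then closure (tadd K n) l' else None
  else Some K.

Definition all_sets := bitseqs 10.

Lemma closure_complete :
  if closure (foldl tadd Empty positive_basis) closure_steps is Some K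
  then all (fun X => covers X ==> tmem K X) all_sets else false.
Proof. by vm_cast_no_check (erefl true). Qed.

Local Open Scope ring_scope.

(** * From bit sequences to words *)

Definition vlab (e : vedge) : 'I_5 * 'I_5 := (inord e.1, inord e.2).
Definition edges5 := map vlab all_edges.
Definition setw (X : bitseq) := map vlab (mask X all_edges).

(* The word of length [n] using exactly the letters of [X] (for [X] nonempty
   of size at most [n]); the first letter is repeated. *)
Definition canw n (X : bitseq) :=
  nseq (n - size (setw X)) (head (ord0, ord0) (setw X)) ++ setw X.

Lemma mask_setU2 (T : eqType) (s : seq T) X Y : size X = size s -> size Y = size s ->
  mask (setU2 X Y) s =i mask X s ++ mask Y s.
Proof.
elim: s X Y => [|x s IH] [|a X] [|b Y] //= [sX] [sY] y.
have {}IH := IH X Y sX sY y; rewrite mem_cat in IH.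
by case: a; case: b; rewrite /= ?inE !mem_cat ?inE IH; do ![case: (_ == _)|case: (_ \in _)].
Qed.

Lemma all_edges_edgeb : all edgeb edges5.
Proof.
rewrite all_map; apply/allP => -[i j] /= h.
have /allP ok : all is_edge all_edges by [].
have /and3P[/= i5 j5 ij] := ok _ h.
by apply: contra ij => /eqP /(congr1 val) /=; rewrite !inordK // => ->.
Qed.

Lemma setw_edges X : {subset setw X <= edges5}.
Proof. by move=> _ /mapP[e /mem_mask he ->]; apply: map_f. Qed.

Lemma setw_edgeb X : all edgeb (setw X).
Proof. by apply/allP => e /setw_edges /(allP all_edges_edgeb). Qed.

Lemma size_setw X : size X = 10%N -> size (setw X) = count id X.
Proof. by move=> sX; rewrite size_map size_mask. Qed.

Lemma mem_canw n X : size X = 10%N -> has id X -> canw n X =i setw X.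
Proof.
move=> sX hX e; rewrite mem_cat; case: nseqP => [[-> _]|//].
by rewrite orTb; case E: (setw X) => [|x s]; rewrite ?mem_head //; move: hX;
  rewrite has_count -size_setw // E.
Qed.

Lemma canw_edgeb n X : size X = 10%N -> has id X -> all edgeb (canw n X).
Proof.
by move=> sX hX; apply/allP => e; rewrite mem_canw // => /(allP (setw_edgeb X)).
Qed.

Lemma size_canw n X : size X = 10%N -> (count id X <= n)%N -> size (canw n X) = n.
Proof. by move=> sX Xn; rewrite size_cat size_nseq size_setw // subnK. Qed.

Lemma setw_char (w : seq ('I_5 * 'I_5)) : {subset w <= edges5} ->
  setw [seq vlab e \in w | e <- all_edges] =i w.
Proof.
move=> ws e; rewrite /setw -filter_mask; apply/mapP/idP.
  by case=> x; rewrite mem_filter => /andP[xw _] ->.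
move=> ew; have /mapP[x xE ex] := ws e ew.
by exists x; rewrite // mem_filter -ex ew.
Qed.

Lemma setw_uniq X : uniq (setw X).
Proof.
rewrite map_inj_in_uniq ?mask_uniq // => -[a b] [c d] /mem_mask h /mem_mask h' [].
have /allP ok : all is_edge all_edges by [].
have /and3P[/= a5 b5 _] := ok _ h; have /and3P[/= c5 d5 _] := ok _ h'.
by move=> /(congr1 val) /= + /(congr1 val) /=; rewrite !inordK // => -> ->.
Qed.

Lemma count_letters w X : size X = 10%N -> w =i setw X -> (count id X <= size w)%N.
Proof.
move=> sX wX; rewrite -size_setw //; apply: uniq_leq_size (setw_uniq X) _.
by move=> e; rewrite wX.
Qed.

Lemma has_letters w X : size X = 10%N -> w =i setw X -> (0 < size w)%N -> has id X.
Proof.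
move=> sX wX w0; rewrite has_count -size_setw //.
by case: w w0 wX => // x w _ /(_ x); rewrite mem_head; case: (setw X).
Qed.

Lemma weq_canw n w X : (5 <= n)%N -> size w = n -> w =i setw X -> size X = 10%N ->
  weq n w (canw n X).
Proof.
move=> n5 wn wX sX.
have hX : has id X by apply: (has_letters sX wX); rewrite wn (leq_trans _ n5).
have Xn := count_letters sX wX.
rewrite wn in Xn; rewrite -wn; apply: weq_set; rewrite ?wn //.
- by move=> e; rewrite mem_canw.
- by rewrite size_canw.
- by apply/allP => e; rewrite wX => /(allP (setw_edgeb X)).
Qed.

(** The ordered Pluecker relation followed by a word with letter set [m]; by [weq_canw] each of its
    words may be replaced by the canonical word of its letter set. *)
Lemma hit_matchings n q m : q \in quads -> size m = 10%N -> has id m -> (5 <= n)%N ->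
  (count id m + 2 <= n)%N ->
  hit n (\sum_(p <- matchings q) 'X_[mon (canw n (setU2 (set2 p) m))]).
Proof.
move=> qQ sm hm n5 mn.
(* Two places are left for the letters of the matching. *)
pose z := canw (n - 2) m.
have sz : (size z).+2 = n by rewrite size_canw //; lia.
have ez : all edgeb z by apply: canw_edgeb.
have [a [b [c [d [qE uq]]]]] : exists a b c d, q = [:: a; b; c; d] /\
    uniq [:: inord a; inord b; inord c; inord d : 'I_5].
  have [u4 lt5] : uniq q /\ all (fun i => i < 5)%N q.
    by move: qQ; rewrite !inE => /or4P[|||/orP[]] /eqP ->.
  have : size q = 4%N by move: qQ; rewrite !inE => /or4P[|||/orP[]] /eqP ->.
  case: q u4 lt5 {qQ} => [|a [|b [|c [|d [|? ?]]]]] // u4 /allP lt5 _.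
  exists a, b, c, d; split=> //.
  rewrite -[X in uniq X]/(map inord [:: a; b; c; d]) map_inj_in_uniq //.
  by move=> i j /lt5 i5 /lt5 j5 /(congr1 val) /=; rewrite !inordK.
have pE p : p \in matchings q -> (p.1 \in all_edges) && (p.2 \in all_edges).
  move: p; apply/allP.
  by move: qQ; rewrite !inE => /or4P[|||/orP[]] /eqP ->.
have wE p : p \in matchings q ->
    weq n [:: vlab p.1, vlab p.2 & z] (canw n (setU2 (set2 p) m)).
  move=> /pE /andP[p1 p2]; apply: weq_canw => //; last by rewrite size_map size_zip sm.
  move=> e; rewrite /setw; set lhs := (LHS).
  have -> : (e \in [seq vlab i | i <- mask (setU2 (set2 p) m) all_edges]) =
            (e \in [seq vlab i | i <- mask (set2 p) all_edges ++ mask m all_edges]).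
    by apply: eq_mem_map; apply: mask_setU2.
  rewrite map_cat mem_cat /lhs -[e \in map vlab (mask m _)]/(e \in setw m).
  rewrite -(mem_canw (n - 2) sm hm) -/z !inE orbA; congr (_ || _).
  rewrite /set2 -filter_mask; apply/orP/mapP.
    by case=> /eqP ->; [exists p.1|exists p.2]; rewrite // mem_filter eqxx ?orbT.
  by case=> x; rewrite mem_filter => /andP[/orP[] /eqP -> _] ->; [left|right].
have := (hit_plucker uq ez).1; rewrite sz => h.
have hs : hit n (\sum_(p <- matchings q)
   ('X_[mon [:: vlab p.1, vlab p.2 & z]] + 'X_[mon (canw n (setU2 (set2 p) m))])).
  by rewrite big_seq; apply: hit_sum => p /wE.
have := hitD h hs; rewrite big_split /= addrA [X in X + _](_ : _ = 0) ?add0r //.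
by rewrite qE /wsum !big_cons !big_nil addpp.
Qed.

(** Over [F_2] a linear combination is a subset, so the coefficients form a predicate. *)
Definition inspan Bs n w := exists c : pred bitseq,
  hit n ('X_[mon w] + \sum_(X <- Bs | c X) 'X_[mon (canw n X)]).

Lemma sum_addb (Bs : seq bitseq) (c1 c2 : pred bitseq) (F : bitseq -> P5) :
  \sum_(X <- Bs | c1 X) F X + \sum_(X <- Bs | c2 X) F X =
  \sum_(X <- Bs | c1 X (+) c2 X) F X.
Proof.
rewrite big_mkcond [X in _ + X]big_mkcond [RHS]big_mkcond -big_split; apply: eq_bigr => X _ /=.
by case: (c1 X); case: (c2 X); rewrite /= ?addpp ?addr0 ?add0r.
Qed.

Lemma count_setU2 X Y : (count id (setU2 X Y) <= count id X + count id Y)%N.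
Proof.
elim: X Y => [|a X IH] [|b Y] //=.
rewrite -/(setU2 X Y); have := IH Y.
by move: (count _ (setU2 X Y)) (count id X) (count id Y); case: a; case: b; lia.
Qed.

Lemma count_set2 p : (count id (set2 p) <= 2)%N.
Proof.
rewrite count_map; have := count_predUI (pred1 p.1) (pred1 p.2) all_edges.
have ue : uniq all_edges by [].
rewrite !(count_uniq_mem _ ue) => h.
apply: (@leq_trans ((p.1 \in all_edges) + (p.2 \in all_edges))%N).
  by rewrite -h leq_addr.
by do 2 case: (_ \in _).
Qed.

Lemma inspan_weq Bs n u v : weq n u v -> inspan Bs n v -> inspan Bs n u.
Proof.
move=> uv [c hc]; exists c; have := hitD uv hc.
by rewrite addrA -[_ + _ + 'X_[mon v]]addrA addpp addr0.
Qed.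

Lemma inspan_hit Bs n u : hit n 'X_[mon u] -> inspan Bs n u.
Proof. by exists pred0; rewrite big_pred0 // addr0. Qed.

Lemma inspan3 Bs n u v w : hit n ('X_[mon u] + ('X_[mon v] + 'X_[mon w])) ->
  inspan Bs n v -> inspan Bs n w -> inspan Bs n u.
Proof.
move=> h [c1 h1] [c2 h2]; exists (fun X => c1 X (+) c2 X); rewrite -sum_addb.
have E (a b c s t : P5) : a + (b + c) + (b + s + (c + t)) = a + (s + t).
  by rewrite (addrACA b s) (addrA (a + _)) -(addrA a) addpp addr0.
by have := hitD h (hitD h1 h2); rewrite E.
Qed.

Lemma inspan_basis Bs n X : uniq Bs -> X \in Bs -> inspan Bs n (canw n X).
Proof.
move=> uB XB; exists (pred1 X); rewrite big_mkcond (bigD1_seq X) //= eqxx big1.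
  by rewrite addr0 addpp; apply: hit0.
by move=> Y /negbTE ->.
Qed.

(** No word of length [n] carries more than [n] letters. Making larger sets vacuously reducible
    allows one closure certificate to serve all lengths. *)
Definition reducible n (X : bitseq) := size X = 10%N /\
  ((count id X <= n)%N -> inspan positive_basis n (canw n X)).

Lemma size_decode c : size (decode c) = 10%N.
Proof. by []. Qed.

Lemma closure_reducible n (K : trie) l K' : (5 <= n)%N -> (forall X, tmem K X -> reducible n X) ->
  closure K l = Some K' -> forall X, tmem K' X -> reducible n X.
Proof.
move=> n5; elim: l K => [|[[a k] c] l IH] K gK /=; first by case=> <-.
set s := map _ (rot _ _).
case: ifP => // /and4P[a5 hm mn xy]; apply: IH => X; rewrite tmem_add => /predU1P[->|/gK //].
have qQ : nth [::] quads a \in quads by apply: mem_nth.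
have : perm_eq (rot k (matchings (nth [::] quads a))) (matchings (nth [::] quads a)).
  by rewrite perm_rot.
have : size (rot k (matchings (nth [::] quads a))) = 3%N by rewrite size_rot.
move: mn xy; rewrite {}/s; case: (rot k _) => [|p0 [|p1 [|p2 [|? ?]]]] //= mn xy _ pm.
have sE p : size (setU2 (set2 p) (decode c)) = 10%N by rewrite size_map size_zip.
split=> // Xn.
have := hit_matchings qQ (size_decode c) hm n5.
have mn' : (count id (decode c) + 2 <= n)%N.
  by apply: leq_trans mn _; rewrite geq_max n5.
move=> /(_ mn'); rewrite -(perm_big _ pm) !big_cons big_nil /= addr0 => h.
have szle p : (count id (setU2 (set2 p) (decode c)) <= n)%N.
  apply: leq_trans (count_setU2 _ _) _; apply: leq_trans mn'.
  by rewrite addnC leq_add2l count_set2.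
case/orP: xy => [/eqP xy|/andP[xK yK]].
  by apply: inspan_hit; rewrite xy addpp addr0 in h.
by apply: (inspan3 h); [apply: (gK _ xK).2|apply: (gK _ yK).2].
Qed.


(** These are the nonempty sets of edges through a common vertex. They contain no two disjoint
    edges, so the Pluecker relations never reduce them, and all 65 are kept. *)
Definition negative_basis := [seq X <- all_sets | has id X && ~~ covers X].
Definition basis := positive_basis ++ negative_basis.

Lemma basis_ok : [&& uniq basis, size basis == 155%N, size positive_basis == 90%N,
  all (fun X => [&& size X == 10, has id X & count id X <= 5]%N) basis
  & all covers positive_basis].
Proof. by vm_cast_no_check (erefl true). Qed.

Lemma mem_bitseqs k X : size X = k -> X \in bitseqs k.
Proof.
elim: k X => [|k IH] [|b X] //= [sX].
by rewrite mem_cat; case: b; [apply/orP; right|apply/orP; left]; apply/map_f/IH.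
Qed.

Lemma tmem_foldl K l Y : tmem (foldl tadd K l) Y = (Y \in l) || tmem K Y.
Proof.
by elim: l K => [|Z l IH] K //=; rewrite IH tmem_add inE orbA [(Y \in l) || _]orbC.
Qed.

Lemma span_covers n X : (5 <= n)%N -> size X = 10%N -> covers X -> (count id X <= n)%N ->
  inspan positive_basis n (canw n X).
Proof.
move=> n5 sX cX Xn; have := closure_complete.
case E: closure => [K|//] /allP /(_ X (mem_bitseqs sX)) /implyP /(_ cX) XK.
have /and5P[ub _ _ /allP szb _] := basis_ok.
have gK Y : tmem (foldl tadd Empty positive_basis) Y -> reducible n Y.
  rewrite tmem_foldl orbF => Yp.
  have Yb : Y \in basis by rewrite mem_cat Yp.
  have /and3P[/eqP sY _ _] := szb Y Yb.
  split; first exact: sY.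
  move=> _; apply: inspan_basis Yp.
  by move: ub; rewrite cat_uniq => /andP[].
exact: (closure_reducible n5 gK E XK).2 Xn.
Qed.

Lemma inspan_catl P Q n w : uniq (P ++ Q) -> inspan P n w -> inspan (P ++ Q) n w.
Proof.
rewrite cat_uniq => /and3P[_ /hasPn dis _] [c hc].
exists (fun X => (X \in P) && c X); rewrite big_cat /= [X in _ + (_ + X)]big_seq_cond.
rewrite [X in _ + (_ + X)]big_pred0 ?addr0; last first.
  by move=> X; apply/andP => -[/dis /negbTE ->].
rewrite big_seq_cond (eq_bigl (fun X => (X \in P) && c X)) -?big_seq_cond //.
by move=> X; rewrite andbA andbb.
Qed.

Lemma span_word n w : (5 <= n)%N -> size w = n -> {subset w <= edges5} ->
  inspan basis n w /\
  ((forall v : 'I_5, exists2 e, e \in w & (v != e.1) && (v != e.2)) ->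
   inspan positive_basis n w).
Proof.
move=> n5 wn we; pose X : bitseq := [seq vlab e \in w | e <- all_edges].
have sX : size X = 10%N by [].
have wX : w =i setw X by move=> e; rewrite setw_char.
have wc := weq_canw n5 wn wX sX.
have Xn : (count id X <= n)%N by rewrite -wn; apply: count_letters.
have hX : has id X by apply: (has_letters sX wX); rewrite wn (leq_trans _ n5).
have /and5P[ub _ _ _ _] := basis_ok.
have pos : covers X -> inspan positive_basis n w.
  by move=> cX; apply: inspan_weq wc _; exact: (span_covers n5 sX cX Xn).
split.
  have [/pos h|nc] := boolP (covers X); first exact: (inspan_catl ub h).
  apply: inspan_weq wc _; apply: (inspan_basis _ ub).
  by rewrite mem_cat mem_filter nc hX (mem_bitseqs sX) orbT.
move=> cov; apply: pos; apply/allP => v; rewrite mem_iota => /andP[_ v5].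
have [e ew /andP[ve1 ve2]] := cov (inord v).
have /mapP [f fE ef] := we _ ew.
have /allP /(_ _ fE) /and3P[f1 f2 _] : all is_edge all_edges by [].
apply/hasP; exists (true, f) => /=.
  suff : (vlab f \in w, f) \in zip X all_edges by rewrite -ef ew.
  by rewrite /X -[X in zip _ X]map_id zip_map; apply/mapP; exists f.
rewrite ef /vlab /= in ve1 ve2.
by apply/andP; split; [apply: contra ve1|apply: contra ve2] => /eqP ->.
Qed.

(** * Monomials of weight [(3)|^d] as words *)

Lemma half_mon (m : 'X_{1..5}) :
  m = (ind [set j | odd (m j)] + [multinom (m j)./2 | j < 5] *+ 2)%MM.
Proof.
by apply/mnmP => j; rewrite mnmDE mulmnE !mnmE inE muln2 odd_double_half.
Qed.

Lemma set3_edge (A : {set 'I_5}) : #|A| = 3%N -> exists2 e, e \in edges5 & ind A = letter e.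
Proof.
move=> A3; have /cards2P [i [j [ij AE]]] : #|~: A| == 2%N by rewrite cardC5 A3.
have AE' : ind A = letter (i, j) by rewrite /letter /= -AE setCK.
have [lt|ge] := ltnP i j.
  exists (i, j) => //; apply/mapP; exists (i : nat, j : nat).
    by case: i j lt {ij AE AE'} => [[|[|[|[|[|]]]]] ?] // [[|[|[|[|[|]]]]] ?].
  by rewrite /vlab /= !inord_val.
exists (j, i); last by rewrite letterC.
have {ge} lt : (j < i)%N by rewrite ltn_neqAle ge andbT eq_sym.
apply/mapP; exists (j : nat, i : nat).
  by case: i j lt {ij AE AE'} => [[|[|[|[|[|]]]]] ?] // [[|[|[|[|[|]]]]] ?].
by rewrite /vlab /= !inord_val.
Qed.

(** The lowest binary digits form a 3-subset, hence a letter; the halved exponents have the weight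
    vector with its first entry removed. *)
Lemma weight_word d (m : 'X_{1..5}) : (forall i, omega m i = wv (three_d d) i) ->
  exists w, [/\ {subset w <= edges5}, size w = d & mon w = m].
Proof.
elim: d m => [|d IH] m om.
  exists [::]; split=> //; apply/mnmP => j; rewrite mnm0E.
  apply/esym/eqP; apply/negPn/negP; rewrite -lt0n => mj.
  (* A positive exponent would have its leading digit 1 at this place, where the weight is 0. *)
  have := om (trunc_log 2 (m j)); rewrite /wv nth_nil /omega => /eqP.
  rewrite sum_nat_eq0 => /forallP /(_ j) /=.
  have /andP[lo hi] := trunc_log_bounds (isT : 1 < 2)%N mj.
  suff -> : (m j %/ 2 ^ trunc_log 2 (m j) = 1)%N by [].
  by apply/eqP; rewrite eqn_leq -ltnS ltn_divLR ?expn_gt0 // -expnS hi leq_divRL ?expn_gt0 // mul1n lo.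
set A := [set j | odd (m j)]; set m' := [multinom (m j)./2 | j < 5].
have mE : m = (ind A + m' *+ 2)%MM by apply: half_mon.
have A3 : #|A| = 3%N.
  have := om 0%N; rewrite mE omega_add0 (mdeg_squarefree (@ind_squarefree _ A)).
  by rewrite mdeg_ind.
have [e eE eA] := set3_edge A3.
have [i|w [wE sw wm]] := IH m'; first by rewrite -(omegaS _ _ (@ind_squarefree _ A)) -mE om.
exists (e :: w); split=> /=; [|by rewrite sw|by rewrite wm -eA -mE].
by move=> x; rewrite inE => /predU1P[->|/wE].
Qed.

Lemma edge_posmon w (v : 'I_5) : (0 < mon w v)%N ->
  exists2 e, e \in w & (v != e.1) && (v != e.2).
Proof.
elim: w => [|e w IH] /=; first by rewrite mnm0E.
rewrite mnmDE mulmnE mnmE !inE negb_or.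
case: (boolP (_ && _)) => [ve _|_ /=]; first by exists e; rewrite ?mem_head.
rewrite add0n muln_gt0 andbT => /IH [f fw vf].
by exists f; rewrite // inE fw orbT.
Qed.

Lemma omega_mon w i : all edgeb w -> omega (mon w) i = wv (three_d (size w)) i.
Proof.
elim: w i => [|e w IH] i /=.
  by move=> _; rewrite /wv nth_nil /omega big1 // => j _; rewrite mnm0E div0n.
case/andP=> he hw; case: i => [|i].
  by rewrite omega_add0 (mdeg_squarefree (@letter_squarefree e)) mdeg_letter.
by rewrite omegaS ?IH //; apply: letter_squarefree.
Qed.

Lemma posmon_mon w : (forall v : 'I_5, exists2 e, e \in w & (v != e.1) && (v != e.2)) ->
  posmon (mon w).
Proof.
move=> cov; apply/forallP => v; have [e] := cov v.
elim: w {cov} => [|f w IH] //=; rewrite inE => /predU1P[->|ew] ve.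
  by rewrite mnmDE mnmE !inE negb_or ve.
by rewrite mnmDE mulmnE addn_gt0 muln_gt0 IH ?orbT.
Qed.


(** * Functionals attached to subspaces *)

(** The last binary digit in Lucas' theorem modulo 2. *)
Lemma odd_bin_double n k : odd 'C(n.*2, k.*2.+1) = false /\ odd 'C(n.*2, k.*2) = odd 'C(n, k).
Proof.
elim: n k => [|n IH] k; first by case: k.
have odd_succ j : odd 'C(n.*2.+1, j.+1.*2) = odd 'C(n.*2, j.+1.*2).
  by rewrite {1}doubleS binS oddD (IH j).1 addbF -doubleS.
split.
  rewrite doubleS binS oddD binS oddD (IH k).1 addFb.
  by case: k => [|k]; rewrite ?bin0 // odd_succ addbb.
case: k => [|k]; first by rewrite !bin0.
rewrite doubleS {1}doubleS binS oddD -doubleS odd_succ (IH k.+1).2.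
by rewrite binS oddD (IH k).1 (IH k).2 binS oddD.
Qed.

Lemma mersenneS d : ((2 ^ d.+1).-1 = ((2 ^ d).-1).*2.+1)%N.
Proof. by have := expn_gt0 2 d; rewrite expnS mul2n; case: (2 ^ d)%N. Qed.

(** All digits of [2^d - 1] are 1, so [a] and [t] have complementary digits. Some digit is 1 in [t]
    and 0 in [a], and by Lucas' theorem the coefficient is even. This is what makes the monomial
    [top d] a spike. *)
Lemma odd_bin_mersenne d a t : (a + t = (2 ^ d).-1)%N -> (0 < t)%N -> ~~ odd 'C(a, t).
Proof.
elim: d a t => [|d IH] a t at_ t0.
  by move: at_ t0; rewrite expn0 /= => /eqP; rewrite addn_eq0 => /andP[_ /eqP ->].
rewrite mersenneS in at_.
have [aE|aO] := boolP (odd a); last first.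
  have tO : odd t by move: at_ => /(congr1 odd); rewrite oddD (negbTE aO) /= odd_double.
  rewrite -(odd_double_half a) (negbTE aO) add0n -(odd_double_half t) tO add1n.
  by rewrite (odd_bin_double _ _).1.
have tE : odd t = false by move: at_ => /(congr1 odd); rewrite oddD aE /= odd_double; case: odd.
have := odd_double_half a; have := odd_double_half t; rewrite aE tE add0n add1n.
move: a./2 t./2 => b c tc ab; rewrite -tc -ab in at_ t0 *.
case: c {tc} at_ t0 => // c at_ _.
rewrite doubleS binS -doubleS oddD (odd_bin_double b c.+1).2.
rewrite (odd_bin_double b c).1 addbF; apply: IH => //.
by apply: double_inj; move: at_; rewrite addSn => -[<-]; rewrite doubleD.
Qed.

Definition top d : 'X_{1..3} := [multinom (2 ^ d).-1 | i < 3].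
Definition ones3 : 'X_{1..3} := [multinom 1%N | i < 3].

Lemma SqX_top d k (a : 'X_{1..3}) : (0 < k)%N -> (SqX k a)@_(top d) = 0.
Proof.
move=> k0; rewrite raddf_sum big1 //= => t /eqP tk.
rewrite mcoeffZ mcoeffX; case: eqP => [/mnmP at_|_]; last by rewrite mulr0.
have [j tj] : exists j, (0 < t j)%N.
  apply/existsP; apply: contraLR k0 => /existsPn t0.
  by rewrite -tk big1 // => j _; apply/eqP; rewrite -leqn0 leqNgt t0.
have := at_ j; rewrite mnmDE !mnmE => /odd_bin_mersenne /(_ tj) ev.
rewrite mulr1 (bigD1 j) //= natrM -(odd_double_half 'C(a j, t j)) (negbTE ev) add0n.
by rewrite -mul2n natrM (_ : 2%:R = 0 :> 'F_2) ?mul0r //; apply/val_inj.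
Qed.

(** All exponents of [top d.+1] are odd, so a contributing monomial of [p] has three odd exponents;
    in degree at most 3 only [ones3] does. Halving what is left gives [top d]. *)
Lemma coef_top (p q : {mpoly 'F_2[3]}) d :
  supported (fun m => (mdeg m <= 3)%N) p ->
  (p * q ^+ 2)@_(top d.+1) = p@_ones3 * q@_(top d).
Proof.
move=> p3; rewrite {1}[p]mpolyE mpoly_sqr mulr_suml raddf_sum /=.
have key a b : (mdeg a <= 3)%N ->
    ((a + b *+ 2)%MM == top d.+1) = (a == ones3) && (b == top d).
  move=> a3; apply/eqP/andP => [/mnmP ab|[/eqP -> /eqP ->]].
    have ai i : odd (a i).
      have := ab i; rewrite mnmDE mulmnE mnmE mersenneS => /(congr1 odd).
      by rewrite oddD oddM andbF addbF /= odd_double.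
    have a1 : a = ones3.
      have : (\sum_(i < 3) (a i).-1 == 0)%N.
        have e3 : mdeg a = (3 + \sum_(i < 3) (a i).-1)%N.
          rewrite mdegE (eq_bigr (fun i => 1 + (a i).-1)%N) => [|i _].
            by rewrite big_split /= sum1_card card_ord.
          by rewrite add1n prednK // odd_gt0.
        by move: a3; rewrite e3 -[X in (_ <= X)%N]addn0 leq_add2l leqn0.
      rewrite sum_nat_eq0 => /forallP a0; apply/mnmP => i; rewrite mnmE.
      by have := ai i; have := a0 i; case: (a i) => [|[]].
    split; first exact/eqP.
    apply/eqP/mnmP => i; have := ab i; rewrite mnmDE mulmnE a1 !mnmE mersenneS.
    by rewrite muln2 add1n => -[] /double_inj.
  by apply/mnmP => i; rewrite mnmDE mulmnE !mnmE mersenneS muln2.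
have coefE a : a \in msupp p ->
    (p@_a *: 'X_[a] * (\sum_(b <- msupp q) q@_b *: 'X_[b *+ 2]))@_(top d.+1) =
    (p@_a * (a == ones3)%:R) * q@_(top d).
  move=> /p3 a3; rewrite -scalerAl mcoeffZ -mulrA; congr (_ * _).
  rewrite mulr_sumr raddf_sum /= [in RHS](mpolyE q) raddf_sum mulr_sumr /=.
  apply: eq_bigr => b _.
  rewrite -scalerAr -mpolyXD !mcoeffZ !mcoeffX key // mulrCA; congr (_ * _).
  by rewrite -natrM mulnb.
rewrite big_seq (eq_bigr _ coefE) -big_seq -mulr_suml; congr (_ * _).
rewrite [in RHS](mpolyE p) raddf_sum /=; apply: eq_bigr => a _.
by rewrite mcoeffZ mcoeffX.
Qed.

Section Functional.
Variable l : 'I_5 -> {mpoly 'F_2[3]}.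
Hypothesis lin : forall j, exists c : 'I_3 -> 'F_2, l j = \sum_i c i *: 'X_i.

Definition phi d (p : P5) : 'F_2 := (mmap (@mpolyC 3 'F_2) l p)@_(top d).

Lemma phi0 d : phi d 0 = 0.
Proof. by rewrite /phi raddf0 mcoeff0. Qed.

Lemma phiD d p q : phi d (p + q) = phi d p + phi d q.
Proof. by rewrite /phi raddfD mcoeffD. Qed.

Lemma phiZ d c p : phi d (c *: p) = c * phi d p.
Proof. by rewrite /phi mmapZ mcoeffCM. Qed.

Lemma phi_sum d (I : Type) (r : seq I) (P : pred I) (F : I -> P5) :
  phi d (\sum_(i <- r | P i) F i) = \sum_(i <- r | P i) phi d (F i).
Proof. by apply: (big_morph (phi d)); [apply: phiD|apply: phi0]. Qed.

Lemma mmap1_deg (m : 'X_{1..5}) : supported (fun a => mdeg a = mdeg m) (mmap1 l m).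
Proof.
have lin1 j : supported (fun a => mdeg a = 1%N) (l j).
  have [c ->] := lin j; apply: supported_sum => i _.
  by apply: supportedZ; apply: supportedX; rewrite mdeg1.
have powk j k : supported (fun a => mdeg a = k) (l j ^+ k).
  elim: k => [|k IH].
    by rewrite expr0 -mpolyX0; apply: supportedX; rewrite mdeg0.
  rewrite exprS; apply: (supportedM (lin1 j) IH) => a b a1 b1.
  by rewrite mdegD a1 b1.
rewrite mdegE /mmap1; elim/big_rec2: _ => [|j k p _ IH].
  by rewrite -mpolyX0; apply: supportedX; rewrite mdeg0.
by apply: (supportedM (powk j _) IH) => a b a1 b1; rewrite mdegD a1 b1.
Qed.

Lemma mmap1_double (e m : 'X_{1..5}) : mmap1 l (e + m *+ 2) = mmap1 l e * mmap1 l m ^+ 2.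
Proof.
rewrite -prodrXl -big_split; apply: eq_bigr => j _ /=.
by rewrite mnmDE mulmnE exprD exprM.
Qed.

(** For a letter [e] this is the coefficient of [y_0 y_1 y_2] in a product of three linear forms: a
    permanent, which modulo 2 is the determinant, thus a Pluecker coordinate. *)
Definition minor (e : 'X_{1..5}) : 'F_2 := (mmap1 l e)@_ones3.

Lemma phi_next d (e m : 'X_{1..5}) : (mdeg e <= 3)%N ->
  phi d.+1 'X_[e + m *+ 2] = minor e * phi d 'X_[m].
Proof.
move=> e3; rewrite /phi !mmapX mmap1_double coef_top //.
by move=> a /mmap1_deg ->.
Qed.

Lemma minor_small e : (mdeg e < 3)%N -> minor e = 0.
Proof.
move=> e3; apply/eqP; rewrite mcoeff_eq0; apply/negP => /mmap1_deg.
rewrite mdegE; under eq_bigr do rewrite mnmE.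
by rewrite sum_nat_const card_ord => E; rewrite -E in e3.
Qed.

(** [phi_next] strips the full letters before the first deficient digit; that digit has fewer than
    three variables, so its [minor] vanishes for degree reasons. *)
Lemma phi_low d m : wlt (omega m) (wv (three_d d)) -> phi d 'X_[m] = 0.
Proof.
case=> k; elim: k d m => [|k IH] [|d] m [eqk ltk]; rewrite /wv ?nth_nil // in ltk.
- set A := [set j | odd (m j)]; rewrite (half_mon m) -/A in ltk *.
  rewrite omega_add0 (mdeg_squarefree (@ind_squarefree _ A)) /= in ltk.
  by rewrite phi_next ?minor_small ?mul0r // ltnW.
set A := [set j | odd (m j)]; set m' := [multinom (m j)./2 | j < 5].
have mE : m = (ind A + m' *+ 2)%MM by apply: half_mon.
have A3 : mdeg (ind A) = 3%N.
  by have := eqk 0%N isT; rewrite mE omega_add0 (mdeg_squarefree (@ind_squarefree _ A)).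
rewrite mE phi_next ?A3 // IH ?mulr0 //; split.
  by move=> i ik; have := eqk i.+1 ik; rewrite mE omegaS //; apply: ind_squarefree.
by move: ltk; rewrite mE omegaS //; apply: ind_squarefree.
Qed.

Lemma phi_Sq d k m : (0 < k)%N -> phi d (Sq_mon k m) = 0.
Proof.
move=> k0.
(* The total square in three variables, as a ring morphism into polynomials in the grading
   variable. *)
pose T : {mpoly 'F_2[3]} -> {poly {mpoly 'F_2[3]}} :=
  mmap (polyC \o @mpolyC 3 'F_2) (fun i => ('X_i)%:P + ('X_i ^+ 2)%:P * 'X).
(* A linear form behaves like a variable because squaring is additive and fixes the coefficients in
   [F_2]. Hence [T] commutes with the substitution. *)
have Tl j : T (l j) = (l j)%:P + (l j ^+ 2)%:P * 'X.
  have [c ->] := lin j.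
  rewrite /T [LHS]raddf_sum /= -(pFrobenius_autE (pchar_mpolyF2 3)).
  rewrite !rmorph_sum /= mulr_suml -big_split /=.
  apply: eq_bigr => i _; rewrite /T mmapZ mmapX mmap1U /= mulrDr mulrA.
  by rewrite pFrobenius_autE exprZn F2_sqr -!mul_mpolyC !polyCM.
have -> : phi d (Sq_mon k m) = ((T (mmap1 l m))`_k)@_(top d).
  rewrite /phi; congr (_@_ _).
  rewrite [Sq_mon k m](_ : _ = SqX k m) // -coef_totSq.
  rewrite -(coef_map (mmap (@mpolyC 3 'F_2) l)).
  suff -> : map_poly (mmap (@mpolyC 3 'F_2) l) (totSq m) = T (mmap1 l m) by [].
  rewrite /totSq /T /mmap1 [LHS]rmorph_prod [RHS]rmorph_prod; apply: eq_bigr => j _.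
  rewrite [LHS]rmorphXn [RHS]rmorphXn /= -/(T (l j)) Tl; congr (_ ^+ _).
  by rewrite rmorphD rmorphM /= !map_polyC /= map_polyX rmorphXn /= mmapX mmap1U.
(* Monomial by monomial, what remains is the coefficient of the spike in a positive square, zero by
   [SqX_top]. *)
rewrite {1}[mmap1 l m]mpolyE /T raddf_sum coef_sum raddf_sum big1 //= => a _.
rewrite mmapZ mmapX /= coefCM mcoeffCM.
by rewrite -/(totSq a) coef_totSq SqX_top // mulr0.
Qed.

Lemma phi_Aplus d h : AplusP h -> phi d h = 0.
Proof.
case=> s [/allP s0 ->]; rewrite phi_sum big_seq big1 // => x /s0 x0.
by rewrite /Sq phi_sum big1 // => m _; rewrite phiZ phi_Sq // mulr0.
Qed.

Lemma phi_minus d q : inPminus (three_d d) q -> phi d q = 0.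
Proof.
move=> hq; rewrite [q]mpolyE phi_sum big_seq big1 // => m /hq [_ lt].
by rewrite phiZ phi_low // mulr0.
Qed.

Lemma phi_equiv d f : equivw (three_d d) f 0 -> phi d f = 0.
Proof.
case=> h [q [hh [hq]]]; rewrite addr0 => ->.
by rewrite phiD phi_Aplus // phi_minus // addr0.
Qed.

Lemma phi_mon w : all edgeb w -> phi (size w) 'X_[mon w] = \prod_(e <- w) minor (letter e).
Proof.
elim: w => [|e w IH] /=.
  move=> _; rewrite big_nil /phi mmapX mmap11 mcoeff1.
  by rewrite (_ : 0%MM == top 0) //; apply/eqP/mnmP => i; rewrite mnm0E mnmE.
by case/andP=> he hw; rewrite big_cons -IH // phi_next ?mdeg_letter.
Qed.
End Functional.

(** * The values of the 155 functionals on the 155 sets *)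

Local Open Scope nat_scope.

(* One 3 x 5 matrix for each 3-dimensional row space; the columns are 3-bit numbers. *)
Definition plane_codes : seq (seq nat) :=
 [:: [:: 0; 0; 1; 2; 4]; [:: 0; 1; 0; 2; 4]; [:: 0; 1; 1; 2; 4]; [:: 0; 1; 2; 0; 4];
   [:: 0; 1; 2; 1; 4]; [:: 0; 1; 2; 2; 4]; [:: 0; 1; 2; 3; 4]; [:: 0; 1; 2; 4; 0];
   [:: 0; 1; 2; 4; 1]; [:: 0; 1; 2; 4; 2]; [:: 0; 1; 2; 4; 3]; [:: 0; 1; 2; 4; 4];
   [:: 0; 1; 2; 4; 5]; [:: 0; 1; 2; 4; 6]; [:: 0; 1; 2; 4; 7]; [:: 1; 0; 0; 2; 4];
   [:: 1; 0; 1; 2; 4]; [:: 1; 1; 0; 2; 4]; [:: 1; 1; 1; 2; 4]; [:: 1; 0; 2; 0; 4];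
   [:: 1; 0; 2; 1; 4]; [:: 1; 1; 2; 0; 4]; [:: 1; 1; 2; 1; 4]; [:: 1; 0; 2; 2; 4];
   [:: 1; 0; 2; 3; 4]; [:: 1; 1; 2; 2; 4]; [:: 1; 1; 2; 3; 4]; [:: 1; 0; 2; 4; 0];
   [:: 1; 0; 2; 4; 1]; [:: 1; 1; 2; 4; 0]; [:: 1; 1; 2; 4; 1]; [:: 1; 0; 2; 4; 2];
   [:: 1; 0; 2; 4; 3]; [:: 1; 1; 2; 4; 2]; [:: 1; 1; 2; 4; 3]; [:: 1; 0; 2; 4; 4];
   [:: 1; 0; 2; 4; 5]; [:: 1; 1; 2; 4; 4]; [:: 1; 1; 2; 4; 5]; [:: 1; 0; 2; 4; 6];
   [:: 1; 0; 2; 4; 7]; [:: 1; 1; 2; 4; 6]; [:: 1; 1; 2; 4; 7]; [:: 1; 2; 0; 0; 4];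
   [:: 1; 2; 0; 1; 4]; [:: 1; 2; 1; 0; 4]; [:: 1; 2; 1; 1; 4]; [:: 1; 2; 0; 2; 4];
   [:: 1; 2; 0; 3; 4]; [:: 1; 2; 1; 2; 4]; [:: 1; 2; 1; 3; 4]; [:: 1; 2; 2; 0; 4];
   [:: 1; 2; 2; 1; 4]; [:: 1; 2; 3; 0; 4]; [:: 1; 2; 3; 1; 4]; [:: 1; 2; 2; 2; 4];
   [:: 1; 2; 2; 3; 4]; [:: 1; 2; 3; 2; 4]; [:: 1; 2; 3; 3; 4]; [:: 1; 2; 0; 4; 0];
   [:: 1; 2; 0; 4; 1]; [:: 1; 2; 1; 4; 0]; [:: 1; 2; 1; 4; 1]; [:: 1; 2; 0; 4; 2];
   [:: 1; 2; 0; 4; 3]; [:: 1; 2; 1; 4; 2]; [:: 1; 2; 1; 4; 3]; [:: 1; 2; 2; 4; 0];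
   [:: 1; 2; 2; 4; 1]; [:: 1; 2; 3; 4; 0]; [:: 1; 2; 3; 4; 1]; [:: 1; 2; 2; 4; 2];
   [:: 1; 2; 2; 4; 3]; [:: 1; 2; 3; 4; 2]; [:: 1; 2; 3; 4; 3]; [:: 1; 2; 0; 4; 4];
   [:: 1; 2; 0; 4; 5]; [:: 1; 2; 1; 4; 4]; [:: 1; 2; 1; 4; 5]; [:: 1; 2; 0; 4; 6];
   [:: 1; 2; 0; 4; 7]; [:: 1; 2; 1; 4; 6]; [:: 1; 2; 1; 4; 7]; [:: 1; 2; 2; 4; 4];
   [:: 1; 2; 2; 4; 5]; [:: 1; 2; 3; 4; 4]; [:: 1; 2; 3; 4; 5]; [:: 1; 2; 2; 4; 6];
   [:: 1; 2; 2; 4; 7]; [:: 1; 2; 3; 4; 6]; [:: 1; 2; 3; 4; 7]; [:: 1; 2; 4; 0; 0];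
   [:: 1; 2; 4; 0; 1]; [:: 1; 2; 4; 1; 0]; [:: 1; 2; 4; 1; 1]; [:: 1; 2; 4; 0; 2];
   [:: 1; 2; 4; 0; 3]; [:: 1; 2; 4; 1; 2]; [:: 1; 2; 4; 1; 3]; [:: 1; 2; 4; 2; 0];
   [:: 1; 2; 4; 2; 1]; [:: 1; 2; 4; 3; 0]; [:: 1; 2; 4; 3; 1]; [:: 1; 2; 4; 2; 2];
   [:: 1; 2; 4; 2; 3]; [:: 1; 2; 4; 3; 2]; [:: 1; 2; 4; 3; 3]; [:: 1; 2; 4; 0; 4];
   [:: 1; 2; 4; 0; 5]; [:: 1; 2; 4; 1; 4]; [:: 1; 2; 4; 1; 5]; [:: 1; 2; 4; 0; 6];
   [:: 1; 2; 4; 0; 7]; [:: 1; 2; 4; 1; 6]; [:: 1; 2; 4; 1; 7]; [:: 1; 2; 4; 2; 4];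
   [:: 1; 2; 4; 2; 5]; [:: 1; 2; 4; 3; 4]; [:: 1; 2; 4; 3; 5]; [:: 1; 2; 4; 2; 6];
   [:: 1; 2; 4; 2; 7]; [:: 1; 2; 4; 3; 6]; [:: 1; 2; 4; 3; 7]; [:: 1; 2; 4; 4; 0];
   [:: 1; 2; 4; 4; 1]; [:: 1; 2; 4; 5; 0]; [:: 1; 2; 4; 5; 1]; [:: 1; 2; 4; 4; 2];
   [:: 1; 2; 4; 4; 3]; [:: 1; 2; 4; 5; 2]; [:: 1; 2; 4; 5; 3]; [:: 1; 2; 4; 6; 0];
   [:: 1; 2; 4; 6; 1]; [:: 1; 2; 4; 7; 0]; [:: 1; 2; 4; 7; 1]; [:: 1; 2; 4; 6; 2];
   [:: 1; 2; 4; 6; 3]; [:: 1; 2; 4; 7; 2]; [:: 1; 2; 4; 7; 3]; [:: 1; 2; 4; 4; 4];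
   [:: 1; 2; 4; 4; 5]; [:: 1; 2; 4; 5; 4]; [:: 1; 2; 4; 5; 5]; [:: 1; 2; 4; 4; 6];
   [:: 1; 2; 4; 4; 7]; [:: 1; 2; 4; 5; 6]; [:: 1; 2; 4; 5; 7]; [:: 1; 2; 4; 6; 4];
   [:: 1; 2; 4; 6; 5]; [:: 1; 2; 4; 7; 4]; [:: 1; 2; 4; 7; 5]; [:: 1; 2; 4; 6; 6];
   [:: 1; 2; 4; 6; 7]; [:: 1; 2; 4; 7; 6]; [:: 1; 2; 4; 7; 7]].

(* The [i]-th list gives the elements of [basis] whose values sum to the indicator of the
   [i]-th subspace. *)
Definition inverse_rows : seq (seq nat) :=
 [:: [:: 0; 5; 6; 7; 12; 15; 16; 17; 18; 20; 23; 25; 26; 28; 31; 33; 34; 40; 41; 42; 45; 47; 49;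
   51; 52; 62; 64; 65; 66; 67; 69; 71; 82; 85; 140; 141; 142; 143; 144; 145; 146; 147; 148; 149;
   150; 151; 152; 153; 154]; [:: 0; 1; 5; 7; 9; 10; 16; 17; 19; 20; 21; 23; 25; 26; 34; 36; 38;
   39; 41; 42; 43; 46; 47; 49; 51; 52; 55; 57; 58; 61; 73; 82; 84; 87; 88; 129; 130; 131; 132;
   133; 134; 135; 136; 137; 138; 139; 151; 152; 153; 154]; [:: 0; 2; 3; 5; 7; 8; 10; 16; 17; 19;
   20; 23; 25; 28; 29; 31; 34; 39; 40; 41; 42; 43; 46; 47; 51; 52; 58; 60; 63; 65; 82; 151; 152;
   153; 154]; [:: 1; 2; 5; 6; 9; 11; 14; 17; 18; 20; 21; 23; 24; 25; 26; 28; 31; 33; 34; 37; 38;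
   39; 43; 49; 51; 56; 63; 64; 67; 69; 71; 73; 76; 80; 81; 82; 87; 88; 120; 121; 122; 123; 124;
   125; 126; 127; 128; 138; 139; 149; 150; 153; 154]; [:: 5; 6; 8; 15; 17; 18; 20; 23; 24; 25; 26;
   31; 32; 33; 34; 39; 46; 51; 54; 58; 59; 62; 63; 64; 65; 69; 71; 82; 149; 150; 153; 154]; [:: 1;
   5; 8; 17; 20; 21; 23; 24; 25; 26; 28; 31; 33; 34; 38; 43; 50; 51; 57; 61; 63; 67; 69; 73; 80;
   82; 87; 88; 138; 139; 153; 154]; [:: 2; 5; 9; 17; 20; 23; 24; 25; 29; 33; 34; 43; 49; 50; 51;
   65; 67; 69; 82; 153; 154]; [:: 4; 5; 10; 11; 12; 14; 17; 22; 33; 35; 36; 39; 40; 43; 44; 45;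
   47; 51; 55; 56; 60; 61; 62; 63; 64; 65; 66; 69; 72; 75; 76; 81; 82; 84; 85; 87; 88; 112; 113;
   114; 115; 116; 117; 118; 119; 128; 137; 139; 148; 150; 152; 154]; [:: 3; 4; 5; 9; 10; 12; 15;
   17; 26; 33; 39; 45; 47; 49; 51; 54; 59; 61; 64; 66; 69; 72; 82; 85; 148; 150; 152; 154]; [:: 3;
   4; 5; 9; 17; 19; 22; 31; 32; 35; 36; 37; 40; 43; 44; 47; 49; 51; 55; 59; 63; 65; 75; 82; 84;
   87; 88; 137; 139; 152; 154]; [:: 4; 5; 17; 19; 29; 43; 46; 47; 51; 57; 58; 59; 60; 61; 63; 67;
   82; 152; 154]; [:: 5; 11; 14; 17; 22; 33; 35; 39; 44; 46; 51; 54; 56; 59; 61; 62; 64; 65; 67;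
   69; 72; 75; 76; 80; 81; 82; 87; 88; 128; 139; 150; 154]; [:: 5; 9; 15; 17; 26; 33; 39; 43; 46;
   49; 51; 61; 63; 64; 67; 69; 72; 82; 150; 154]; [:: 5; 17; 22; 33; 35; 37; 44; 46; 49; 50; 51;
   59; 65; 67; 69; 75; 80; 82; 87; 88; 139; 154]; [:: 5; 9; 17; 29; 31; 32; 33; 50; 51; 57; 58;
   59; 61; 69; 82; 154]; [:: 0; 1; 3; 5; 7; 9; 10; 13; 16; 17; 18; 23; 24; 25; 26; 27; 28; 31; 33;
   34; 41; 44; 45; 47; 48; 49; 51; 52; 53; 59; 60; 61; 63; 65; 68; 69; 79; 83; 84; 85; 88; 105;
   106; 107; 108; 109; 110; 111; 133; 134; 135; 136; 144; 145; 146; 147]; [:: 0; 2; 5; 7; 8; 10;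
   13; 16; 17; 18; 23; 24; 25; 29; 33; 34; 40; 41; 44; 45; 47; 51; 52; 57; 59; 69; 85; 144; 145;
   146; 147]; [:: 0; 1; 2; 5; 7; 8; 9; 13; 16; 17; 19; 23; 24; 25; 28; 29; 31; 34; 39; 41; 43; 44;
   46; 47; 51; 52; 58; 59; 61; 65; 67; 84; 88; 133; 134; 135; 136]; [:: 0; 3; 5; 7; 13; 16; 17;
   19; 23; 24; 25; 26; 34; 39; 40; 41; 43; 44; 46; 47; 49; 51; 52; 57; 58; 59; 60; 63; 67]; [:: 1;
   6; 7; 14; 15; 17; 18; 20; 25; 27; 28; 29; 30; 33; 34; 39; 42; 46; 49; 51; 52; 53; 54; 58; 60;
   61; 63; 64; 65; 66; 67; 68; 69; 70; 71; 76; 79; 83; 85; 88; 89; 100; 101; 102; 103; 104; 110;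
   111; 124; 125; 126; 127; 142; 143; 146; 147]; [:: 2; 6; 7; 8; 9; 11; 17; 18; 20; 25; 29; 32;
   33; 34; 39; 42; 43; 51; 52; 59; 60; 61; 62; 63; 64; 66; 69; 71; 85; 142; 143; 146; 147]; [:: 1;
   6; 8; 14; 15; 17; 18; 20; 24; 25; 29; 32; 33; 34; 51; 59; 60; 61; 64; 65; 69; 71; 76; 88; 124;
   125; 126; 127]; [:: 2; 6; 9; 11; 17; 18; 20; 24; 25; 28; 29; 33; 34; 43; 46; 49; 51; 54; 58;
   60; 61; 62; 64; 67; 69; 71]; [:: 1; 2; 7; 8; 17; 18; 24; 25; 26; 27; 31; 33; 34; 39; 44; 51;
   52; 53; 57; 58; 59; 60; 61; 63; 65; 68; 69; 78; 79; 83; 85; 88; 89; 110; 111; 146; 147]; [:: 7;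
   9; 17; 18; 24; 25; 28; 29; 33; 34; 39; 44; 49; 51; 52; 58; 59; 60; 69; 85; 146; 147]; [:: 1; 2;
   9; 17; 24; 25; 29; 32; 33; 34; 43; 44; 46; 49; 50; 51; 60; 61; 65; 67; 69; 88]; [:: 8; 17; 24;
   25; 26; 28; 31; 32; 33; 34; 43; 44; 46; 50; 51; 57; 60; 63; 67; 69]; [:: 3; 11; 12; 14; 16; 17;
   18; 29; 30; 33; 34; 39; 40; 42; 45; 46; 47; 48; 49; 51; 52; 53; 54; 57; 59; 60; 61; 62; 66; 68;
   69; 70; 71; 74; 75; 76; 79; 82; 84; 85; 88; 89; 96; 97; 98; 99; 104; 109; 111; 116; 117; 118;
   119; 141; 143; 145; 147]; [:: 9; 12; 15; 16; 17; 18; 26; 29; 33; 34; 39; 42; 43; 44; 45; 46;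
   47; 51; 52; 57; 61; 63; 65; 66; 69; 71; 82; 85; 141; 143; 145; 147]; [:: 4; 9; 10; 11; 12; 14;
   17; 29; 31; 33; 41; 45; 46; 47; 49; 51; 57; 60; 65; 66; 67; 69; 72; 75; 76; 82; 84; 85; 88;
   116; 117; 118; 119]; [:: 3; 4; 10; 12; 15; 17; 26; 29; 31; 33; 40; 41; 43; 44; 45; 46; 47; 51;
   54; 57; 59; 62; 63; 66; 67; 69; 72; 82; 85]; [:: 3; 10; 13; 16; 17; 18; 29; 32; 33; 34; 39; 40;
   43; 44; 45; 47; 48; 51; 52; 53; 57; 58; 59; 60; 68; 69; 74; 75; 78; 79; 84; 85; 88; 89; 109;
   111; 145; 147]; [:: 9; 10; 13; 16; 17; 18; 31; 33; 34; 39; 43; 45; 46; 47; 49; 51; 52; 59; 61;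
   65; 67; 69; 85; 145; 147]; [:: 4; 13; 17; 19; 29; 41; 43; 44; 46; 47; 51; 57; 58; 59; 61; 65;
   67; 75; 84; 88]; [:: 3; 4; 9; 13; 17; 19; 31; 32; 40; 41; 43; 47; 49; 51; 59; 60]; [:: 14; 15;
   17; 18; 26; 30; 31; 33; 34; 39; 42; 46; 49; 51; 52; 53; 54; 57; 58; 59; 60; 62; 63; 65; 66; 67;
   68; 69; 70; 71; 74; 75; 76; 78; 79; 85; 88; 104; 111; 143; 147]; [:: 9; 11; 17; 18; 31; 33; 34;
   39; 42; 43; 44; 46; 51; 52; 57; 58; 60; 66; 67; 69; 71; 85; 143; 147]; [:: 9; 14; 15; 17; 26;
   33; 43; 49; 51; 58; 60; 61; 63; 69; 72; 75; 76; 88]; [:: 11; 17; 33; 44; 51; 54; 58; 59; 60;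
   61; 62; 65; 69; 72]; [:: 17; 18; 29; 33; 34; 39; 44; 51; 52; 53; 58; 60; 68; 69; 74; 75; 79;
   85; 88; 111; 147]; [:: 9; 17; 18; 31; 32; 33; 34; 39; 46; 49; 51; 52; 57; 60; 61; 65; 67; 69;
   85; 147]; [:: 9; 17; 29; 31; 33; 44; 46; 50; 51; 57; 58; 59; 60; 61; 65; 67; 69; 75; 88];
   [:: 17; 32; 33; 49; 50; 51; 59; 60; 69]; [:: 5; 7; 8; 9; 18; 19; 20; 21; 23; 25; 27; 29; 30;
   34; 35; 38; 42; 44; 46; 49; 51; 52; 53; 55; 58; 59; 61; 63; 65; 67; 69; 73; 76; 79; 81; 84; 86;
   87; 88; 89; 93; 94; 95; 102; 103; 107; 108; 122; 123; 126; 127; 131; 132; 135; 136]; [:: 2; 5;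
   7; 19; 20; 21; 23; 25; 29; 34; 35; 37; 38; 39; 42; 44; 46; 50; 51; 52; 55; 57; 58; 59; 63; 65;
   67; 69; 73; 84; 87; 88; 131; 132; 135; 136]; [:: 5; 18; 20; 21; 23; 24; 25; 28; 29; 31; 33; 34;
   35; 38; 39; 44; 50; 51; 59; 61; 65; 73; 76; 80; 81; 87; 88; 122; 123; 126; 127]; [:: 2; 5; 8;
   9; 20; 21; 23; 24; 25; 28; 29; 31; 33; 34; 35; 37; 38; 44; 49; 51; 57; 59; 65; 73; 80; 87; 88];
   [:: 2; 5; 7; 9; 18; 19; 23; 24; 25; 26; 27; 28; 31; 34; 51; 52; 53; 57; 58; 61; 63; 65; 69; 78;
   79; 84; 88; 89; 107; 108; 135; 136]; [:: 5; 7; 8; 19; 23; 24; 25; 28; 29; 32; 34; 39; 43; 46;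
   49; 50; 51; 52; 57; 59; 61; 65; 67; 69; 84; 88; 135; 136]; [:: 2; 5; 8; 18; 23; 24; 25; 29; 31;
   32; 33; 34; 39; 50; 51; 58; 59]; [:: 5; 9; 23; 24; 25; 26; 33; 34; 43; 46; 49; 51; 63; 67];
   [:: 2; 7; 18; 19; 20; 25; 27; 28; 29; 30; 34; 39; 42; 44; 46; 51; 52; 53; 57; 59; 61; 63; 65;
   67; 69; 76; 78; 79; 88; 102; 103; 126; 127]; [:: 2; 7; 9; 19; 20; 25; 26; 31; 34; 39; 42; 44;
   46; 49; 50; 51; 52; 59; 61; 67; 69]; [:: 2; 8; 9; 18; 20; 24; 25; 29; 31; 33; 34; 44; 49; 50;
   51; 57; 58; 59; 60; 61; 65; 76; 88; 126; 127]; [:: 2; 8; 20; 24; 25; 26; 28; 33; 34; 44; 51;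
   58; 59; 60; 61; 63]; [:: 7; 8; 18; 19; 24; 25; 26; 27; 31; 34; 39; 49; 51; 52; 53; 61; 63; 65;
   69; 79; 88]; [:: 7; 8; 9; 19; 24; 25; 26; 28; 31; 32; 34; 39; 43; 46; 50; 51; 52; 58; 59; 63;
   67; 69]; [:: 9; 18; 24; 25; 28; 29; 31; 32; 33; 34; 49; 50; 51; 57; 59; 60]; [:: 24; 25; 29;
   31; 33; 34; 43; 46; 51; 57; 58; 60; 61; 65; 67; 88]; [:: 4; 5; 9; 16; 22; 26; 30; 32; 33; 34;
   35; 36; 40; 42; 44; 45; 47; 48; 49; 51; 52; 53; 57; 59; 60; 61; 63; 67; 68; 69; 73; 74; 76; 77;
   78; 79; 81; 82; 83; 84; 85; 86; 87; 88; 91; 92; 95; 98; 99; 106; 108; 114; 115; 118; 119; 130;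
   132; 134; 136]; [:: 3; 4; 5; 10; 16; 19; 22; 26; 31; 34; 35; 36; 37; 39; 40; 42; 44; 47; 51;
   52; 57; 63; 67; 73; 82; 84; 87; 88; 130; 132; 134; 136]; [:: 3; 5; 9; 10; 31; 33; 36; 37; 38;
   39; 41; 45; 46; 47; 49; 51; 58; 60; 65; 67; 69; 75; 76; 81; 82; 84; 85; 87; 88; 114; 115; 118;
   119]; [:: 5; 19; 32; 36; 38; 41; 46; 47; 51; 58; 59; 61; 65; 67; 75; 82; 84; 87; 88]; [:: 4; 5;
   9; 10; 13; 16; 26; 33; 34; 40; 43; 45; 46; 47; 48; 51; 52; 53; 57; 58; 59; 60; 63; 67; 68; 69;
   74; 77; 79; 83; 84; 85; 88; 106; 108; 134; 136]; [:: 3; 4; 5; 13; 16; 19; 29; 34; 39; 40; 47;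
   49; 51; 52; 59; 84; 88; 134; 136]; [:: 5; 9; 10; 13; 29; 33; 39; 40; 41; 43; 45; 46; 47; 49;
   51; 57; 59; 61; 65; 67; 69; 85]; [:: 3; 5; 13; 19; 26; 40; 41; 47; 51; 58; 59; 60; 61; 63; 65];
   [:: 4; 16; 29; 30; 31; 33; 34; 39; 41; 42; 43; 44; 45; 47; 48; 51; 52; 53; 58; 59; 60; 65; 67;
   68; 69; 75; 76; 77; 79; 82; 84; 85; 88; 89; 98; 99; 118; 119]; [:: 3; 4; 9; 10; 16; 19; 26; 29;
   32; 34; 39; 40; 41; 42; 46; 47; 49; 51; 52; 60; 61; 63; 65; 82]; [:: 3; 10; 29; 33; 40; 43; 44;
   45; 47; 51; 57; 58; 60; 61; 69; 75; 76; 82; 84; 85; 88; 118; 119]; [:: 9; 19; 26; 29; 31; 32;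
   46; 47; 49; 51; 57; 59; 60; 63; 67; 82]; [:: 4; 10; 13; 16; 29; 31; 32; 33; 34; 39; 41; 45; 46;
   47; 48; 49; 51; 52; 53; 59; 60; 61; 65; 67; 68; 69; 75; 77; 78; 79; 84; 85; 88; 89]; [:: 3; 4;
   9; 13; 16; 19; 31; 32; 34; 39; 40; 41; 44; 46; 47; 51; 52; 57; 59; 60; 61; 65; 67]; [:: 10; 13;
   31; 33; 44; 45; 47; 51; 59; 69; 85]; [:: 3; 9; 13; 19; 29; 31; 40; 47; 49; 51; 57; 59; 75; 84;
   88]; [:: 5; 19; 22; 29; 30; 31; 34; 37; 42; 43; 51; 52; 53; 59; 65; 69; 73; 74; 76; 77; 79; 81;
   84; 86; 87; 88; 89; 95; 108; 132; 136]; [:: 5; 19; 22; 29; 31; 34; 39; 42; 43; 49; 50; 51; 52;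
   59; 61; 65; 69; 73; 84; 87; 88; 132; 136]; [:: 5; 9; 26; 29; 31; 33; 35; 38; 39; 44; 50; 51;
   57; 59; 61; 63; 75; 76; 80; 81; 87; 88]; [:: 5; 9; 26; 29; 31; 33; 35; 37; 38; 44; 49; 51; 57;
   59; 63; 75; 80; 87; 88]; [:: 5; 19; 26; 34; 43; 44; 46; 49; 51; 52; 53; 57; 63; 67; 69; 74; 77;
   78; 79; 84; 88; 89; 108; 136]; [:: 5; 19; 29; 31; 32; 34; 39; 44; 50; 51; 52; 58; 59; 69; 84;
   88; 136]; [:: 5; 9; 29; 31; 33; 39; 44; 46; 50; 51; 57; 59; 61; 65; 67]; [:: 5; 9; 26; 32; 33;
   43; 44; 49; 51; 58; 61; 63; 65]; [:: 9; 19; 26; 30; 34; 39; 42; 43; 49; 51; 52; 53; 57; 59; 61;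
   63; 69; 75; 76; 77; 78; 79; 88]; [:: 9; 19; 32; 34; 39; 42; 43; 44; 46; 50; 51; 52; 57; 58; 59;
   67; 69]; [:: 26; 32; 33; 46; 49; 50; 51; 59; 60; 63; 65; 67; 75; 76; 88]; [:: 33; 44; 51; 58;
   59; 60; 61; 65]; [:: 9; 19; 29; 31; 34; 39; 43; 44; 46; 51; 52; 53; 61; 65; 67; 69; 75; 77; 79;
   88]; [:: 9; 19; 34; 39; 46; 49; 50; 51; 52; 57; 59; 61; 65; 67; 69]; [:: 32; 33; 49; 50; 51;
   59; 60]; [:: 29; 31; 32; 33; 43; 44; 51; 57; 60; 75; 88]; [:: 9; 11; 15; 18; 26; 31; 34; 43;
   46; 49; 51; 54; 55; 56; 57; 58; 59; 64; 66; 68; 69; 70; 71; 73; 74; 76; 78; 79; 81; 82; 83; 84;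
   85; 86; 87; 88; 90; 92; 94; 97; 99; 101; 103; 113; 115; 117; 119; 121; 123; 125; 127]; [:: 9;
   11; 15; 18; 26; 31; 34; 49; 51; 56; 57; 58; 60; 63; 64; 67; 69; 71; 73; 76; 80; 81; 82; 87; 88;
   121; 123; 125; 127]; [:: 11; 15; 22; 35; 37; 38; 44; 51; 55; 56; 57; 58; 61; 62; 63; 64; 65;
   66; 69; 72; 75; 76; 81; 82; 84; 85; 87; 88; 113; 115; 117; 119]; [:: 11; 15; 22; 35; 37; 38;
   43; 44; 46; 51; 54; 56; 57; 58; 59; 60; 61; 62; 64; 65; 67; 69; 72; 75; 76; 80; 81; 82; 87;
   88]; [:: 9; 18; 29; 34; 43; 46; 49; 51; 54; 57; 59; 61; 63; 64; 65; 66; 67; 68; 69; 70; 71; 74;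
   76; 79; 83; 85; 88; 89; 101; 103; 125; 127]; [:: 9; 18; 29; 34; 49; 51; 57; 61; 64; 65; 69; 71;
   76; 88; 125; 127]; [:: 29; 31; 43; 46; 51; 54; 59; 63; 64; 65; 66; 67; 69; 72; 85]; [:: 29; 31;
   51; 64; 65; 69; 72]; [:: 9; 11; 15; 18; 29; 34; 43; 46; 49; 51; 54; 58; 61; 62; 66; 68; 69; 70;
   71; 75; 76; 79; 82; 84; 85; 88; 89; 97; 99; 117; 119]; [:: 9; 11; 15; 18; 26; 29; 34; 43; 44;
   46; 49; 51; 58; 59; 60; 61; 63; 65; 69; 71; 82]; [:: 11; 15; 29; 31; 32; 46; 51; 59; 65; 66;
   67; 69; 72; 75; 76; 82; 84; 85; 88; 117; 119]; [:: 11; 15; 26; 29; 31; 32; 44; 46; 51; 54; 60;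
   62; 63; 67; 69; 72; 82]; [:: 9; 18; 26; 31; 34; 43; 46; 49; 51; 54; 62; 63; 65; 66; 67; 68; 69;
   70; 71; 75; 76; 78; 79; 85; 88]; [:: 9; 18; 31; 34; 43; 44; 46; 49; 51; 59; 67; 69; 71];
   [:: 32; 43; 44; 51; 54; 57; 58; 61; 62; 65; 66; 69; 72; 85]; [:: 26; 32; 43; 51; 57; 58; 59;
   61; 63; 69; 72; 75; 76; 88]; [:: 18; 19; 29; 32; 33; 34; 35; 37; 44; 46; 51; 55; 58; 59; 60;
   61; 63; 65; 67; 69; 73; 74; 76; 79; 81; 84; 86; 87; 88; 89; 94; 103; 123; 127]; [:: 9; 18; 29;
   31; 34; 35; 37; 43; 44; 50; 51; 58; 59; 60; 61; 65; 73; 76; 80; 81; 87; 88; 123; 127]; [:: 9;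
   19; 22; 26; 29; 31; 32; 33; 35; 37; 38; 43; 46; 49; 50; 51; 55; 58; 60; 61; 67; 69; 75; 84; 87;
   88]; [:: 22; 26; 29; 35; 37; 38; 49; 51; 58; 60; 61; 63; 75; 80; 87; 88]; [:: 18; 19; 29; 33;
   34; 43; 44; 46; 51; 57; 58; 60; 61; 63; 65; 67; 69; 74; 76; 78; 79; 88; 103; 127]; [:: 9; 18;
   29; 31; 32; 34; 44; 50; 51; 57; 58; 61; 65; 76; 88; 127]; [:: 9; 19; 26; 32; 33; 44; 49; 50;
   51; 57; 59; 60; 65; 69]; [:: 26; 31; 43; 44; 46; 49; 51; 57; 59; 63; 65; 67]; [:: 18; 19; 29;
   33; 34; 44; 51; 59; 60; 69; 75; 78; 79; 84; 88; 89]; [:: 9; 18; 34; 46; 50; 51; 57; 58; 60; 61;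
   65; 67]; [:: 9; 19; 29; 31; 32; 33; 43; 44; 46; 49; 50; 51; 58; 60; 61; 65; 67; 69; 75; 84;
   88]; [:: 31; 32; 43; 49; 51; 57; 59; 60]; [:: 18; 19; 29; 32; 33; 34; 43; 44; 51; 57; 60; 69;
   75; 79; 88]; [:: 9; 18; 32; 34; 43; 46; 50; 51; 58; 59; 61; 65; 67]; [:: 9; 19; 32; 33; 49; 50;
   51; 57; 59; 60; 69]; [:: 29; 32; 44; 46; 49; 51; 58; 61; 65; 67; 75; 88]; [:: 22; 26; 34; 35;
   37; 38; 44; 51; 57; 59; 61; 63; 67; 68; 69; 73; 76; 77; 78; 79; 81; 82; 83; 84; 85; 86; 87; 88;
   92; 99; 115; 119]; [:: 22; 26; 34; 38; 43; 44; 50; 51; 57; 58; 59; 60; 63; 67; 69; 73; 80; 82;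
   87; 88]; [:: 31; 43; 46; 49; 51; 65; 67; 69; 75; 76; 81; 82; 84; 85; 87; 88; 115; 119]; [:: 31;
   35; 37; 46; 49; 50; 51; 58; 60; 61; 65; 67; 69; 75; 80; 82; 87; 88]; [:: 26; 32; 34; 44; 46;
   51; 57; 58; 59; 63; 67; 68; 69; 77; 78; 79; 83; 85; 88; 89]; [:: 29; 31; 32; 34; 44; 50; 51;
   58; 69; 88]; [:: 29; 32; 44; 46; 49; 51; 57; 58; 59; 61; 65; 67; 69; 85]; [:: 26; 31; 32; 44;
   49; 50; 51; 58; 61; 63; 65; 69]; [:: 29; 31; 34; 44; 51; 65; 67; 68; 69; 74; 75; 76; 77; 79;
   82; 84; 85; 88; 89; 99; 119]; [:: 26; 29; 31; 34; 46; 50; 51; 58; 60; 61; 63; 65; 69; 82];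
   [:: 29; 32; 43; 44; 49; 51; 57; 58; 59; 61; 69; 75; 76; 82; 84; 85; 88; 119]; [:: 26; 29; 32;
   43; 46; 49; 50; 51; 57; 59; 60; 63; 67; 69; 82]; [:: 29; 31; 32; 34; 44; 46; 51; 58; 61; 65;
   67; 68; 69; 74; 75; 77; 79; 85; 88]; [:: 32; 34; 43; 46; 50; 51; 57; 58; 59; 61; 65; 67; 69];
   [:: 31; 49; 51; 69; 85]; [:: 29; 43; 44; 49; 50; 51; 57; 59; 69; 75; 88]; [:: 9; 19; 22; 29;
   31; 32; 33; 34; 38; 43; 49; 51; 59; 60; 65; 69; 73; 76; 77; 79; 81; 84; 86; 87; 88; 89];
   [:: 22; 29; 34; 35; 37; 38; 49; 51; 58; 60; 61; 65; 73; 80; 87; 88]; [:: 9; 19; 26; 29; 32; 33;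
   44; 50; 51; 57; 60; 63; 69; 75; 84; 87; 88]; [:: 26; 29; 31; 35; 37; 43; 44; 50; 51; 57; 58;
   59; 60; 61; 63; 75; 76; 80; 81; 87; 88]; [:: 9; 19; 26; 32; 33; 34; 46; 49; 51; 57; 60; 63; 67;
   69; 77; 79; 88]; [:: 29; 34; 49; 51; 88]; [:: 9; 19; 26; 31; 33; 43; 50; 51; 58; 59; 60; 61;
   63; 65; 69]; [:: 29; 31; 32; 43; 46; 50; 51; 57; 58; 59; 61; 65; 67]; [:: 9; 19; 29; 31; 33;
   34; 43; 46; 49; 51; 58; 59; 60; 61; 65; 67; 69; 74; 75; 77; 78; 79; 84; 88; 89]; [:: 31; 34;
   43; 44; 46; 49; 51; 57; 58; 59; 60; 61; 65; 67]; [:: 9; 19; 29; 32; 33; 50; 51; 57; 60; 69; 75;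
   84; 88]; [:: 32; 44; 50; 51; 60]; [:: 9; 19; 26; 33; 34; 49; 51; 57; 58; 60; 61; 63; 69; 74;
   75; 76; 77; 78; 79; 88]; [:: 31; 34; 43; 44; 46; 49; 51; 57; 59; 67]; [:: 9; 19; 31; 33; 43;
   44; 50; 51; 58; 59; 60; 61; 65; 69]; [:: 26; 46; 50; 51; 63; 65; 67; 75; 76; 88]].

Definition bit c i := odd (iter i half c).

(** Expansion along the column [a]; modulo 2 this is the determinant of the matrix with columns [a],
    [b], [c]. *)
Definition permanent3 a b c : bool :=
  (bit a 0 && ((bit b 1 && bit c 2) (+) (bit b 2 && bit c 1))) (+)
  ((bit a 1 && ((bit b 0 && bit c 2) (+) (bit b 2 && bit c 0))) (+)
   (bit a 2 && ((bit b 0 && bit c 1) (+) (bit b 1 && bit c 0)))).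

(** The columns used are the three vertices off the edge, that is, the variables of its letter. *)
Definition plucker (p : seq nat) (e : vedge) : bool :=
  if [seq nth 0 p k | k <- iota 0 5 & (k != e.1) && (k != e.2)] is [:: a; b; c]
  then permanent3 a b c else false.

(** A product of bits is 1 exactly when all of them are. So the functional of a subspace is 1 on a
    set of letters exactly when the set lies among the letters with nonzero Pluecker coordinate, and
    [value_rows] is an inclusion matrix. *)
Definition subbits (X Y : bitseq) := all (fun q => q.1 ==> q.2) (zip X Y).

Definition value_rows : seq bitseq :=
  let P := [seq [seq plucker p e | e <- all_edges] | p <- plane_codes] in
  [seq [seq subbits X Y | Y <- P] | X <- basis].

Fixpoint xor_rows n (V : seq bitseq) (s : seq nat) : bitseq :=
  if s is k :: s' then [seq q.1 (+) q.2 | q <- zip (nth [::] V k) (xor_rows n V s')]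
  else nseq n false.

Lemma inverse_ok :
  let V := value_rows in
  [&& size plane_codes == 155, size inverse_rows == 155,
      all (fun s => uniq s && all (fun k => k < 155) s) inverse_rows,
      all (fun r => size r == 155) V &
      map (xor_rows 155 V) inverse_rows == [seq [seq i == j | j <- iota 0 155] | i <- iota 0 155]].
Proof. by vm_cast_no_check (erefl true). Qed.

Local Open Scope ring_scope.

Definition form (c : nat) : {mpoly 'F_2[3]} := \sum_(i < 3) (bit c i)%:R *: 'X_i.
Definition forms (p : seq nat) (j : 'I_5) := form (nth 0%N p j).

Lemma forms_lin p j : exists c : 'I_3 -> 'F_2, forms p j = \sum_i c i *: 'X_i.
Proof. by exists (fun i => (bit (nth 0%N p j) i)%:R). Qed.

Lemma addb_F2 (a b : bool) : (a (+) b)%:R = a%:R + b%:R :> 'F_2.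
Proof. by case: a; case: b; apply/val_inj. Qed.

Lemma andb_F2 (a b : bool) : (a && b)%:R = a%:R * b%:R :> 'F_2.
Proof. by rewrite -natrM mulnb. Qed.

Lemma U3_ones (i j k : 'I_3) :
  (U_(i) + (U_(j) + U_(k)) == ones3)%MM = uniq [:: val i; val j; val k].
Proof.
apply/eqP/idP => [/mnmP h|u].
  have := h i; have := h j; have := h k; rewrite !mnmDE !mnmE !eqxx /=.
  rewrite !inE !negb_or -!val_eqE /= (eq_sym (val j) (val i)) (eq_sym (val k) (val i)).
  by rewrite (eq_sym (val k) (val j)); do 3 case: (_ == _).
apply/mnmP => x; rewrite !mnmDE !mnmE -!val_eqE /=; move: u.
by case: i j k x => [[|[|[|]]] ?] // [[|[|[|]]] ?] // [[|[|[|]]] ?] // [[|[|[|]]] ?].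
Qed.

Lemma coef_forms a b c : (form a * form b * form c)@_ones3 = (permanent3 a b c)%:R.
Proof.
have -> : (form a * form b * form c)@_ones3 =
    \sum_(i < 3) \sum_(j < 3) \sum_(k < 3)
      (bit a i)%:R * (bit b j)%:R * (bit c k)%:R * (uniq [:: val i; val j; val k])%:R.
  rewrite /form -mulrA mulr_suml raddf_sum; apply: eq_bigr => i _ /=.
  rewrite mulr_suml mulr_sumr raddf_sum; apply: eq_bigr => j _ /=.
  rewrite !mulr_sumr raddf_sum; apply: eq_bigr => k _ /=.
  rewrite -!scalerAr -!scalerAl -!scalerAr !mcoeffZ -!mpolyXD mcoeffX U3_ones.
  by ring.
rewrite !big_ord_recl !big_ord0 /= /permanent3 !(addb_F2, andb_F2) /bump /=.
ring.
Qed.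

Lemma letter_vlab (i j : nat) (k : 'I_5) : (i < 5)%N -> (j < 5)%N ->
  letter (vlab (i, j)) k = ((k != i :> nat) && (k != j :> nat))%N.
Proof. by move=> i5 j5; rewrite mnmE !inE negb_or -!val_eqE /= !inordK. Qed.

Lemma minor_vlab p e : e \in all_edges ->
  minor (forms p) (letter (vlab e)) = (plucker p e)%:R.
Proof.
rewrite /minor /mmap1 !big_ord_recl big_ord0 /forms /=.
by rewrite !inE; do ![case/orP|move/eqP->]; rewrite !letter_vlab //= ?expr0 ?expr1 ?mul1r ?mulr1
  ?mulrA coef_forms.
Qed.

Lemma prod_minor (T : Type) (w : seq T) (F : T -> 'F_2) :
  \prod_(e <- w) F e = (all (fun e => F e == 1) w)%:R.
Proof.
elim: w => [|e w IH]; first by rewrite big_nil.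
rewrite big_cons IH /= andb_F2; congr (_ * _).
by case: (F e) => [[|[|]]] // i; apply/val_inj.
Qed.

Lemma all_mask (T : Type) (a : pred T) m s :
  all a (mask m s) = all (fun q => q.1 ==> q.2) (zip m (map a s)).
Proof. by elim: s m => [|x s IH] [|[] m] //=; rewrite IH. Qed.

Lemma phi_canw p n X : size X = 10%N -> has id X -> (count id X <= n)%N ->
  phi (forms p) n 'X_[mon (canw n X)] = (subbits X [seq plucker p e | e <- all_edges])%:R.
Proof.
move=> sX hX Xn.
have := phi_mon (forms_lin p) (canw_edgeb n sX hX); rewrite size_canw // => ->.
rewrite prod_minor (eq_all_r (mem_canw n sX hX)) all_map; congr (_%:R).
rewrite /subbits -all_mask; congr nat_of_bool.
apply: eq_in_all => e /mem_mask eE /=; rewrite minor_vlab //.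
by case: (plucker p e).
Qed.


Lemma xor_rowsE n V s j : all (fun r => size r == n) V -> all (fun k => (k < size V)%N) s ->
  (j < n)%N -> (nth false (xor_rows n V s) j)%:R =
  \sum_(k <- s) (nth false (nth [::] V k) j)%:R :> 'F_2.
Proof.
move=> /all_nthP Vn sV jn.
suff [] : size (xor_rows n V s) = n /\ (nth false (xor_rows n V s) j)%:R =
  \sum_(k <- s) (nth false (nth [::] V k) j)%:R :> 'F_2 by [].
elim: s sV => [|k s IH] /=; first by rewrite big_nil size_nseq nth_nseq jn.
case/andP=> kV /IH [sz E]; have /eqP szk := Vn [::] k kV.
rewrite size_map size_zip szk sz minnn; split=> //.
rewrite big_cons -E (nth_map (false, false)) ?size_zip ?szk ?sz ?minnn //.
by rewrite nth_zip ?szk ?sz //= addb_F2.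
Qed.

Lemma sum_seq_ord n (s : seq nat) (F : nat -> 'F_2) : uniq s -> all (fun k => (k < n)%N) s ->
  \sum_(k <- s) F k = \sum_(k < n) ((k : nat) \in s)%:R * F k.
Proof.
move=> us /allP sn.
have ps : perm_eq s [seq k <- iota 0 n | k \in s].
  apply: uniq_perm; rewrite ?filter_uniq ?iota_uniq // => k.
  rewrite mem_filter mem_iota add0n leq0n /=.
  by case: (boolP (k \in s)) => // /sn ->.
rewrite (perm_big _ ps) /= big_filter big_mkcond /= -[X in iota 0 X]subn0 big_mkord.
by apply: eq_bigr => k _; case: (_ \in _); rewrite ?mul1r ?mul0r.
Qed.

Definition value k j : bool := nth false (nth [::] value_rows k) j.

Lemma size_basis : size basis = 155%N.
Proof. by have /and5P[_ /eqP] := basis_ok. Qed.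

(** The lists in [I] are the supports of the rows of a left inverse [N]; for square matrices a
    one-sided inverse is enough. *)
Lemma xor_rows_unit n V (I : seq (seq nat)) : size V = n -> size I = n ->
  all (fun s => uniq s && all (fun k => k < n)%N s) I -> all (fun r => size r == n) V ->
  map (xor_rows n V) I = [seq [seq i == j | j <- iota 0 n] | i <- iota 0 n] ->
  (\matrix_(k < n, j < n) (nth false (nth [::] V k) j)%:R : 'M['F_2]_n) \in unitmx.
Proof.
move=> sV sI /allP rowsI Vn E; set M := (\matrix_(_, _) _).
pose N : 'M['F_2]_n := \matrix_(i, k) ((k : nat) \in nth [::] I i)%:R.
suff /mulmx1_unit [] : N *m M = 1%:M by [].
apply/matrixP => i j; rewrite !mxE.
have iI : (i < size I)%N by rewrite sI.
have /andP[us sn] := rowsI _ (mem_nth [::] iI).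
under eq_bigr do rewrite !mxE.
rewrite -(sum_seq_ord (fun k => (nth false (nth [::] V k) j)%:R) us sn) -(xor_rowsE Vn) ?sV //.
have /(congr1 (fun t => nth false (nth [::] t i) j)) := E.
rewrite (nth_map [::]) // => ->.
by rewrite (nth_map 0%N) ?size_iota // (nth_map 0%N) ?size_iota // !nth_iota.
Qed.

Lemma size_value_rows : size value_rows = 155%N.
Proof. by rewrite size_map size_basis. Qed.

Lemma values_unit : (\matrix_(k < 155, j < 155) (value k j)%:R : 'M['F_2]_155) \in unitmx.
Proof.
have /and5P[_ /eqP sI rowsI V155 /eqP E] := inverse_ok.
exact: (xor_rows_unit size_value_rows sI rowsI V155 E).
Qed.

Lemma valueE (k j : 'I_155) : value k j =
  subbits (nth [::] basis k) [seq plucker (nth [::] plane_codes j) e | e <- all_edges].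
Proof.
have /and5P[/eqP sP _ _ _ _] := inverse_ok.
rewrite /value /value_rows (nth_map [::]) ?size_basis //.
by rewrite (nth_map [::]) ?size_map ?sP // (nth_map [::]) ?sP.
Qed.

Lemma basisP k : (k < 155)%N -> let X := nth [::] basis k in
  [/\ size X = 10%N, has id X & (count id X <= 5)%N].
Proof.
move=> k155; have /and5P[_ _ _ /allP h _] := basis_ok.
have /h /and3P[/eqP] : nth [::] basis k \in basis by rewrite mem_nth ?size_basis.
by [].
Qed.

(** * The bases of the two quotient spaces *)

Definition bmon d k : P5 := 'X_[mon (canw d (nth [::] basis k))].

(** The [j]-th functional turns the relation into the [j]-th entry of [u *m M = 0], and [M] is
    invertible. With coefficients indexed by [nat], the statement also serves the first 90
    elements. *)
Lemma bmon_free d (c : nat -> 'F_2) : (5 <= d)%N ->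
  equivw (three_d d) (\sum_(k < 155) c k *: bmon d k) 0 ->
  forall k : 'I_155, c k = 0.
Proof.
move=> d5 h0.
pose u : 'rV['F_2]_155 := \row_k c k.
set M := (\matrix_(k < 155, j < 155) (value k j)%:R : 'M['F_2]_155).
have uM : u *m M = 0.
  apply/rowP => j; rewrite !mxE.
  have := phi_equiv (forms_lin (nth [::] plane_codes j)) h0.
  rewrite phi_sum => E; rewrite -[RHS]E; apply: eq_bigr => k _.
  have [sX hX Xn] := basisP (ltn_ord k).
  by rewrite phiZ !mxE phi_canw ?valueE // (leq_trans Xn).
move=> k; have : u 0 k = 0 by rewrite -(mulmxK values_unit u) uM mul0mx mxE.
by rewrite mxE.
Qed.

Lemma equivw_hit d f g : hit d (f + g) -> equivw (three_d d) f g.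
Proof.
case=> s [/allP s0 lows].
exists (\sum_(x <- s) Sq_mon x.1 x.2), (f + g + \sum_(x <- s) Sq_mon x.1 x.2).
split; last first.
  by split=> //; rewrite [RHS]addrC -[RHS]addrA addpp addr0.
exists [seq (x.1, 'X_[x.2]) | x <- s]; split.
  by rewrite all_map; apply/allP => x /s0 /andP[].
rewrite big_map; apply: eq_bigr => x _ /=.
by rewrite /Sq msuppX big_seq1 mcoeffX eqxx scale1r.
Qed.

Lemma hit_equivw0 d f : supported (low d) f -> equivw (three_d d) f 0.
Proof. by move=> lf; apply: equivw_hit; rewrite addr0; apply: hit_low. Qed.

Lemma bmon_mon d k : (5 <= d)%N -> (k < 155)%N ->
  mdeg (mon (canw d (nth [::] basis k))) = degw (three_d d) /\
  forall i, omega (mon (canw d (nth [::] basis k))) i = wv (three_d d) i.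
Proof.
move=> d5 k155; have [sX hX X5] := basisP k155.
have sz : size (canw d (nth [::] basis k)) = d by rewrite size_canw // (leq_trans X5).
have he := canw_edgeb d sX hX.
by split=> [|i]; [rewrite mdeg_mon ?sz|rewrite omega_mon ?sz].
Qed.

Lemma bmon_inP d k : (5 <= d)%N -> (k < 155)%N -> inP (three_d d) (bmon d k).
Proof.
move=> d5 k155 m; rewrite msuppX inE => /eqP ->.
by have [? ?] := bmon_mon d5 k155; split=> //; left.
Qed.

Lemma inspan_sum n Bs d w : size Bs = n -> inspan Bs d w ->
  exists c : 'I_n -> 'F_2,
    hit d ('X_[mon w] + \sum_(i < n) c i *: 'X_[mon (canw d (nth [::] Bs i))]).
Proof.
move=> sB [c hc]; exists (fun i => (c (nth [::] Bs i))%:R).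
move: hc; rewrite big_mkcond (big_nth [::]) sB big_mkord; congr (hit _ (_ + _)).
by apply: eq_bigr => i _; case: (c _); rewrite ?scale1r ?scale0r.
Qed.

Lemma inP_word d m : (mdeg m = degw (three_d d) /\ wle (omega m) (wv (three_d d))) ->
  low d m \/ exists w, [/\ {subset w <= edges5}, size w = d & mon w = m].
Proof. by case=> dm [eqm|ltm]; [right; apply: weight_word|left]. Qed.

Lemma positive_nth k : (k < 90)%N -> nth [::] positive_basis k = nth [::] basis k.
Proof.
have /and5P[_ _ /eqP s90 _ _] := basis_ok.
by rewrite /basis nth_cat s90 => ->.
Qed.

Lemma positive_posmon d k : (k < 90)%N -> posmon (mon (canw d (nth [::] basis k))).
Proof.
move=> k90; have /and5P[_ _ /eqP s90 _ /allP cov] := basis_ok.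
have [sX hX _] := basisP (ltn_trans k90 (isT : (90 < 155)%N)).
have : covers (nth [::] basis k) by rewrite -positive_nth //; apply/cov/mem_nth; rewrite s90.
move: (nth [::] basis k) sX hX => X sX hX /allP cX; apply: posmon_mon => v.
have : val v \in iota 0 5 by rewrite mem_iota /= ltn_ord.
move=> /cX /hasP [[b e] be /= /and3P[bt v1 v2]].
have eE : e \in mask X all_edges.
  by clear -be bt; elim: X (all_edges) be => [|[] X IH] [|f s] //=; rewrite inE;
    case/predU1P => [[bE ->]|/IH h]; rewrite ?mem_head ?inE ?h ?orbT // bE in bt *.
exists (vlab e); first by rewrite mem_canw //; apply: map_f.
have /allP /(_ _ (mem_mask eE)) /and3P[e1 e2 _] : all is_edge all_edges by [].
by rewrite -!val_eqE /= !inordK // v1 v2.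
Qed.

Theorem theorem4 (d : nat) (hd : (5 <= d)%N) :
  dimQPplus (three_d d) 90 /\ dimQP (three_d d) 155.
Proof.
have s90 : size positive_basis = 90%N by have /and5P[_ _ /eqP] := basis_ok.
split.
- exists (fun i => bmon d i); split; [|split].
  + move=> i; have i155 : (i < 155)%N by apply: ltn_trans (ltn_ord i) _.
    split; first exact: bmon_inP.
    by move=> m; rewrite msuppX inE => /eqP ->; apply: positive_posmon.
  + move=> c h0 i.
    (* Extension by zero from 90 to 155 coefficients: the positive elements come first in [basis],
       so their independence is that of a subfamily. *)
    pose c' k : 'F_2 := if insub k is Some j then c j else 0.
    have c'E (j : 'I_90) : c' j = c j by rewrite /c' valK.
    rewrite -c'E; apply: (bmon_free (c := c') hd _ (widen_ord (isT : (90 <= 155)%N) i)).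
    rewrite (_ : \sum_(k < 155) _ = \sum_(k < 90) c k *: bmon d k) //.
    rewrite -(big_mkord xpredT (fun k => c' k *: bmon d k)).
    rewrite (big_cat_nat (n := 90)) //= big_mkord.
    rewrite [X in _ + X]big_nat_cond [X in _ + X]big1 ?addr0.
      by apply: eq_bigr => j _; rewrite c'E.
    move=> k /andP[/andP[k90 _] _]; rewrite /c' insubF ?scale0r //.
    by apply/negbTE; rewrite -leqNgt.
  (* A monomial of lower weight is zero in the quotient; any other is a word, whose letters cover
     all variables because the exponents are positive. *)
  move=> m pm /(_ m); rewrite msuppX mem_head => /(_ isT) /inP_word [lm|[w [we sw wm]]].
    exists (fun=> 0); rewrite big1 => [|i _]; last by rewrite scale0r.
    by apply: hit_equivw0; apply: supportedX.
  have cov v : exists2 e, e \in w & (v != e.1) && (v != e.2).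
    by apply: edge_posmon; rewrite wm; apply: (forallP pm).
  have [c hc] := inspan_sum s90 ((span_word hd sw we).2 cov).
  exists c; apply: equivw_hit; move: hc; rewrite wm; congr (hit _ (_ + _)).
  by apply: eq_bigr => i _; rewrite positive_nth.
exists (fun i => bmon d i); split; [|split].
- by move=> i; apply: bmon_inP.
- move=> c h0 i.
  pose c' k : 'F_2 := if insub k is Some j then c j else 0.
  have c'E (j : 'I_155) : c' j = c j by rewrite /c' valK.
  rewrite -c'E; apply: (bmon_free hd); move: h0; congr equivw.
  by apply: eq_bigr => j _; rewrite c'E.
move=> f hf.
have span m : m \in msupp f -> exists c : 'I_155 -> 'F_2,
    hit d ('X_[m] + \sum_(i < 155) c i *: bmon d i).
  move=> /hf /inP_word [lm|[w [we sw <-]]].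
    exists (fun=> 0); rewrite big1 => [|i _]; last by rewrite scale0r.
    by rewrite addr0; apply: hit_low; apply: supportedX.
  exact: inspan_sum size_basis (span_word hd sw we).1.
suff [c hc] : exists c : 'I_155 -> 'F_2, hit d (f + \sum_(i < 155) c i *: bmon d i).
  by exists c; apply: equivw_hit.
rewrite [f]mpolyE; elim: (msupp f) span => [|m s IH] span.
  exists (fun=> 0); rewrite big_nil add0r big1 => [|i _]; last by rewrite scale0r.
  exact: hit0.
have [c1 h1] := span m (mem_head _ _).
have [|c2 h2] := IH; first by move=> x xs; apply: span; rewrite inE xs orbT.
have {h1} h1 : hit d (f@_m *: 'X_[m] + \sum_(i < 155) (f@_m * c1 i) *: bmon d i).
  have -> : f@_m *: 'X_[m] + \sum_(i < 155) (f@_m * c1 i) *: bmon d i =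
      f@_m *: ('X_[m] + \sum_(i < 155) c1 i *: bmon d i).
    by rewrite scalerDr scaler_sumr; congr (_ + _); apply: eq_bigr => i _; rewrite scalerA.
  (* The only scalars are 0 and 1, so scaling a hit element gives zero or the element itself. *)
  case: (f@_m) => [[|[|//]] q].
    by rewrite (_ : Ordinal q = 0) ?scale0r; [apply: hit0|apply/val_inj].
  by rewrite (_ : Ordinal q = 1) ?scale1r //; apply/val_inj.
exists (fun i => f@_m * c1 i + c2 i); rewrite big_cons.
have := hitD h1 h2; congr hit.
rewrite addrACA; congr (_ + _); rewrite -big_split; apply: eq_bigr => i _.
by rewrite scalerDl.
Qed.
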